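(* Fix $\gamma\in(0,\infty)$ and $M\in(0,\infty)$. Then the process $u\mapsto L^{\rm resc,h}_n(u)$ defined in the context is tight in the space $\mathcal{C}([-M,M])$ of continuous functions on $[-M,M]$ (with the supremum norm), as $n\to\infty$.
   Context: Let $\omega_{i,j}$, $i,j\ge1$, be i.i.d. exponential random variables with parameter $1$, and $\omega_{i,j}=0$ if $i\le0$ or $j\le0$. For $(m,n)\in\mathbb{Z}^2$ let $L_{(0,0)\to(m,n)}$ be the maximum, over up-right paths $\pi=(\pi(0),\dots,\pi(\ell))$ in $\mathbb{Z}^2$ (steps $(1,0)$ or $(0,1)$) from $(0,0)$ to $(m,n)$, of $\sum_{k=1}^{\ell}\omega_{\pi(k)}$. Set $\beta_1=2(1+\gamma)^{2/3}\gamma^{4/3}$, $\beta_2=(1+\gamma)^{4/3}\gamma^{-1/3}$ and $$L^{\rm resc,h}_n(u)=\frac{L_{(0,0)\to(\gamma^2n+\beta_1un^{2/3},\,n)}-n\big(1+\sqrt{\gamma^2+\beta_1un^{-1/3}}\big)^2}{\beta_2n^{1/3}},$$ where coordinates are taken with integer parts and the process is regarded as a continuous function of $u$ (by linear interpolation). *)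

(* Defs.v *)
From HB Require Import structures.
From mathcomp Require Import all_boot all_order all_algebra.
From mathcomp Require Import finmap.
From mathcomp Require Import all_classical all_reals all_analysis.
Set Implicit Arguments. Unset Strict Implicit. Unset Printing Implicit Defensive.
Import Order.TTheory GRing.Theory Num.Theory.
Import numFieldNormedType.Exports.
Local Open Scope classical_set_scope.
Local Open Scope ring_scope.

Section Defs.
Context {R : realType}.

Definition mutually_independent d (T : measurableType d) (P : probability T R)
  (I : choiceType) (X : I -> {RV P >-> R}) : Prop :=
  forall (J : {fset I}) (B : I -> set R), (forall i, measurable (B i)) ->
    P (\bigcap_(i in [set` J]) (X i @^-1` B i)) =
    (\prod_(i <- J) P (X i @^-1` B i))%E.

(** [om i j] plays the role of omega_{i+1,j+1}: the family
    (omega_{i,j})_{i,j>=1} is i.i.d. exponential of parameter 1. *)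
Definition iid_exp1 d (T : measurableType d) (P : probability T R)
  (om : nat -> nat -> {RV P >-> R}) : Prop :=
  @mutually_independent _ _ P _ (fun ij : nat * nat => om ij.1 ij.2) /\
  forall i j (A : set R), measurable A ->
    P (om i j @^-1` A) = exponential_prob (1 : R) A.

(** weight at site (i,j) of Z^2 (i,j >= 0): omega_{i,j} if i,j >= 1, else 0;
    [om] is a deterministic realization. *)
Definition site_weight (om : nat -> nat -> R) (i j : nat) : R :=
  if (0 < i)%N && (0 < j)%N then om i.-1 j.-1 else 0.

(** An up-right path from (0,0) to (m,n) is encoded by its sequence of
    m+n steps (true = step (1,0), false = step (0,1)) with exactly m
    [true]'s; after k steps it is at pi(k) = (#true, #false) among the
    first k steps.  Its weight is sum_{k=1}^{m+n} omega_{pi(k)}. *)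
Definition path_weight (om : nat -> nat -> R) (m n : nat)
  (t : (m + n).-tuple bool) : R :=
  \sum_(1 <= k < (m + n).+1)
     site_weight om (count id (take k t)) (k - count id (take k t)).

(** a particular up-right path (all right steps first), used only as the
    seed of the (nonempty) maximum *)
Definition first_path (m n : nat) : (m + n).-tuple bool :=
  cat_tuple (nseq_tuple m true) (nseq_tuple n false).

Definition LPP (om : nat -> nat -> R) (m n : nat) : R :=
  \big[Num.max/path_weight om (first_path m n)]_(t : (m + n).-tuple bool
                                                 | count id t == m)
     path_weight om t.

(** endpoint with an integer first coordinate; no up-right path exists if
    a < 0 (this never happens for n large, uniformly in |u| <= M) *)
Definition LPPz (om : nat -> nat -> R) (a : int) (n : nat) : R :=
  if (a < 0)%R then 0 else LPP om `|a|%N n.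

Definition beta1 (g : R) : R := 2 * powR (1 + g) (2/3) * powR g (4/3).
Definition beta2 (g : R) : R := powR (1 + g) (4/3) * powR g (- (1/3)).

(** The rescaled process L^{resc,h}_n(u).  The first coordinate
    x = gamma^2 n + beta1 u n^{2/3} is taken with integer part, and the
    resulting step function of x is made continuous by linear
    interpolation between consecutive integers. *)
Definition Lresc (om : nat -> nat -> R) (g : R) (n : nat) (u : R) : R :=
  let nr : R := n%:R in
  let x := g ^+ 2 * nr + beta1 g * u * powR nr (2/3) in
  let k := Num.floor x in
  let th := x - k%:~R in
  let Lx := (1 - th) * LPPz om k n + th * LPPz om (k + 1) n in
  (Lx - nr * (1 + Num.sqrt (g ^+ 2 + beta1 g * u * powR nr (- (1/3)))) ^+ 2)
    / (beta2 g * powR nr (1/3)).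

End Defs.
Arguments mutually_independent {R d T} P {I} X.
Arguments iid_exp1 {R d T} P om.

(* Main.v *)
(** The proof uses only the stationary version of the model. Put independent weights of rates [a] and
    [1 - a] on the two axes; by Burke's theorem the increments of the passage time along every row
    are then i.i.d. exponential of rate [a], and those along every column of rate [1 - a]. Tilting
    the boundary weights computes an exponential moment of the passage time exactly, and
    Markov-type arguments with parameters within [O(n^(-1/3))] of the characteristic one show that
    the passage time fluctuates by [O(n^(1/3))], and that for [a] slightly above (below) the
    characteristic parameter the maximal path is very likely to leave the axes vertically
    (horizontally). On these events the increments of the original passage time along the
    top row are sandwiched between two i.i.d. exponential sequences. Ville's inequality applied to
    them on blocks of length [delta n^(2/3)] bounds the modulus of continuity, and tightness
    follows from the one-point bound at [u = 0] and the Arzela-Ascoli criterion. *)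

(* The exact exponential moment controls upper deviations only. The substitute for lower ones is a
   mean: at the characteristic parameter the stationary passage time has mean exactly $N$, so a
   bound on its expected excess over $N$ also bounds its expected deficit. The model with slightly
   smaller boundary weights inherits this because the passage time is convex in those weights. Its
   boundary can then be removed, since an axis weaker than the stationary one rarely gains on the
   bulk; this is seen by rotating the bulk by a half turn. The exit estimates are weak, of order
   $1/k$ for a parameter shifted by $k n^{-1/3}$, but they suffice: two exit events, one at each end
   of the window, serve all blocks, and only the oscillations inside the blocks need a union bound.
   With $\delta=\tau^2$ there are $O(\tau^{-2})$ blocks, each failing with probability
   $e^{-c/\tau}$. *)
Require Import Defs.
From HB Require Import structures.
From mathcomp Require Import all_boot all_order all_algebra.
From mathcomp Require Import finmap.
From mathcomp Require Import all_classical all_reals all_analysis.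
From mathcomp Require Import measurable_realfun interval_inference ring lra zify.
Set Implicit Arguments. Unset Strict Implicit. Unset Printing Implicit Defensive.
Import Order.TTheory GRing.Theory Num.Theory.
Import numFieldNormedType.Exports.
Local Open Scope classical_set_scope.
Local Open Scope ring_scope.

(** * Measures with a density, image measures, and the exponential law *)

Section density.
Context d (T : measurableType d) (R : realType).
Variables (mu : {measure set T -> \bar R}) (f : T -> R).
Hypotheses (mf : measurable_fun setT f) (f0 : forall x, 0 <= f x).
Local Open Scope ereal_scope.

Definition density_fun (A : set T) := \int[mu]_(x in A) (f x)%:E.

Let density0 : density_fun set0 = 0.
Proof. exact: integral_set0. Qed.

Let density_ge0 A : 0 <= density_fun A.
Proof. by apply: integral_ge0 => x _; rewrite lee_fin. Qed.

Let density_sigma_additive : semi_sigma_additive density_fun.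
Proof.
move=> /= F mF tF mUF; rewrite /density_fun; apply: cvg_toP.
  apply: ereal_nondecreasing_is_cvgn => m n mn.
  apply: lee_sum_nneg_natr => // k _ _; exact: density_ge0.
rewrite ge0_integral_bigcup//=.
- by apply/measurable_EFinP; exact: measurable_funTS.
- by move=> x _; rewrite lee_fin.
Qed.

Definition density_measure : {measure set T -> \bar R} :=
  HB.pack density_fun (isMeasure.Build _ _ _ density_fun
    density0 density_ge0 density_sigma_additive).

Lemma density_measureE A : density_measure A = \int[mu]_(x in A) (f x)%:E.
Proof. by []. Qed.

Import HBNNSimple.

(** True by construction for indicators, hence by linearity for the simple approximations of [g];
    monotone convergence is then used once for each of the two measures. *)
Lemma ge0_integral_density (g : T -> \bar R) :
  measurable_fun setT g -> (forall x, 0 <= g x) ->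
  \int[density_measure]_x g x = \int[mu]_x (g x * (f x)%:E).
Proof.
move=> mg g0.
have mfE : measurable_fun setT (EFin \o f) by exact/measurable_EFinP.
pose g_ := nnsfun_approx measurableT mg.
transitivity (limn (fun n => \int[density_measure]_x (g_ n x)%:E)).
  rewrite -monotone_convergence//.
  - apply: eq_integral => y _; apply/esym/cvg_lim => //.
    exact: cvg_nnsfun_approx.
  - by move=> n; exact/measurable_EFinP/measurable_funP.
  - by move=> n y _; rewrite lee_fin.
  - by move=> y _ m n mn; rewrite lee_fin; exact/lefP/nd_nnsfun_approx.
rewrite [X in limn X](_ : _ = (fun n => \int[mu]_x ((g_ n x)%:E * (f x)%:E))).
  rewrite -monotone_convergence//.
  - apply: eq_integral => y _; apply/cvg_lim => //.
    apply: cvgeZr => //; exact: cvg_nnsfun_approx.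
  - move=> n; apply: emeasurable_funM => //.
    exact/measurable_EFinP/measurable_funP.
  - by move=> n x _; rewrite mule_ge0// lee_fin.
  - move=> x _ m n mn; rewrite lee_wpmul2r ?lee_fin//.
    exact/lefP/nd_nnsfun_approx.
apply/funext => n.
under eq_integral do rewrite fimfunE -fsumEFin//.
rewrite ge0_integral_fsum//; last 2 first.
  - by move=> y; exact/measurable_EFinP/measurable_funM.
  - by move=> y x _; rewrite nnfun_muleindic_ge0.
transitivity (\sum_(r \in range (g_ n)) \int[mu]_x
    ((r * \1_(g_ n @^-1` [set r]) x)%:E * (f x)%:E)).
  apply: eq_fsbigr => r; rewrite inE => -[t _ tr].
  rewrite integralZl_indic_nnsfun// integral_indic// setIT.
  have r0 : (0 <= r)%R by rewrite -tr.
  under [RHS]eq_integral do rewrite EFinM -muleA.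
  rewrite ge0_integralZl_EFin//; last 2 first.
    - by move=> x _; rewrite mule_ge0// lee_fin.
    - by apply: emeasurable_funM => //; exact/measurable_EFinP.
  congr (_ * _); rewrite /density_measure/= /density_fun.
  rewrite [LHS]integral_mkcond/=; apply: eq_integral => x _.
  by rewrite patchE indicE; case: ifP => /=; rewrite ?mul1e ?mul0e.
rewrite -ge0_integral_fsum//; last 2 first.
- move=> r; apply: emeasurable_funM => //.
  by apply/measurable_EFinP/measurable_funM.
- by move=> r x _; rewrite mule_ge0 ?lee_fin// -lee_fin nnfun_muleindic_ge0.
apply: eq_integral => x _; rewrite [in RHS]fimfunE -fsumEFin//.
rewrite ge0_mule_fsuml// => r; exact: nnfun_muleindic_ge0.
Qed.

End density.

Section push.
Context d1 d2 (T1 : measurableType d1) (T2 : measurableType d2) (R : realType).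
Variables (m : {measure set T1 -> \bar R}) (f : T1 -> T2).
Hypothesis mf : measurable_fun [set: T1] f.

Definition push_measure : {measure set T2 -> \bar R} :=
  measure_function_pushforward__canonical__measure_function_Measure m mf.

Lemma push_measureE A : push_measure A = m (f @^-1` A).
Proof. by []. Qed.

Lemma ge0_integral_push (g : T2 -> \bar R) : measurable_fun setT g ->
  (forall x, 0 <= g x)%E -> (\int[push_measure]_y g y = \int[m]_x g (f x))%E.
Proof. by move=> mg g0; rewrite ge0_integral_pushforward. Qed.
End push.

Section exponential_law.
Context {R : realType}.
Notation leb := (@lebesgue_measure R).
Notation mR := (measurableTypeR R).
Local Open Scope ereal_scope.

(** A measure that agrees with Lebesgue measure on half-open intervals is Lebesgue measure; this is
    applied to the image under the translation. Scaling is treated in the same way. *)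
Lemma ge0_integral_shift (c : R) (g : mR -> \bar R) :
  measurable_fun setT g -> (forall x, 0 <= g x) ->
  \int[leb]_x g (x + c)%R = \int[leb]_x g x.
Proof.
move=> mg g0.
have ms : measurable_fun setT ((fun x => x + c)%R : mR -> mR) by exact: measurable_funD.
rewrite -(ge0_integral_push _ ms)//.
apply: eq_measure_integral => A mA _; apply/esym.
apply: lebesgue_measure_unique => // _ [[a b]] _ <-.
pose I : set R := `](a - c)%R, (b - c)%R]%classic.
rewrite push_measureE (_ : _ @^-1` _ = I); last first.
  by apply/seteqP; split => x; rewrite /I/= !in_itv/= ltrBlDr lerBrDr.
apply: (etrans _ (esym (lebesgue_measure_itv `](a - c)%R, (b - c)%R]))).
rewrite (lebesgue_measure_itv `]a, b])/= !lte_fin ltrD2r; case: ifP => // _.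
by rewrite -!EFinD; congr (_%:E); ring.
Qed.

Lemma ge0_integral_scale (k : R) (g : mR -> \bar R) : (0 < k)%R ->
  measurable_fun setT g -> (forall x, 0 <= g x) ->
  k%:E * \int[leb]_x g (k * x)%R = \int[leb]_x g x.
Proof.
move=> k0 mg g0.
have ms : measurable_fun setT ((fun x => k * x)%R : mR -> mR) by exact: measurable_funM.
rewrite -(ge0_integral_push _ ms)//.
pose kn : {nonneg R} := NngNum (ltW k0).
rewrite -[k]/(kn%:num) -(ge0_integral_mscale _ _ kn)//.
apply: eq_measure_integral => A mA _; apply/esym.
apply: lebesgue_measure_unique => // _ [[a b]] _ <-.
rewrite -[RHS]/(k%:E * leb ((fun x : mR => k * x)%R @^-1` `]a, b])).
pose I : set R := `](k^-1 * a)%R, (k^-1 * b)%R]%classic.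
rewrite (_ : _ @^-1` _ = I); last first.
  by apply/seteqP; split => x; rewrite /I/= !in_itv/= ltr_pdivrMl// ler_pdivlMl.
apply: (etrans _ (congr1 (fun z => k%:E * z) (esym (lebesgue_measure_itv `](k^-1 * a)%R, (k^-1 * b)%R])))).
rewrite (lebesgue_measure_itv `]a, b])/= !lte_fin ltr_pM2l ?invr_gt0//; case: ifP => // _; last by rewrite mule0.
by rewrite -!EFinD -EFinM; congr (_%:E); field; lra.
Qed.

Definition pos_rate (r : R) : R := if (0 < r)%R then r else 1%R.

Lemma pos_rate_gt0 r : (0 < pos_rate r)%R.
Proof. by rewrite /pos_rate; case: ifP. Qed.

Let expd_measure r : {measure set mR -> \bar R} :=
  density_measure leb (measurable_exponential_pdf (pos_rate r))
    (exponential_pdf_ge0 (ltW (pos_rate_gt0 r))).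

Let expd_setT r : expd_measure r setT = 1.
Proof. by rewrite /expd_measure/= /density_fun integral_exponential_pdf ?pos_rate_gt0. Qed.

Section expd_def.
Variable r : R.
Let expd_fun : set mR -> \bar R := expd_measure r.
HB.instance Definition _ := Measure.copy expd_fun (expd_measure r).
HB.instance Definition _ := Measure_isProbability.Build _ _ R expd_fun (expd_setT r).
Let expd_prob : probability mR R := expd_fun.

(** Closing this existence proof with [Qed] hides the density measure: afterwards [expd] is known
    only through these two facts, and unification cannot unfold its integrals. *)
Let expd_sig : {e : probability mR R | (0 < r)%R ->
  (forall A, e A = exponential_prob r A) /\
  (forall g : mR -> \bar R, measurable_fun setT g -> (forall x, 0 <= g x) ->
     \int[e]_x g x = \int[leb]_x (g x * (exponential_pdf r x)%:E))}.
Proof.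
exists expd_prob => r0; split=> [A|g mg g0].
  by rewrite -[LHS]/(density_fun leb (exponential_pdf (pos_rate r)) A) /density_fun /pos_rate r0.
apply: (etrans (ge0_integral_density leb (measurable_exponential_pdf (pos_rate r))
  (exponential_pdf_ge0 (ltW (pos_rate_gt0 r))) mg g0)).
by rewrite /pos_rate r0.
Qed.

(* For [r <= 0] this is a junk value, the law of rate 1. *)
Definition expd : probability mR R := sval expd_sig.

Lemma expdE A : (0 < r)%R -> expd A = exponential_prob r A.
Proof. by move=> r0; rewrite /expd; case: expd_sig => e /= /(_ r0)[]. Qed.

Lemma integral_expd (g : mR -> \bar R) : (0 < r)%R ->
  measurable_fun setT g -> (forall x, 0 <= g x) ->
  \int[expd]_x g x = \int[leb]_x (g x * (exponential_pdf r x)%:E).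
Proof. by move=> r0 mg g0; rewrite /expd; case: expd_sig => e /= /(_ r0)[_ ->]. Qed.

End expd_def.

Lemma eq_integral_expd r (g h : mR -> \bar R) : (0 < r)%R ->
  measurable_fun setT g -> (forall x, 0 <= g x) ->
  measurable_fun setT h -> (forall x, 0 <= h x) ->
  (forall x, 0 <= x -> g x = h x)%R ->
  \int[expd r]_x g x = \int[expd r]_x h x.
Proof.
move=> r0 mg g0 mh h0 gh; rewrite !integral_expd//; apply: eq_integral => x _.
have [x0|x0] := leP 0%R x; first by rewrite gh.
by rewrite lt0_exponential_pdf// !mule0.
Qed.

(** The law is an exponential family: $e^{\theta x}\,re^{-rx}$ is $r/(r-\theta)$ times the density
    of rate $r-\theta$. *)
Lemma integral_expd_tilt (r th : R) (g : mR -> \bar R) : (0 < r)%R -> (th < r)%R ->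
  measurable_fun setT g -> (forall x, 0 <= g x) ->
  \int[expd r]_x ((expR (th * x))%:E * g x) = (r / (r - th))%:E * \int[expd (r - th)]_x g x.
Proof.
move=> r0 thr mg g0; have rth : (0 < r - th)%R by lra.
have me : measurable_fun setT (fun x : mR => (expR (th * x))%:E).
  by apply/measurable_EFinP; apply: measurableT_comp => //; exact: measurable_funM.
rewrite !integral_expd//; last 2 first.
  exact: emeasurable_funM.
  by move=> x; rewrite mule_ge0// lee_fin expR_ge0.
rewrite -ge0_integralZl_EFin//; last 3 first.
- by move=> x _; rewrite mule_ge0// lee_fin exponential_pdf_ge0// ltW.
- apply: emeasurable_funM => //; apply/measurable_EFinP; exact: measurable_exponential_pdf.
- by rewrite divr_ge0// ltW.
apply: eq_integral => x _.
have [x0|x0] := leP 0%R x; last by rewrite !lt0_exponential_pdf// !mule0.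
rewrite !exponential_pdfE// [in LHS]muleC muleA -EFinM [in RHS]muleCA -EFinM [RHS]muleC; congr (_%:E * _).
rewrite -mulrA -expRD [RHS]mulrA divfK; last by rewrite gt_eqF.
by congr (_ * expR _)%R; ring.
Qed.

Lemma integral_expd_scale (r k : R) (g : mR -> \bar R) : (0 < r)%R -> (0 < k)%R ->
  measurable_fun setT g -> (forall x, 0 <= g x) ->
  \int[expd r]_x g (k * x)%R = \int[expd (r / k)]_x g x.
Proof.
move=> r0 k0 mg g0; have rk : (0 < r / k)%R by rewrite divr_gt0.
have mk : measurable_fun setT ((fun x => k * x)%R : mR -> mR) by exact: measurable_funM.
rewrite (integral_expd r0 (measurableT_comp mg mk) (fun x => g0 (k * x)%R)).
rewrite (integral_expd rk mg g0).
rewrite -[RHS](ge0_integral_scale k0); last 2 first.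
- apply: emeasurable_funM => //; apply/measurable_EFinP; exact: measurable_exponential_pdf.
- by move=> x; rewrite mule_ge0// lee_fin exponential_pdf_ge0// ltW.
rewrite -ge0_integralZl_EFin//; last 3 first.
- by move=> x _; rewrite mule_ge0// lee_fin exponential_pdf_ge0// ltW.
- apply: emeasurable_funM; first exact: measurableT_comp mk.
  apply/measurable_EFinP; apply: measurableT_comp mk; exact: measurable_exponential_pdf.
- exact: ltW.
apply: eq_integral => x _; rewrite muleCA; congr (_ * _).
have [x0|x0] := leP 0%R x; last first.
  by rewrite !lt0_exponential_pdf ?mule0// pmulr_rlt0.
rewrite !exponential_pdfE// ?mulr_ge0// 1?ltW// -EFinM; congr (_%:E).
rewrite mulrA mulrCA divff ?gt_eqF// mulr1; congr (_ * expR _)%R.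
by field; rewrite gt_eqF.
Qed.

Lemma integral_expd_memoryless (a y : R) (g : mR -> \bar R) : (0 < a)%R -> (0 <= y)%R ->
  measurable_fun setT g -> (forall x, 0 <= g x) ->
  \int[expd a]_x (if (y <= x)%R then g (x - y)%R else 0) = (expR (- (a * y)))%:E * \int[expd a]_x g x.
Proof.
move=> a0 y0 mg g0.
have mh : measurable_fun setT (fun x : mR => if (y <= x)%R then g (x - y)%R else 0).
  apply: measurable_fun_ifT => //; first exact: measurable_fun_ler.
  by apply: (measurableT_comp mg); exact: measurable_funB.
have h0 (x : mR) : 0 <= (if (y <= x)%R then g (x - y)%R else 0) by case: ifP.
have mp : measurable_fun setT (fun x : mR => (exponential_pdf a x)%:E).
  apply/measurable_EFinP; exact: measurable_exponential_pdf.
have p0 (x : mR) : 0 <= (exponential_pdf a x)%:E by rewrite lee_fin exponential_pdf_ge0// ltW.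
rewrite !integral_expd// -(ge0_integral_shift y); last 2 first.
- exact: emeasurable_funM.
- by move=> x; rewrite mule_ge0.
rewrite -ge0_integralZl_EFin//; last 2 first.
- by move=> x _; rewrite mule_ge0.
- exact: emeasurable_funM.
apply: eq_integral => x _; rewrite lerDr addrK.
have [x0|x0] := leP 0%R x; last by rewrite (lt0_exponential_pdf _ x0) !mule0 mul0e.
rewrite !exponential_pdfE// ?addr_ge0// [RHS]muleCA -EFinM; congr (_ * _%:E).
by rewrite [RHS]mulrCA -expRD; congr (_ * expR _)%R; ring.
Qed.

End exponential_law.

(** * Burke's theorem for one cell *)

Section burke_law.
Context {R : realType}.
Notation leb := (@lebesgue_measure R).
Notation mR := (measurableTypeR R).
Local Open Scope ereal_scope.

Lemma measurable_fun_section1 d d' (T1 : measurableType d) (T2 : measurableType d')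
  (F : T1 * T2 -> \bar R) x : measurable_fun setT F -> measurable_fun setT (fun y => F (x, y)).
Proof. by move=> mF; apply: measurableT_comp mF _; exact: measurable_pair1. Qed.

(** A case distinction on the order of two variables puts ties on one side only, so both forms of
    memorylessness are used; they differ on the null set [[set y]]. *)
Lemma integral_expd_memoryless_strict (a y : R) (g : mR -> \bar R) :
  (0 < a)%R -> (0 <= y)%R ->
  measurable_fun setT g -> (forall x, 0 <= g x) ->
  \int[expd a]_x (if (y < x)%R then g (x - y)%R else 0) =
  (expR (- (a * y)))%:E * \int[expd a]_x g x.
Proof.
move=> a0 y0 mg g0; rewrite -integral_expd_memoryless//.
have mgy : measurable_fun setT (fun x : mR => g (x - y)%R).
  by apply: (measurableT_comp mg); exact: measurable_funB.
have mlt : measurable_fun setT (fun x : mR => if (y < x)%R then g (x - y)%R else 0).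
  by apply: measurable_fun_ifT => //; exact: measurable_fun_ltr.
have mle : measurable_fun setT (fun x : mR => if (y <= x)%R then g (x - y)%R else 0).
  by apply: measurable_fun_ifT => //; exact: measurable_fun_ler.
rewrite !integral_expd//; try by move=> x; case: ifP.
apply: ae_eq_integral => //.
- apply: emeasurable_funM => //.
  by apply/measurable_EFinP; exact: measurable_exponential_pdf.
- apply: emeasurable_funM => //.
  by apply/measurable_EFinP; exact: measurable_exponential_pdf.
exists [set y]; split => //.
- exact: lebesgue_measure_set1.
- move=> x /=; apply: contra_notP => xy _; congr (_ * _).
  rewrite [(y <= x)%R]le_eqVlt; case: eqP => //= e; by rewrite e in xy.
Qed.

(** Both sides equal $\frac{b}{a+b}E F(w+t,w)$ with independent $w$ of rate $a+b$ and $t$ of rate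
    $a$. When $y$ is the smaller variable, memorylessness gives $x-y$ rate $a$, and the factor
    $e^{-ay}$ so produced tilts $y$ to rate $a+b$, the law of the fresh $w$. The relation [lt]
    stands for either the large or the strict inequality. *)
Let half (a b : R) (lt : R -> R -> bool) (F : mR * mR -> \bar R) :
  (0 < a)%R -> (0 < b)%R -> measurable_fun setT F -> (forall z, 0 <= F z) ->
  measurable_fun setT (fun z : mR * mR => lt z.1 z.2) ->
  (forall (y : R) (g : mR -> \bar R),
    (0 <= y)%R -> measurable_fun setT g -> (forall x, 0 <= g x) ->
    \int[expd a]_x (if lt y x then g (x - y)%R else 0) =
    (expR (- (a * y)))%:E * \int[expd a]_x g x) ->
  \int[expd b]_y \int[expd a]_x \int[expd (a + b)]_w
     (if lt y x then F (w + (x - y), w)%R else 0) =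
  \int[expd b]_y \int[expd a]_x (if lt y x then F (x, y) else 0).
Proof.
move=> a0 b0 mF F0 mlt mem; have ab0 : (0 < a + b)%R by exact: addr_gt0.
have mFt : measurable_fun setT (fun z : mR * mR => F (z.2 + z.1, z.2)%R).
  by apply: (measurableT_comp mF); apply: measurable_fun_pair => //; exact: measurable_funD.
have [Phi [PhiE mPhi Phi0]] : exists Phi : mR -> \bar R,
    [/\ forall t, Phi t = \int[expd (a + b)]_w F (w + t, w)%R,
       measurable_fun setT Phi & forall t, 0 <= Phi t].
  exists (fun t => \int[expd (a + b)]_w F (w + t, w)%R); split; first by move=> ?; exact: erefl.
    by apply: (@measurable_fun_fubini_tonelli_F _ _ _ _ _ (expd (a + b))
      (fun z : mR * mR => F (z.2 + z.1, z.2)%R)).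
  by move=> t; apply: integral_ge0.
have mFy : measurable_fun setT (fun z : mR * mR => F (z.1 + z.2, z.1)%R).
  by apply: (measurableT_comp mF); apply: measurable_fun_pair => //; exact: measurable_funD.
have [Psi [PsiE mPsi Psi0]] : exists Psi : mR -> \bar R,
    [/\ forall y, Psi y = \int[expd a]_t F (y + t, y)%R,
       measurable_fun setT Psi & forall y, 0 <= Psi y].
  exists (fun y => \int[expd a]_t F (y + t, y)%R); split; first by move=> ?; exact: erefl.
    by apply: (@measurable_fun_fubini_tonelli_F _ _ _ _ _ (expd a)
      (fun z : mR * mR => F (z.1 + z.2, z.1)%R)).
  by move=> t; apply: integral_ge0.
have mexp : measurable_fun setT (fun y : mR => (expR (- a * y))%:E).
  by apply/measurable_EFinP; apply: measurableT_comp => //; exact: measurable_funM.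
have Nab : (- a < b)%R by lra.
transitivity ((b / (a + b))%:E * \int[expd a]_x Phi x).
  transitivity (\int[expd b]_y \int[expd a]_x (if lt y x then Phi (x - y)%R else 0)).
    apply: eq_integral => y _; apply: eq_integral => x _; case: ifP => _.
      by rewrite PhiE.
    by rewrite integral0.
  have [C [CE C0]] : exists C, \int[expd a]_x Phi x = C /\ 0 <= C.
    by exists (\int[expd a]_x Phi x); split => //; exact: integral_ge0.
  transitivity (\int[expd b]_y ((expR (- a * y))%:E * C)).
    apply: (eq_integral_expd b0).
    - apply: (@measurable_fun_fubini_tonelli_F _ _ _ _ _ (expd a)
        (fun z : mR * mR => if lt z.1 z.2 then Phi (z.2 - z.1)%R else 0)); last by move=> z; case: ifP.
      apply: measurable_fun_ifT; [exact: mlt| |exact: measurable_cst].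
      by apply: (measurableT_comp mPhi); exact: measurable_funB.
    - by move=> y; apply: integral_ge0 => x _; case: ifP.
    - by apply: emeasurable_funM; [exact: mexp|exact: measurable_cst].
    - by move=> y; apply: mule_ge0; [rewrite lee_fin expR_ge0|].
    - by move=> y y0; rewrite (mem _ _ y0 mPhi Phi0) mulNr CE.
  rewrite (integral_expd_tilt b0 Nab (measurable_cst C) (fun=> C0)).
  rewrite CE opprK [(b + a)%R]addrC; congr (_ * _).
  rewrite (integral_cst (expd (a + b)) measurableT C) -[RHS]mule1; congr (_ * _).
  exact: probability_setT.
transitivity (\int[expd b]_y ((expR (- a * y))%:E * Psi y)); last first.
  apply: (eq_integral_expd b0).
  - by apply: emeasurable_funM; [exact: mexp|exact: mPsi].
  - by move=> y; apply: mule_ge0; [rewrite lee_fin expR_ge0|exact: Psi0].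
  - apply: (@measurable_fun_fubini_tonelli_F _ _ _ _ _ (expd a)
      (fun z : mR * mR => if lt z.1 z.2 then F (z.2, z.1) else 0)); last by move=> z; case: ifP.
    apply: measurable_fun_ifT; [exact: mlt| |exact: measurable_cst].
    by apply: (measurableT_comp mF); exact: measurable_fun_pair.
  - by move=> y; apply: integral_ge0 => x _; case: ifP.
  - move=> y y0; have mFy' := measurable_fun_section1 y mFy.
    rewrite mulNr PsiE -(mem _ _ y0 mFy' (fun x => F0 _)).
    by apply: eq_integral => x _; rewrite /= [(y + _)%R]addrC subrK.
rewrite (integral_expd_tilt b0 Nab mPsi Psi0).
rewrite opprK [(b + a)%R]addrC; congr (_ * _).
under eq_integral do rewrite PhiE.
under [RHS]eq_integral do rewrite PsiE.
rewrite (@fubini_tonelli _ _ _ _ _ (expd a) (expd (a + b)) (fun z : mR * mR => F (z.2 + z.1, z.2)%R) mFt (fun=> F0 _)).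
by apply: eq_integral => y _; apply: eq_integral => t _; rewrite addrC.
Qed.

(** Transport of a passage time increment across a unit cell: [x] is the increment on one incoming
    edge, [y] that on the other, [w] the weight of the cell, and the result is the increment on the
    edge opposite to that of [x]. *)
Definition burkeI (x y w : R) : R := (w + Num.max (x - y) 0)%R.

Lemma measurable_burkeI d (T : measurableType d) (f g h : T -> mR) :
  measurable_fun setT f -> measurable_fun setT g -> measurable_fun setT h ->
  measurable_fun setT (fun t => burkeI (f t) (g t) (h t) : mR).
Proof.
move=> mf mg mh; apply: measurable_funD => //.
by apply: measurable_maxr => //; exact: measurable_funB.
Qed.

(** Since $x=\min(x,y)+(x-y)^+$ and $y=\min(x,y)+(y-x)^+$, the map only replaces $\min(x,y)$ by $w$.
    The minimum has rate $a+b$ and is independent of $x-y$, so an independent [w] of that rate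
    leaves the joint law unchanged. The proof splits by the sign of $x-y$ and applies [half] to each
    part. *)
Lemma burke_law (a b : R) (F : mR * mR -> \bar R) : (0 < a)%R -> (0 < b)%R ->
  measurable_fun setT F -> (forall z, 0 <= F z) ->
  \int[expd a]_x \int[expd b]_y \int[expd (a + b)]_w F (burkeI x y w, burkeI y x w) =
  \int[expd a]_x \int[expd b]_y F (x, y).
Proof.
move=> a0 b0 mF F0.
pose F' (z : mR * mR) := F (z.2, z.1).
have mF' : measurable_fun setT F'.
  by apply: (measurableT_comp mF); exact: measurable_fun_pair.
have mle : measurable_fun setT (fun z : mR * mR => (z.1 <= z.2)%R) by exact: measurable_fun_ler.
have mlt : measurable_fun setT (fun z : mR * mR => (z.1 < z.2)%R) by exact: measurable_fun_ltr.
pose G1 (x y w : mR) := if (y <= x)%R then F (w + (x - y), w)%R else 0.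
pose G2 (x y w : mR) := if (x < y)%R then F (w, w + (y - x))%R else 0.
have G10 x y w : 0 <= G1 x y w by rewrite /G1; case: ifP.
have G20 x y w : 0 <= G2 x y w by rewrite /G2; case: ifP.
have GE x y w : F (burkeI x y w, burkeI y x w) = G1 x y w + G2 x y w.
  rewrite /G1 /G2 /burkeI ltNge; case: leP => xy /=.
    by rewrite adde0 (max_idPl _) ?subr_ge0// (max_idPr _) ?subr_le0// addr0.
  by rewrite add0e (max_idPr _) ?subr_le0 1?ltW// (max_idPl _) ?subr_ge0 1?ltW// addr0.
have mG1 : measurable_fun setT (fun z : (mR * mR) * mR => G1 z.1.1 z.1.2 z.2).
  apply: measurable_fun_ifT => //.
  - apply: measurable_fun_ler; exact: measurableT_comp.
  - apply: (measurableT_comp mF); apply: measurable_fun_pair => //; apply: measurable_funD => //.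
    by apply: measurable_funB; exact: measurableT_comp.
have mG2 : measurable_fun setT (fun z : (mR * mR) * mR => G2 z.1.1 z.1.2 z.2).
  apply: measurable_fun_ifT => //.
  - apply: measurable_fun_ltr; exact: measurableT_comp.
  - apply: (measurableT_comp mF); apply: measurable_fun_pair => //; apply: measurable_funD => //.
    by apply: measurable_funB; exact: measurableT_comp.
have mI (G : mR -> mR -> mR -> \bar R) : measurable_fun setT (fun z : (mR * mR) * mR => G z.1.1 z.1.2 z.2) ->
  (forall x y w, 0 <= G x y w) ->
  measurable_fun setT (fun z : mR * mR => \int[expd (a + b)]_w G z.1 z.2 w).
  move=> mG G0; exact: (@measurable_fun_fubini_tonelli_F _ _ _ _ _ (expd (a + b))
     (fun z : (mR * mR) * mR => G z.1.1 z.1.2 z.2)).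
have I0 (G : mR -> mR -> mR -> \bar R) x y :
  (forall x y w, 0 <= G x y w) -> 0 <= \int[expd (a + b)]_w G x y w.
  by move=> G0; apply: integral_ge0.
have II0 (G : mR -> mR -> mR -> \bar R) x :
  (forall x y w, 0 <= G x y w) -> 0 <= \int[expd b]_y \int[expd (a + b)]_w G x y w.
  by move=> G0; apply: integral_ge0 => y _; exact: I0.
have mII (G : mR -> mR -> mR -> \bar R) : measurable_fun setT (fun z : (mR * mR) * mR => G z.1.1 z.1.2 z.2) ->
  (forall x y w, 0 <= G x y w) ->
  measurable_fun setT (fun x : mR => \int[expd b]_y \int[expd (a + b)]_w G x y w).
  move=> mG G0; apply: (@measurable_fun_fubini_tonelli_F _ _ _ _ _ (expd b)
     (fun z : mR * mR => \int[expd (a + b)]_w G z.1 z.2 w)); first exact: mI.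
  by move=> z; exact: I0.
transitivity (\int[expd a]_x \int[expd b]_y \int[expd (a + b)]_w G1 x y w +
   \int[expd a]_x \int[expd b]_y \int[expd (a + b)]_w G2 x y w).
  rewrite -ge0_integralD//; last 4 first.
  - by move=> x _; exact: II0.
  - exact: mII.
  - by move=> x _; exact: II0.
  - exact: mII.
  apply: eq_integral => x _; rewrite -ge0_integralD//; last 4 first.
  - by move=> y _; exact: I0.
  - exact: (measurable_fun_section1 _ (mI _ mG1 _)).
  - by move=> y _; exact: I0.
  - exact: (measurable_fun_section1 _ (mI _ mG2 _)).
  apply: eq_integral => y _; rewrite -ge0_integralD//; last 2 first.
  - exact: (measurable_fun_section1 (x, y) mG1).
  - exact: (measurable_fun_section1 (x, y) mG2).
  by apply: eq_integral => w _; exact: GE.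
have -> : \int[expd a]_x \int[expd b]_y \int[expd (a + b)]_w G1 x y w =
  \int[expd b]_y \int[expd a]_x \int[expd (a + b)]_w G1 x y w.
  apply: (@fubini_tonelli _ _ _ _ _ (expd a) (expd b) (fun z : mR * mR => \int[expd (a + b)]_w G1 z.1 z.2 w)).
  - exact: mI.
  - by move=> z; exact: I0.
have /= e1 := half a0 b0 mF F0 mle
  (fun y g y0 mg g0 => integral_expd_memoryless a0 y0 mg g0).
have /= e2 := half b0 a0 mF' (fun z => F0 _) mlt
  (fun y g y0 mg g0 => integral_expd_memoryless_strict b0 y0 mg g0).
rewrite /G1 e1 /G2.
rewrite (addrC a b) e2 /F'/=; clear e1 e2 GE.
rewrite (@fubini_tonelli _ _ _ _ _ (expd b) (expd a) (fun z : mR * mR => if (z.1 <= z.2)%R then F (z.2, z.1) else 0))/=; last 2 first.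
- by apply: measurable_fun_ifT => //; apply: (measurableT_comp mF); exact: measurable_fun_pair.
- by move=> z; case: ifP.
have m1 : measurable_fun setT (fun z : mR * mR => if (z.2 <= z.1)%R then F (z.1, z.2) else 0).
  by apply: measurable_fun_ifT => //; [exact: measurable_fun_ler|apply: (measurableT_comp mF); exact: measurable_fun_pair].
have m2 : measurable_fun setT (fun z : mR * mR => if (z.1 < z.2)%R then F (z.1, z.2) else 0).
  by apply: measurable_fun_ifT => //; apply: (measurableT_comp mF); exact: measurable_fun_pair.
rewrite -ge0_integralD//; last 4 first.
- by move=> x _; apply: integral_ge0 => y _; case: ifP.
- by apply: (@measurable_fun_fubini_tonelli_F _ _ _ _ _ (expd b) _ m1) => // z; case: ifP.
- by move=> x _; apply: integral_ge0 => y _; case: ifP.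
- by apply: (@measurable_fun_fubini_tonelli_F _ _ _ _ _ (expd b) _ m2) => // z; case: ifP.
apply: eq_integral => x _; rewrite -ge0_integralD//; last 4 first.
- by move=> y _; case: ifP.
- exact: (measurable_fun_section1 x m1).
- by move=> y _; case: ifP.
- exact: (measurable_fun_section1 x m2).
by apply: eq_integral => y _; rewrite ltNge; case: leP => _; rewrite ?adde0 ?add0e.
Qed.

End burke_law.

(** * Independent sequences *)

Section product_probability.
Context d1 d2 (T1 : measurableType d1) (T2 : measurableType d2) (R : realType).
Variables (m1 : probability T1 R) (m2 : probability T2 R).

Definition prodp : probability (T1 * T2)%type R := (m1 \x m2)%E.

Lemma integral_prodp (f : T1 * T2 -> \bar R) : measurable_fun setT f ->
  (forall z, 0 <= f z)%E ->
  (\int[prodp]_z f z = \int[m1]_x \int[m2]_y f (x, y))%E.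
Proof. exact: fubini_tonelli1. Qed.

Lemma measurable_integral_prodp (f : T1 * T2 -> \bar R) : measurable_fun setT f ->
  (forall z, 0 <= f z)%E -> measurable_fun setT (fun x => \int[m2]_y f (x, y))%E.
Proof. exact: measurable_fun_fubini_tonelli_F. Qed.

End product_probability.

Section independence.
Context d (T : measurableType d) (R : realType) (P : probability T R).
Notation mR := (measurableTypeR R).

(** The hypothesis on indicators says that two measures coincide, the image of $D\,dP$ under [X] and
    $c\,\mu$; integrals of nonnegative functions follow. *)
Lemma law_ext d' (S : measurableType d') (X : T -> S) (D : T -> R) (c : R)
    (mu : {measure set S -> \bar R}) :
  measurable_fun setT X -> measurable_fun setT D -> (forall t, 0 <= D t) -> 0 <= c ->
  (forall A, measurable A -> \int[P]_t (D t * \1_A (X t))%:E = c%:E * mu A)%E ->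
  forall g : S -> R, measurable_fun setT g -> (forall x, 0 <= g x) ->
  (\int[P]_t (D t * g (X t))%:E = c%:E * \int[mu]_x (g x)%:E)%E.
Proof.
move=> mX mD D0 c0 H g mg g0.
pose cn : {nonneg R} := NngNum c0.
have mgE : measurable_fun setT (EFin \o g) by exact/measurable_EFinP.
rewrite -[c]/(cn%:num) -(ge0_integral_mscale _ _ cn)//; last by move=> x _; rewrite lee_fin.
transitivity (\int[push_measure (density_measure P mD D0) mX]_x (g x)%:E)%E.
  have gE0 x : (0 <= (EFin \o g) x)%E by rewrite /= lee_fin.
  rewrite (ge0_integral_push _ mX mgE gE0).
  rewrite (ge0_integral_density _ _ _ (measurableT_comp mgE mX) (fun=> gE0 _)).
  by apply: eq_integral => t _; rewrite -EFinM mulrC.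
apply: eq_measure_integral => A mA _.
rewrite push_measureE density_measureE -[RHS]/(c%:E * mu A)%E -H//.
rewrite integral_mkcond; apply: eq_integral => t _; rewrite patchE indicE.
have -> : (t \in X @^-1` A) = (X t \in A) by apply/idP/idP; rewrite !inE.
by case: ifP => _; rewrite ?mulr1 ?mulr0.
Qed.

(** Items carry their own space because they get grouped: the update of a cell needs three variables
    merged into one. *)
Record item := Item {
  it_disp : measure_display;
  it_type : measurableType it_disp;
  it_rv : T -> it_type;
  it_law : probability it_type R }.

(* The items of [s] are independent with the prescribed laws, also independently of the density [D],
   which has total mass [c]: the expectation of [D] times any product of nonnegative functions of
   the items factorizes. Keeping a general [D] makes exponential tilting an operation on [indep]. *)
Fixpoint indep (D : T -> R) (c : R) (s : seq item) : Prop :=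
  if s is X :: s' then
    measurable_fun setT (it_rv X) /\
    forall (g : it_type X -> R) (cg : R), measurable_fun setT g ->
      (forall x, 0 <= g x) -> (\int[it_law X]_x (g x)%:E = cg%:E)%E ->
      indep (fun t => D t * g (it_rv X t)) (c * cg) s'
  else [/\ measurable_fun setT D, forall t, 0 <= D t & (\int[P]_t (D t)%:E = c%:E)%E].

Lemma integral_prob1 d' (S : measurableType d') (mu : probability S R) :
  (\int[mu]_x (1 : R)%:E = 1%:E)%E.
Proof. by rewrite integral_cst//= probability_setT mule1. Qed.

Lemma indep_behead D c X s : indep D c (X :: s) -> indep D c s.
Proof.
move=> [_ /(_ (fun=> 1) 1)]; rewrite mulr1.
rewrite (_ : (fun t => D t * _) = D); last by apply/funext => t; rewrite mulr1.
by apply => //; exact: integral_prob1.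
Qed.

Lemma indep_nil D c s : indep D c s ->
  [/\ measurable_fun setT D, forall t, 0 <= D t & (\int[P]_t (D t)%:E = c%:E)%E].
Proof. by elim: s => // X s IH /indep_behead. Qed.

Lemma indep_ge0 D c s : indep D c s -> 0 <= c.
Proof.
move=> /indep_nil[mD D0 H]; rewrite -lee_fin -H.
by apply: integral_ge0 => t _; rewrite lee_fin.
Qed.

Lemma indep_cat_sub s t t' : (forall D c, indep D c t -> indep D c t') ->
  forall D c, indep D c (s ++ t) -> indep D c (s ++ t').
Proof.
move=> H; elim: s => //= X s IH D c [mX HX]; split=> // g cg mg g0 Hg.
by apply: IH; exact: HX.
Qed.

Lemma indep_swap D c X Y s : indep D c (X :: Y :: s) -> indep D c (Y :: X :: s).
Proof.
move=> H; have [mY _] := indep_behead H; case: H => mX H; split => // h ch mh h0 Hh.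
split => // g cg mg g0 Hg; have [_ /(_ h ch mh h0 Hh)] := H g cg mg g0 Hg.
by rewrite mulrAC; congr indep; apply/funext => t; rewrite mulrAC.
Qed.

Lemma indep_front s1 X s2 D c : indep D c (s1 ++ X :: s2) -> indep D c (X :: s1 ++ s2).
Proof.
elim: s1 D c => // Y s1 IH D c /= H; apply: indep_swap.
by apply: (@indep_cat_sub [:: Y] _ _ _ _ _ H) => D' c'; exact: IH.
Qed.

Lemma indep_back s1 X s2 D c : indep D c (X :: s1 ++ s2) -> indep D c (s1 ++ X :: s2).
Proof.
elim: s1 D c => // Y s1 IH D c /= H.
by apply: (@indep_cat_sub [:: Y] _ _ _ _ _ (indep_swap H)) => D' c'; exact: IH.
Qed.

Lemma indep_catC s1 s2 D c : indep D c (s1 ++ s2) -> indep D c (s2 ++ s1).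
Proof.
elim: s1 s2 D c => [|X s1 IH] s2 D c /=; first by rewrite cats0.
by move=> H; apply: indep_back; apply: (@indep_cat_sub [:: X] _ _ _ _ _ H) => D' c'; exact: IH.
Qed.

Lemma indep_head_sub u u' s : (forall D c, indep D c u -> indep D c u') ->
  forall D c, indep D c (u ++ s) -> indep D c (u' ++ s).
Proof.
by move=> H D c /indep_catC H1; apply: indep_catC; exact: indep_cat_sub H1.
Qed.

Lemma indep_head_all u u' s : size u = size u' ->
  (forall i D c X0, (i < size u)%N -> indep D c [:: nth X0 u i] -> indep D c [:: nth X0 u' i]) ->
  forall D c, indep D c (u ++ s) -> indep D c (u' ++ s).
Proof.
elim: u u' => [|X u IH] [|Y u']//= [su] H D c HX.
apply: (@indep_head_sub [:: X] [:: Y]); first by move=> D' c'; exact: (H 0%N _ _ X).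
apply: (@indep_cat_sub [:: X] _ _ _ _ _ HX) => D' c'; apply: IH => // i D2 c2 X0 iu.
exact: (H i.+1).
Qed.

Lemma indep_drop s1 s2 D c : indep D c (s1 ++ s2) -> indep D c s2.
Proof. by elim: s1 => // X s1 IH /= /indep_behead. Qed.

Definition pair_item (X Y : item) : item :=
  Item (fun t => (it_rv X t, it_rv Y t)) (prodp (it_law X) (it_law Y)).

(** [indep] tests only products of functions of the items. Tested on rectangles, this already
    determines the joint law, by uniqueness of the product measure. *)
Let merge2 D c X Y : indep D c [:: X; Y] -> indep D c [:: pair_item X Y].
Proof.
move=> H; have c0 := indep_ge0 H; have [mD D0 HD] := indep_nil H.
have [mX _] := H; have [mY _] := indep_behead H.
have mXY : measurable_fun setT (fun t => (it_rv X t, it_rv Y t)).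
  exact: measurable_fun_pair.
split=> // g cg mg g0 Hg; split.
- by apply: measurable_funM => //; exact: measurableT_comp mg mXY.
- by move=> t; rewrite mulr_ge0.
rewrite EFinM -Hg; apply: (law_ext mXY) => //.
move=> A mA.
(* With zero total mass there is nothing to normalize, and both sides vanish because the integrand
   is at most [D]. *)
have [c00|cn0] := eqVneq c 0.
  rewrite c00 mul0e; apply/eqP; rewrite eq_le; apply/andP; split; last first.
    by apply: integral_ge0 => t _; rewrite lee_fin mulr_ge0.
  rewrite -[leRHS]/(0%R%:E) -c00 -HD; apply: ge0_le_integral => //.
  - by move=> t _; rewrite lee_fin mulr_ge0.
  - apply/measurable_EFinP; apply: measurable_funM => //.
    by apply: (measurableT_comp _ mXY); exact: measurable_indic.
  - exact/measurable_EFinP.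
  - by move=> t _; rewrite lee_fin ler_piMr// indicE; case: (_ \in _).
have cp : 0 < c by rewrite lt_def cn0.
have ci : 0 <= c^-1 by rewrite invr_ge0.
(* The joint law under $D\,dP$, normalized so that it can be compared with a product of
   probabilities. *)
pose m' := mscale (NngNum ci) (push_measure (density_measure P mD D0) mXY).
suff m'E : forall A1 A2, measurable A1 -> measurable A2 ->
    m' (A1 `*` A2) = (it_law X A1 * it_law Y A2)%E.
  have pE := @product_measure_unique _ _ _ _ _ (it_law X) (it_law Y) m' m'E _ mA.
  transitivity (c%:E * m' A)%E; last by congr (_ * _)%E; exact: esym pE.
  rewrite -[m' A]/((c^-1)%:E * (push_measure (density_measure P mD D0) mXY A))%E.
  rewrite push_measureE density_measureE muleA -EFinM divff// mul1e.
  rewrite [RHS]integral_mkcond; apply: eq_integral => t _; rewrite patchE indicE.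
  have -> : (t \in (fun t => (it_rv X t, it_rv Y t)) @^-1` A) = ((it_rv X t, it_rv Y t) \in A).
    by apply/idP/idP; rewrite !inE.
  by case: ifP => _; rewrite ?mulr1 ?mulr0.
move=> A1 A2 mA1 mA2.
have I1 : (\int[it_law X]_x (\1_A1 x)%:E = (fine (it_law X A1))%:E)%E.
  by rewrite integral_indic// setIT fineK// fin_num_measure.
have I2 : (\int[it_law Y]_x (\1_A2 x)%:E = (fine (it_law Y A2))%:E)%E.
  by rewrite integral_indic// setIT fineK// fin_num_measure.
have i0 S (B : set S) x : 0 <= \1_B x :> R by rewrite indicE.
have [_ H1] := H.
have [_ H1'] := H1 _ _ (measurable_indic mA1) (i0 _ _) I1.
have [_ _ H2] := H1' _ _ (measurable_indic mA2) (i0 _ _) I2.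
rewrite -[m' _]/((c^-1)%:E * (push_measure (density_measure P mD D0) mXY (A1 `*` A2)))%E.
rewrite push_measureE density_measureE integral_mkcond.
rewrite (_ : integral _ _ _ = (c * fine (it_law X A1) * fine (it_law Y A2))%:E); last first.
  rewrite -H2; apply: eq_integral => t _; rewrite patchE !indicE.
  have -> : (t \in (fun t => (it_rv X t, it_rv Y t)) @^-1` (A1 `*` A2)) =
      (it_rv X t \in A1) && (it_rv Y t \in A2).
    apply/idP/idP; first by rewrite inE => -[/= K1 K3]; rewrite !mem_set.
    by move=> /andP[]; rewrite !inE => K1 K3; split.
  by do 2 case: (_ \in _); rewrite /= ?mulr1 ?mulr0.
rewrite -EFinM mulrA mulrA mulVf// mul1r EFinM !fineK ?fin_num_measure//.
Qed.

Lemma indep_merge D c X Y s : indep D c (X :: Y :: s) -> indep D c (pair_item X Y :: s).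
Proof. by apply: (@indep_head_sub [:: X; Y] [:: pair_item X Y]) => {}D {}c; exact: merge2. Qed.

Definition rv (X : T -> mR) (r : R) : item := Item X (expd r).

(** Independence of the outputs is tested on $g(x)h(y)$, read as one function of the merged triple,
    and [burke_law] gives it the same mean as on the inputs. The tail [s] is untouched, which lets
    the update be repeated cell after cell. *)
Lemma indep_burke D c (X Y W : T -> mR) (a b : R) s : 0 < a -> 0 < b ->
  indep D c [:: rv X a, rv Y b, rv W (a + b) & s] ->
  indep D c [:: rv (fun t => burkeI (X t) (Y t) (W t)) a,
               rv (fun t => burkeI (Y t) (X t) (W t)) b & s].
Proof.
move=> a0 b0 H.
have /= mX : measurable_fun setT X by case: H.
have /= mY : measurable_fun setT Y by case: (indep_behead H).
have /= mW : measurable_fun setT W by case: (indep_behead (indep_behead H)).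
split=> [|g cg mg g0 Hg]; first exact: measurable_burkeI.
split=> [|h ch mh h0 Hh]; first exact: measurable_burkeI.
have [_ K] := indep_merge (indep_merge H).
have {}K := K (fun z => g (burkeI z.1.1 z.1.2 z.2) * h (burkeI z.1.2 z.1.1 z.2)) (cg * ch).
rewrite -[c * cg * ch]mulrA (_ : (fun t => _ * _ * _) = (fun t => D t *
    (g (burkeI (X t) (Y t) (W t)) * h (burkeI (Y t) (X t) (W t))))); last first.
  by apply/funext => t; rewrite mulrA.
apply: K.
- by apply: measurable_funM;
    [apply: (measurableT_comp mg)|apply: (measurableT_comp mh)];
    apply: measurable_burkeI => //; exact: measurableT_comp.
- by move=> z; rewrite mulr_ge0.
pose F (z : mR * mR) := ((g z.1 * h z.2)%:E : \bar R).
have mF : measurable_fun setT F.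
  by apply/measurable_EFinP; apply: measurable_funM; exact: measurableT_comp.
have F0 z : (0 <= F z)%E by rewrite lee_fin mulr_ge0.
have mF3 : measurable_fun setT (fun z : (mR * mR) * mR =>
    F (burkeI z.1.1 z.1.2 z.2, burkeI z.1.2 z.1.1 z.2)).
  apply: (measurableT_comp mF); apply: measurable_fun_pair;
    apply: measurable_burkeI => //; exact: measurableT_comp.
have F30 (z : (mR * mR) * mR) : (0 <= F (burkeI z.1.1 z.1.2 z.2, burkeI z.1.2 z.1.1 z.2))%E by exact: F0.
have mF2 := measurable_integral_prodp (expd (a + b)) mF3 F30.
have F20 (z : mR * mR) : (0 <= \int[expd (a + b)]_w
    F (burkeI z.1 z.2 w, burkeI z.2 z.1 w))%E by apply: integral_ge0 => w _; exact: F0.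
apply: (etrans (@integral_prodp _ _ _ _ _ (prodp (expd a) (expd b)) (expd (a + b)) _ mF3 F30)).
apply: (etrans (@integral_prodp _ _ _ _ _ (expd a) (expd b) _ mF2 F20)).
apply: (etrans (burke_law a0 b0 mF F0)).
clear mF2 F20 F30 mF3 mF F0 H.
under eq_integral.
  move=> x _; under eq_integral do rewrite /F/= EFinM.
  rewrite ge0_integralZl//; last 3 first.
  - exact/measurable_EFinP.
  - by move=> y _; rewrite lee_fin.
  - by rewrite lee_fin.
  rewrite Hh; over.
rewrite /= ge0_integralZr//; last 3 first.
- exact/measurable_EFinP.
- by move=> y _; rewrite lee_fin.
- by rewrite -Hh; apply: integral_ge0 => y _; rewrite lee_fin.
by rewrite Hg.
Qed.

End independence.

(** * Exponential tilting and maximal inequalities *)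

Section expd_moments.
Context {R : realType}.
Notation mR := (measurableTypeR R).
Local Open Scope ereal_scope.

Lemma le_integral_expd (r : R) (g h : mR -> \bar R) : (0 < r)%R ->
  measurable_fun setT g -> (forall x, 0 <= g x) ->
  measurable_fun setT h -> (forall x, 0 <= h x) ->
  (forall x : R, (0 <= x)%R -> g x <= h x) ->
  \int[expd r]_x g x <= \int[expd r]_x h x.
Proof.
move=> r0 mg g0 mh h0 gh; rewrite (integral_expd r0 mg g0) (integral_expd r0 mh h0).
have mp : measurable_fun setT (fun x : mR => (exponential_pdf r x)%:E).
  by apply/measurable_EFinP; exact: measurable_exponential_pdf.
have p0 (x : mR) : 0 <= (exponential_pdf r x)%:E.
  by rewrite lee_fin; apply: exponential_pdf_ge0; exact: ltW.
apply: ge0_le_integral => //.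
- by move=> x _; exact: mule_ge0.
- exact: emeasurable_funM.
- exact: emeasurable_funM.
- move=> x _; have [x0|x0] := leP 0%R x; first by apply: lee_wpmul2r => //; exact: gh.
  by rewrite lt0_exponential_pdf// !mule0.
Qed.

Lemma measurable_expRM (th : R) : measurable_fun setT (fun x : mR => expR (th * x) : mR).
Proof. by apply: measurableT_comp => //; exact: measurable_funM. Qed.

Lemma expd_mgf (r th : R) : (0 < r)%R -> (th < r)%R ->
  \int[expd r]_x (expR (th * x))%:E = (r / (r - th))%:E.
Proof.
move=> r0 thr.
have := integral_expd_tilt r0 thr (measurable_cst 1%E) (fun=> lee01).
rewrite integral_cst//= probability_setT !mule1 => <-.
by apply: eq_integral => x _; rewrite mule1.
Qed.

(** The mean is squeezed out of the exponential moments: $1-e^{-\theta x}\le\theta x\le e^{\theta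
    x}-1$, with $\theta\to0$. The positive part makes the integrand nonnegative on the whole line
    without changing it where the law lives. *)
Lemma expd_mean (r : R) : (0 < r)%R -> \int[expd r]_x (Num.max x 0)%:E = (r^-1)%:E.
Proof.
move=> r0; set m := \int[_]_x _.
have mm : measurable_fun setT (fun x : mR => (Num.max x 0)%:E).
  by apply/measurable_EFinP; exact: measurable_maxr.
have m0 (x : mR) : 0 <= (Num.max x 0)%:E by rewrite lee_fin le_max lexx orbT.
have meR (th : R) : measurable_fun setT (fun x : mR => (expR (th * x))%:E).
  by apply/measurable_EFinP; exact: measurable_expRM.
have e0 (th x : R) : 0 <= (expR (th * x))%:E by rewrite lee_fin expR_ge0.
have hi (th : R) : (0 < th < r)%R -> 1 + th%:E * m <= (r / (r - th))%:E.
  move=> /andP[th0 thr]; rewrite -(expd_mgf r0 thr).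
  rewrite -(@integral_prob1 _ _ _ (expd r)) -ge0_integralZl_EFin//; last exact: ltW.
  rewrite -ge0_integralD//; last 2 first.
  - by move=> x _; rewrite mule_ge0// lee_fin ltW.
  - exact: emeasurable_funM.
  apply: (le_integral_expd r0) => //.
  - by apply: emeasurable_funD => //; exact: emeasurable_funM.
  - by move=> x; rewrite adde_ge0// mule_ge0// lee_fin ltW.
  - by move=> x x0; rewrite -EFinM -EFinD lee_fin (max_idPl x0) expR_ge1Dx.
have lo (th : R) : (0 < th)%R -> 1 <= th%:E * m + (r / (r + th))%:E.
  move=> th0; have thr : (- th < r)%R by lra.
  have := expd_mgf r0 thr; rewrite opprK => <-.
  rewrite -[leLHS]/(1%R%:E) -(@integral_prob1 _ _ _ (expd r)) -ge0_integralZl_EFin//; last exact: ltW.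
  rewrite -ge0_integralD//; last 2 first.
  - by move=> x _; rewrite mule_ge0// lee_fin ltW.
  - exact: emeasurable_funM.
  apply: (le_integral_expd r0) => //.
  - by apply: emeasurable_funD => //; exact: emeasurable_funM.
  - by move=> x; rewrite adde_ge0// mule_ge0// lee_fin ltW.
  - move=> x x0; rewrite -EFinM -EFinD lee_fin (max_idPl x0).
    by have := expR_ge1Dx (- th * x); lra.
have mge0 : 0 <= m by apply: integral_ge0.
have [mf mE] : m \is a fin_num /\ m = (fine m)%:E.
  suff mf : m \is a fin_num by rewrite fineK.
  rewrite ge0_fin_numE// ltey; apply/eqP => moo.
  have hr : (0 < r / 2 < r)%R by apply/andP; split; lra.
  by have := hi _ hr; rewrite moo gt0_muley ?lte_fin ?divr_gt0// addey.
rewrite mE in hi lo *; congr (_%:E).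
apply/eqP; rewrite eq_le; apply/andP; split.
  apply/ler_addgt0Pr => e e0'.
  (* For this choice $1/(r-\theta)-1/r=\theta/(r(r-\theta))\le2\theta/r^2\le e$. *)
  pose th := Num.min (r / 2)%R (r ^+ 2 * e / 2)%R.
  have th0 : (0 < th)%R by rewrite lt_min !divr_gt0// mulr_gt0// exprn_gt0.
  have th1 : (th <= r / 2)%R by rewrite ge_min lexx.
  have th2 : (th <= r ^+ 2 * e / 2)%R by rewrite ge_min lexx orbT.
  have thr : (0 < th < r)%R by apply/andP; split=> //; lra.
  have := hi _ thr; rewrite -EFinM -EFinD lee_fin => h.
  have rth : (0 < r - th)%R by lra.
  have h1 : (fine m <= (r - th)^-1)%R.
    rewrite -(ler_pM2l th0) -(lerD2l 1%R); apply: (le_trans h).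
    by rewrite le_eqVlt; apply/orP; left; apply/eqP; field; lra.
  apply: (le_trans h1); rewrite -(ler_pM2l rth) divff ?gt_eqF//.
  have rV : (r * r^-1 = 1)%R by rewrite divff ?gt_eqF.
  have rVp : (0 < r^-1)%R by rewrite invr_gt0.
  have h3 : (th * r^-1 <= r * e / 2)%R.
    rewrite ler_pdivrMr//; apply: (le_trans th2).
    by rewrite (_ : r * e / 2 * r = r ^+ 2 * e / 2)%R//; ring.
  nra.
apply/ler_addgt0Pr => e e0'.
have th0 : (0 < r ^+ 2 * e)%R by rewrite mulr_gt0// exprn_gt0.
have := lo _ th0; rewrite -EFinM -EFinD lee_fin => h.
have rth : (0 < r + r ^+ 2 * e)%R by lra.
have h1 : ((r + r ^+ 2 * e)^-1 <= fine m)%R.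
  rewrite -(ler_pM2l th0) -(lerD2r (r / (r + r ^+ 2 * e))%R); apply: (le_trans _ h).
  by rewrite le_eqVlt; apply/orP; left; apply/eqP; field; lra.
apply: (@le_trans _ _ ((r + r ^+ 2 * e)^-1 + e)%R); last by rewrite lerD2r.
rewrite -(ler_pM2l rth) mulrDr divff ?gt_eqF//.
have rV : (r * r^-1 = 1)%R by rewrite divff ?gt_eqF.
have -> : ((r + r ^+ 2 * e) * r^-1 = 1 + r * e)%R by field; lra.
rewrite lerD2l mulrDl lerDl; apply: mulr_ge0; lra.
Qed.

End expd_moments.

Section real_items.
Context d (T : measurableType d) (R : realType) (P : probability T R).
Notation mR := (measurableTypeR R).
Notation indep := (@indep d T R P).
Notation rv := (@rv d T R).

Lemma indep_scale D c s k : 0 <= k -> indep D c s -> indep (fun t => D t * k) (c * k) s.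
Proof.
move=> k0; elim: s D c => [|X s IH] D c /=.
  move=> [mD D0 HD]; split.
  - exact: measurable_funM.
  - by move=> t; rewrite mulr_ge0.
  under eq_integral do rewrite EFinM.
  rewrite ge0_integralZr//; last 2 first.
  - exact/measurable_EFinP.
  - by move=> t _; rewrite lee_fin.
  by rewrite HD.
move=> [mX H]; split=> // g cg mg g0 Hg; rewrite mulrAC.
rewrite (_ : (fun t => _ * _ * _) = (fun t => D t * g (it_rv X t) * k)); last first.
  by apply/funext => t; rewrite mulrAC.
by apply: IH; exact: H.
Qed.

(** The factor is the likelihood ratio of rate [z] against rate [w]; it has mean 1, so the mass [c]
    is preserved. *)
Lemma indep_tilt1 D c X w z s : 0 < w -> 0 < z ->
  indep D c (rv X w :: s) ->
  indep (fun t => D t * (z / w * expR ((w - z) * X t))) c (rv X z :: s).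
Proof.
move=> w0 z0 [mX H]; split=> // g cg mg g0 Hg.
suff : indep (fun t => D t * (z / w * expR ((w - z) * X t) * g (X t))) (c * cg) s.
  by congr indep; apply/funext => t /=; ring.
apply: (H (fun x => z / w * expR ((w - z) * x) * g x)).
- apply: measurable_funM => //; apply: measurable_funM => //; exact: measurable_expRM.
- by move=> x; rewrite !mulr_ge0 ?expR_ge0// ?invr_ge0 ltW.
have mgE : measurable_fun setT (EFin \o g) by exact/measurable_EFinP.
have gE0 x : (0 <= (EFin \o g) x)%E by rewrite /= lee_fin.
have wz : w - z < w by lra.
have := integral_expd_tilt w0 wz mgE gE0; rewrite opprB addrCA subrr addr0 /= => E.
under eq_integral do rewrite -mulrA EFinM.
rewrite ge0_integralZl_EFin//; last 3 first.
- by move=> x _; rewrite lee_fin mulr_ge0// expR_ge0.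
- by apply/measurable_EFinP; apply: measurable_funM => //; exact: measurable_expRM.
- by rewrite divr_ge0// ltW.
under eq_integral do rewrite EFinM.
rewrite E Hg; transitivity ((z / w * (w / z * cg))%:E); first by []; congr (_%:E).
by field; rewrite !gt_eqF.
Qed.

Lemma indep_tilt I (l : seq I) (X : I -> T -> mR) w z s D c : 0 < w -> 0 < z ->
  indep D c ([seq rv (X i) w | i <- l] ++ s) ->
  indep (fun t => D t * \prod_(i <- l) (z / w * expR ((w - z) * X i t))) c
    ([seq rv (X i) z | i <- l] ++ s).
Proof.
move=> w0 z0; elim: l D c => [|i l IH] D c /=.
  by rewrite (_ : (fun t => D t * _) = D)//; apply/funext => t; rewrite big_nil mulr1.
move=> /(indep_tilt1 w0 z0)[mX H]; split=> // g cg mg g0 Hg.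
have := IH _ _ (H g cg mg g0 Hg); congr indep; apply/funext => t.
by rewrite big_cons /=; ring.
Qed.

Lemma indep_mgf I (l : seq I) (X : I -> T -> mR) r th D c : 0 < r -> th < r ->
  indep D c [seq rv (X i) r | i <- l] ->
  (\int[P]_t (D t * expR (th * \sum_(i <- l) X i t))%:E = (c * (r / (r - th)) ^+ size l)%:E)%E.
Proof.
move=> r0 thr; elim: l D c => [|i l IH] D c /=.
  rewrite expr0 mulr1 => -[_ _ <-]; apply: eq_integral => t _.
  by rewrite big_nil mulr0 expR0 mulr1.
move=> [mX H].
have {}H := H _ _ (measurable_expRM th) (fun=> expR_ge0 _) (expd_mgf r0 thr).
rewrite exprS mulrA -(IH _ _ H); apply: eq_integral => t _.
by rewrite big_cons mulrDr expRD mulrA.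
Qed.

(** One step of a multiplicative process that is frozen once it is at least [a]. The final value
    then remembers whether the level was ever reached, and a maximal inequality reduces to Markov's
    inequality at the last time. *)
Definition stop (a : R) (phi : R -> R) (z x : R) : R := if a <= z then z else z * phi x.

Lemma stop_ge a phi z xs : a <= z -> foldl (stop a phi) z xs = z.
Proof. by move=> az; elim: xs => //= x xs IH; rewrite /stop az. Qed.

Lemma stop_reached a phi xs z k : a <= z * \prod_(x <- take k xs) phi x ->
  a <= foldl (stop a phi) z xs.
Proof.
elim: xs z k => [|x xs IH] z k /=; first by rewrite big_nil mulr1.
have [az|za] := leP a z; first by move=> _; rewrite {2}/stop az stop_ge.
case: k => [|k]; first by rewrite big_nil mulr1 leNgt za.
rewrite big_cons mulrA => H.
have -> : stop a phi z x = z * phi x by rewrite /stop [a <= z]leNgt za.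
exact: IH H.
Qed.

Lemma measurable_stop d' (S : measurableType d') a phi (z x : S -> mR) :
  measurable_fun setT (phi : mR -> mR) ->
  measurable_fun setT z -> measurable_fun setT x ->
  measurable_fun setT (fun y => stop a phi (z y) (x y) : mR).
Proof.
move=> mphi mz mx; apply: measurable_fun_ifT => //; first exact: measurable_fun_ler.
by apply: measurable_funM => //; exact: measurableT_comp.
Qed.

Lemma stop_ge0 a phi z x : (forall x, 0 <= phi x) -> 0 <= z -> 0 <= stop a phi z x.
Proof. by move=> phi0 z0; rewrite /stop; case: ifP => // _; rewrite mulr_ge0. Qed.

(* The product of the [phi (X i)] is a supermartingale, stopped when it reaches [a]. *)
Lemma indep_stopped I (l : seq I) (X : I -> T -> mR) r a (phi : R -> R) :
  measurable_fun setT (phi : mR -> mR) -> (forall x, 0 <= phi x) ->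
  (\int[expd r]_x (phi x)%:E <= 1)%E ->
  forall (Y : item T R) (f : it_type Y -> mR) D c m,
  measurable_fun setT f -> (forall y, 0 <= f y) ->
  indep D c (Y :: [seq rv (X i) r | i <- l]) ->
  (\int[it_law Y]_y (f y)%:E <= m%:E)%E ->
  (\int[P]_t (D t * foldl (stop a phi) (f (it_rv Y t)) [seq X i t | i <- l])%:E <= (c * m)%:E)%E.
Proof.
move=> mphi phi0 phi1; elim: l => [|i l IH] Y f D c m mf f0 H Hm.
  have c0 := indep_ge0 H.
  have If : (0 <= \int[it_law Y]_y (f y)%:E)%E by apply: integral_ge0 => y _; rewrite lee_fin.
  have E : (\int[it_law Y]_y (f y)%:E = (fine (\int[it_law Y]_y (f y)%:E))%:E)%E.
    by rewrite fineK// ge0_fin_numE// (le_lt_trans Hm)// ltry.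
  case: H => _ /(_ f _ mf f0 E)[_ _ /= ->].
  by rewrite EFinM [in leRHS]EFinM lee_wpmul2l ?lee_fin// -lee_fin -E.
pose f' (z : it_type Y * mR) := stop a phi (f z.1) z.2.
have mf' : measurable_fun setT (f' : _ -> mR).
  by apply: measurable_stop => //; exact: measurableT_comp.
have f'0 z : 0 <= f' z by exact: stop_ge0.
have := IH (pair_item Y (rv (X i) r)) f' D c m mf' f'0 (indep_merge H); apply.
have mf'E : measurable_fun setT (EFin \o f') by exact/measurable_EFinP.
have f'E0 z : (0 <= (EFin \o f') z)%E by rewrite /= lee_fin.
apply: (le_trans _ Hm); rewrite (@integral_prodp _ _ _ _ _ (it_law Y) (expd r) _ mf'E f'E0).
apply: ge0_le_integral => //.
- by move=> y _; apply: integral_ge0 => x _; exact: f'E0.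
- exact: (measurable_integral_prodp (expd r) mf'E f'E0).
- exact/measurable_EFinP.
move=> y _; rewrite /f' /stop /=; case: (a <= f y).
  by rewrite integral_cst//= probability_setT mule1.
under eq_integral do rewrite EFinM.
rewrite ge0_integralZl//; last 3 first.
- exact/measurable_EFinP.
- by move=> x _; rewrite lee_fin.
- by rewrite lee_fin.
by rewrite -[leRHS]mule1 lee_wpmul2l ?lee_fin.
Qed.

Lemma indep_cst D c s (k : mR) : indep D c s -> indep D c (Item (fun=> k) (\d_k) :: s).
Proof.
move=> H; split=> [|g cg mg g0]; first exact: measurable_cst.
rewrite integral_dirac//=; last exact/measurable_EFinP.
by rewrite diracT mul1e => -[<-]; apply: indep_scale.
Qed.

(* An outer-probability bound, so that bad events need no measurability proof. *)
Definition pbd (A : set T) (e : R) := exists B, [/\ measurable B, A `<=` B & (P B <= e%:E)%E].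

Lemma pbd_sub A B e : A `<=` B -> pbd B e -> pbd A e.
Proof. by move=> AB [C [mC BC PC]]; exists C; split=> //; exact: subset_trans BC. Qed.

Lemma pbd_le A e e' : e <= e' -> pbd A e -> pbd A e'.
Proof. by move=> ee [C [mC BC PC]]; exists C; split=> //; rewrite (le_trans PC)// lee_fin. Qed.

Lemma pbdU A B e e' : pbd A e -> pbd B e' -> pbd (A `|` B) (e + e').
Proof.
move=> [C [mC AC PC]] [C' [mC' BC PC']]; exists (C `|` C'); split.
- exact: measurableU.
- exact: setUSS.
- by rewrite (le_trans (measureU2 _ mC mC'))// EFinD leeD.
Qed.

Lemma pbd_bigU (I : eqType) (l : seq I) (A : I -> set T) e :
  (forall i, i \in l -> pbd (A i) e) ->
  pbd [set t | exists2 i, i \in l & A i t] (e *+ size l).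
Proof.
elim: l => [|i l IH] H.
  by exists set0; split=> //; [move=> t [] | rewrite measure0].
apply: (@pbd_sub _ (A i `|` [set t | exists2 i, i \in l & A i t])).
  move=> t [j]; rewrite inE => /orP[/eqP -> |jl] At; [by left|by right; exists j].
rewrite mulrS; apply: pbdU; first by apply: H; rewrite mem_head.
by apply: IH => j jl; apply: H; rewrite inE jl orbT.
Qed.

Lemma pbd_markov (F : T -> mR) (a m : R) : 0 < a -> measurable_fun setT F ->
  (forall t, 0 <= F t) -> (\int[P]_t (F t)%:E <= m%:E)%E ->
  pbd [set t | a <= F t] (m / a).
Proof.
move=> a0 mF F0 Hm; exists [set t | a <= F t]; split=> //.
  rewrite -[X in measurable X]setTI.
  have -> : [set t | a <= F t] = F @^-1` `[a, +oo[%classic.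
    by apply/seteqP; split=> t /=; rewrite in_itv/= andbT.
  exact: mF.
have mA : measurable [set t | a <= F t].
  rewrite -[X in measurable X]setTI.
  have -> : [set t | a <= F t] = F @^-1` `[a, +oo[%classic.
    by apply/seteqP; split=> t /=; rewrite in_itv/= andbT.
  exact: mF.
have fP : P [set t | a <= F t] \is a fin_num by exact: fin_num_measure.
rewrite -(fineK fP) lee_fin ler_pdivlMr// -lee_fin EFinM (fineK fP) muleC; apply: le_trans Hm.
rewrite -[P _](_ : \int[P]_t (\1_[set t | a <= F t] t)%:E = _)%E; last first.
  by rewrite integral_indic// setIT.
rewrite -ge0_integralZl_EFin//; last 2 first.
- exact/measurable_EFinP/measurable_indic.
- exact: ltW.
apply: ge0_le_integral => //.
- by move=> t _; rewrite -EFinM lee_fin mulr_ge0// ltW.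
- by apply: emeasurable_funM => //; exact/measurable_EFinP/measurable_indic.
- exact/measurable_EFinP.
- move=> t _; rewrite -EFinM lee_fin indicE; case: (boolP (_ \in _)); last by rewrite mulr0.
  by rewrite inE/= mulr1.
Qed.

Lemma indep_measurable I (l : seq I) (X : I -> T -> mR) r D c s :
  indep D c ([seq rv (X i) r | i <- l] ++ s) ->
  forall k, (k <= size l)%N -> measurable_fun setT (fun t => \sum_(i <- take k l) X i t : mR).
Proof.
elim: l D c => [|i l IH] D c H k /=.
  by move=> _; under eq_fun do rewrite big_nil; exact: measurable_cst.
have [mX _] := H; case: k => [|k] kl.
  by under eq_fun do rewrite big_nil; exact: measurable_cst.
under eq_fun do rewrite big_cons; apply: measurable_funD => //.
exact: IH (indep_behead H) _ kl.
Qed.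

(** The exponentials of the partial sums form a nonnegative supermartingale started at 1, so a
    single Markov bound at level $e^y$ covers all times [k] without a union over them. *)
Lemma ville I (l : seq I) (X : I -> T -> mR) r th b y :
  (\int[expd r]_x (expR (th * (x - b)))%:E <= 1)%E ->
  indep (fun=> 1) 1 [seq rv (X i) r | i <- l] ->
  pbd [set t | exists k, y <= th * \sum_(i <- take k l) (X i t - b)] (expR (- y)).
Proof.
move=> H1 H.
pose phi x := expR (th * (x - b)).
have mphi : measurable_fun setT (phi : mR -> mR).
  apply: measurableT_comp => //; apply: measurable_funM => //; exact: measurable_funB.
have H2 : (\int[P]_t (1 * foldl (stop (expR y) phi) 1 [seq X i t | i <- l])%:E <= (1 * 1)%:E)%E.
  apply: (@indep_stopped _ l X r (expR y) phi mphi (fun=> expR_ge0 _) H1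
    (Item (fun=> 1 : mR) (\d_(1 : mR))) (fun=> 1 : mR) (fun=> 1)).
  - exact: measurable_cst.
  - by [].
  - exact: indep_cst.
  - by rewrite integral_prob1.
have mS (g : T -> mR) : measurable_fun setT g ->
    measurable_fun setT (fun t => foldl (stop (expR y) phi) (g t) [seq X i t | i <- l] : mR).
  elim: l H {H1 H2} g => [|i l IH] H g mg //=.
  by apply: (IH (indep_behead H)); apply: measurable_stop => //; case: H.
have S0 t : 0 <= foldl (stop (expR y) phi) 1 [seq X i t | i <- l].
  have : 0 <= 1 :> R by [].
  elim: l 1 {H H1 H2 mS} => //= i l IH z z0; apply: IH; apply: stop_ge0 => // x; exact: expR_ge0.
have /= := pbd_markov (expR_gt0 y) (mS (fun=> 1) (measurable_cst (1 : mR))) S0.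
move=> /(_ 1); rewrite -expRN mul1r => K.
apply: (pbd_sub _ (K _)); last first.
  rewrite mulr1 in H2; apply: le_trans H2; rewrite le_eqVlt; apply/orP; left; apply/eqP.
  by apply: eq_integral => t _; rewrite mul1r.
move=> t [k]; rewrite -ler_expR => Hk /=; apply: (@stop_reached _ _ _ _ k).
by rewrite mul1r -map_take big_map /phi -expR_sum -mulr_sumr.
Qed.

End real_items.

(** * Last passage recursion and comparison *)

Section lpp.
Context {R : realType}.
Implicit Types w : nat -> nat -> R.

(** The weight at the origin is never collected, as in the definition of the passage time. The inner
    fixpoint on [j] makes structural a recursion that decreases either coordinate. *)
Fixpoint lpp w (i : nat) : nat -> R :=
  if i is i'.+1 then
    fix col (j : nat) : R :=
      if j is j'.+1 then w i j + Num.max (lpp w i' j) (col j')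
      else lpp w i' 0%N + w i 0%N
  else fun j => \sum_(l < j) w 0%N l.+1.

Lemma lpp00 w : lpp w 0 0 = 0. Proof. by rewrite /= big_ord0. Qed.
Lemma lpp0S w j : lpp w 0 j.+1 = lpp w 0 j + w 0%N j.+1.
Proof. by rewrite /= big_ord_recr. Qed.
Lemma lppS0 w i : lpp w i.+1 0 = lpp w i 0 + w i.+1 0%N. Proof. by []. Qed.
Lemma lppSS w i j : lpp w i.+1 j.+1 =
  w i.+1 j.+1 + Num.max (lpp w i j.+1) (lpp w i.+1 j).
Proof. by []. Qed.

Definition hinc (g : nat -> nat -> R) i j := g i.+1 j - g i j.
Definition vinc (g : nat -> nat -> R) i j := g i j.+1 - g i j.

Lemma hinc0 w i : hinc (lpp w) i 0 = w i.+1 0%N.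
Proof. by rewrite /hinc lppS0; ring. Qed.

Lemma vinc0 w j : vinc (lpp w) 0 j = w 0%N j.+1.
Proof. by rewrite /vinc lpp0S; ring. Qed.

Lemma hincS w i j : hinc (lpp w) i j.+1 =
  burkeI (hinc (lpp w) i j) (vinc (lpp w) i j) (w i.+1 j.+1).
Proof.
rewrite /hinc /vinc /burkeI lppSS; move: (lpp w i j.+1) (lpp w i.+1 j) (lpp w i j) (w _ _) => a b c e.
have [ab|ab] := leP a b.
  by rewrite (max_idPl _); [ring|lra].
by rewrite (max_idPr _); [ring|lra].
Qed.

Lemma vincS w i j : vinc (lpp w) i.+1 j =
  burkeI (vinc (lpp w) i j) (hinc (lpp w) i j) (w i.+1 j.+1).
Proof.
rewrite /hinc /vinc /burkeI lppSS; move: (lpp w i j.+1) (lpp w i.+1 j) (lpp w i j) (w _ _) => a b c e.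
have [ab|ab] := leP a b.
  by rewrite (max_idPr _); [ring|lra].
by rewrite (max_idPl _); [ring|lra].
Qed.

Lemma lpp_ind2 (Q : nat -> nat -> Prop) :
  Q 0%N 0%N -> (forall i, Q i 0%N -> Q i.+1 0%N) -> (forall j, Q 0%N j -> Q 0%N j.+1) ->
  (forall i j, Q i j.+1 -> Q i.+1 j -> Q i j -> Q i.+1 j.+1) -> forall i j, Q i j.
Proof.
move=> Q00 QS0 Q0S QSS; elim=> [|i IHi]; first by elim.
by elim=> [|j IHj]; [exact: QS0|exact: QSS].
Qed.

Lemma lpp_tr w i j : lpp (fun i j => w j i) i j = lpp w j i.
Proof.
move: i j; apply: lpp_ind2.
- by rewrite !lpp00.
- by move=> i H; rewrite lppS0 lpp0S H.
- by move=> j H; rewrite lppS0 lpp0S H.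
- by move=> i j H1 H2 _; rewrite !lppSS H1 H2 maxC.
Qed.

Lemma lpp_ext w w' m n :
  (forall i j, (0 < i + j)%N -> (i <= m)%N -> (j <= n)%N -> w i j = w' i j) ->
  lpp w m n = lpp w' m n.
Proof.
move=> H; suff: forall i j, (i <= m)%N -> (j <= n)%N -> lpp w i j = lpp w' i j by apply.
apply: lpp_ind2.
- by rewrite !lpp00.
- by move=> i IH im _; rewrite !lppS0 IH ?H// ltnW.
- by move=> j IH _ jn; rewrite !lpp0S IH ?H// ltnW.
- by move=> i j H1 H2 _ im jn; rewrite !lppSS H1 ?H2 ?H// ltnW.
Qed.

Lemma lpp_hsum w m j : lpp w m j = lpp w 0 j + \sum_(i <- iota 0 m) hinc (lpp w) i j.
Proof.
elim: m => [|m IH]; first by rewrite big_nil addr0.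
by rewrite -addn1 iotaD big_cat big_seq1 addrA -IH add0n addn1 /hinc; ring.
Qed.

Lemma lpp_vsum w i n : lpp w i n = lpp w i 0 + \sum_(j <- iota 0 n) vinc (lpp w) i j.
Proof.
elim: n => [|n IH]; first by rewrite big_nil addr0.
by rewrite -addn1 iotaD big_cat big_seq1 addrA -IH add0n addn1 /vinc; ring.
Qed.

Lemma burkeI_ge0 (x y w : R) : 0 <= w -> 0 <= burkeI x y w.
Proof. by move=> w0; rewrite /burkeI addr_ge0// le_max lexx orbT. Qed.

Lemma burkeI_le (x y w x' y' : R) : x <= x' -> y' <= y -> burkeI x y w <= burkeI x' y' w.
Proof.
move=> xx yy; rewrite /burkeI lerD2l ge_max !le_max lexx orbT andbT.
by apply/orP; left; lra.
Qed.

Lemma inc_ge0 w : (forall i j, 0 <= w i j) ->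
  forall i j, 0 <= hinc (lpp w) i j /\ 0 <= vinc (lpp w) i j.
Proof.
move=> w0 i j; split.
  by case: j => [|j]; [rewrite hinc0|rewrite hincS; exact: burkeI_ge0].
by case: i => [|i]; [rewrite vinc0|rewrite vincS; exact: burkeI_ge0].
Qed.

(** [burkeI] is increasing in its first argument and decreasing in its second, so an order between
    two boundaries, opposite on the two axes, propagates from cell to cell. *)
Lemma inc_mono w w' : (forall i j, w i.+1 j.+1 = w' i.+1 j.+1) ->
  (forall i, w i.+1 0%N <= w' i.+1 0%N) -> (forall j, w' 0%N j.+1 <= w 0%N j.+1) ->
  forall i j, hinc (lpp w) i j <= hinc (lpp w') i j /\ vinc (lpp w') i j <= vinc (lpp w) i j.
Proof.
move=> Hb Hh Hv.
have V0 j : vinc (lpp w') 0 j <= vinc (lpp w) 0 j by rewrite !vinc0.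
suff H : forall j i, hinc (lpp w) i j <= hinc (lpp w') i j /\ vinc (lpp w') i j <= vinc (lpp w) i j by move=> i j; exact: H.
have step i j : hinc (lpp w) i j <= hinc (lpp w') i j ->
  vinc (lpp w') i j <= vinc (lpp w) i j ->
  hinc (lpp w) i j.+1 <= hinc (lpp w') i j.+1 /\ vinc (lpp w') i.+1 j <= vinc (lpp w) i.+1 j.
  by move=> h v; rewrite !hincS !vincS Hb; split; exact: burkeI_le.
elim=> [|j IHj].
  elim=> [|i [IH1 IH2]]; first by rewrite !hinc0.
  by rewrite !hinc0; split => //; have [] := step _ _ IH1 IH2.
have Hh' i : hinc (lpp w) i j.+1 <= hinc (lpp w') i j.+1 by have [h v] := IHj i; have [] := step _ _ h v.
elim=> [|i [IH1 IH2]]; first by split.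
by split => //; have [] := step _ _ IH1 IH2.
Qed.

(* The weights on the horizontal and vertical axes are scaled by [s] and [t]: [(0, 0)] is the model
   without boundary, [(a^-1, (1 - a)^-1)] the stationary model of parameter [a], and the maximum
   for [(s, t)] is the larger of those for [(s, 0)] and [(0, t)]. *)
Definition bdry (s t : R) w i j : R :=
  if j == 0%N then s * w i j else if i == 0%N then t * w i j else w i j.

Definition glpp s t w := lpp (bdry s t w).

Section nonneg.
Variable w : nat -> nat -> R.
Hypothesis w0 : forall i j, 0 <= w i j.

Lemma bdry_ge0 s t i j : 0 <= s -> 0 <= t -> 0 <= bdry s t w i j.
Proof. by move=> s0 t0; rewrite /bdry; case: ifP => _; [|case: ifP => _]; rewrite ?mulr_ge0. Qed.

Lemma glpp_ge0 s t i j : 0 <= s -> 0 <= t -> 0 <= glpp s t w i j.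
Proof.
move=> s0 t0; rewrite /glpp; move: i j; apply: lpp_ind2.
- by rewrite lpp00.
- by move=> i H; rewrite lppS0 addr_ge0// bdry_ge0.
- by move=> i H; rewrite lpp0S addr_ge0// bdry_ge0.
- by move=> i j H _ _; rewrite lppSS addr_ge0 ?bdry_ge0// le_max H.
Qed.

(** A path collects weights on one axis only; giving weight 0 to the other axis creates no better
    path, all weights being nonnegative. *)
Lemma glpp_max s t i j : 0 <= s -> 0 <= t ->
  glpp s t w i j = Num.max (glpp s 0 w i j) (glpp 0 t w i j).
Proof.
move=> s0 t0; have h i' s' : 0 <= s' -> 0 <= lpp (bdry s' 0 w) i' 0 by move=> s'0; exact: (@glpp_ge0 s' 0 i' 0%N s'0 (lexx 0)).
have v j' : 0 <= lpp (bdry 0 t w) 0 j' by exact: (@glpp_ge0 0 t 0%N j' (lexx 0) t0).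
have bh i' : lpp (bdry 0 t w) i' 0 = 0.
  by elim: i' => [|i' IH]; rewrite ?lpp00// lppS0 IH /bdry eqxx mul0r addr0.
have bv j' : lpp (bdry s 0 w) 0 j' = 0.
  by elim: j' => [|j' IH]; rewrite ?lpp00// lpp0S IH /bdry eqxx mul0r addr0.
rewrite /glpp; move: i j; apply: lpp_ind2.
- by rewrite !lpp00 maxxx.
- move=> i _; rewrite bh (max_idPl _) ?h//.
  by elim: (i.+1) => [|k IH]; rewrite ?lpp00// !lppS0 IH /bdry eqxx.
- by move=> j _; rewrite bv (max_idPr _) ?v.
- move=> i j H1 H2 _; rewrite !lppSS H1 H2 /bdry /= -addr_maxr; congr (_ + _).
  by rewrite maxACA.
Qed.

Lemma glpp_le s t s' t' i j : s <= s' -> t <= t' -> glpp s t w i j <= glpp s' t' w i j.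
Proof.
move=> ss tt; rewrite /glpp; move: i j; apply: lpp_ind2.
- by rewrite !lpp00.
- by move=> i H; rewrite !lppS0 lerD// /bdry eqxx ler_wpM2r.
- by move=> i H; rewrite !lpp0S lerD// /bdry/= ler_wpM2r.
- by move=> i j H H' _; rewrite !lppSS {1}/bdry /= {2}/bdry /= lerD2l ge_max !le_max H H' orbT.
Qed.

(** For a fixed path the weight is affine in $(s,t)$, and a maximum of affine functions is
    convex. *)
Lemma glpp_convex s t s' t' i j :
  2 * glpp ((s + s') / 2) ((t + t') / 2) w i j <= glpp s t w i j + glpp s' t' w i j.
Proof.
rewrite /glpp; move: i j; apply: lpp_ind2.
- by rewrite !lpp00; lra.
- move=> i; rewrite !lppS0.
  by move: (lpp _ i 0) (lpp _ i 0) (lpp _ i 0) => a b c; rewrite /bdry/=; lra.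
- move=> j; rewrite !lpp0S.
  by move: (lpp _ 0 j) (lpp _ 0 j) (lpp _ 0 j) => a b c; rewrite /bdry/=; lra.
- move=> i j; rewrite !lppSS.
  move: (lpp (bdry ((s + s') / 2) _ w) i j.+1) (lpp (bdry ((s + s') / 2) _ w) i.+1 j) => a b.
  move: (lpp (bdry s t w) i j.+1) (lpp (bdry s t w) i.+1 j) => a1 b1.
  move: (lpp (bdry s' t' w) i j.+1) (lpp (bdry s' t' w) i.+1 j) => a2 b2 H1 H2 _.
  rewrite /bdry/=.
  have x1 : a1 <= Num.max a1 b1 by rewrite le_max lexx.
  have x2 : b1 <= Num.max a1 b1 by rewrite le_max lexx orbT.
  have x3 : a2 <= Num.max a2 b2 by rewrite le_max lexx.
  have x4 : b2 <= Num.max a2 b2 by rewrite le_max lexx orbT.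
  by case: (leP a b) => _; lra.
Qed.

(* If the geodesic to (i0, n) of the model with boundary (s, t) leaves through the vertical axis, its
   row increments are dominated by those of the model without boundary. *)
Lemma row_comparison s t i0 n : 0 <= s -> 0 <= t ->
  glpp s 0 w i0 n <= glpp 0 t w i0 n ->
  forall i, (i < i0)%N -> hinc (glpp s t w) i n <= hinc (glpp 0 0 w) i n.
Proof.
move=> s0 t0 H i ii0.
have m1 k : hinc (glpp 0 t w) k n <= hinc (glpp 0 0 w) k n.
  by apply: (inc_mono _ _ _ k n).1 => // j; rewrite /bdry/= ler_wpM2r.
have m2 k : hinc (glpp 0 0 w) k n <= hinc (glpp s 0 w) k n.
  by apply: (inc_mono _ _ _ k n).1 => // j; rewrite /bdry/= ler_wpM2r.
(* By [m1] and [m2] the horizontal passage time minus the vertical one is nondecreasing in [k], so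
   its sign at [i0] persists to the left. *)
have E k : (k <= i0)%N -> glpp s 0 w k n <= glpp 0 t w k n.
  move=> ki0; rewrite -(subKn ki0); elim: (i0 - k)%N (leq_subr k i0) => [|l IH] li0.
    by rewrite subn0.
  have := IH (ltnW li0); rewrite -(subnSK li0) => IH'.
  have := le_trans (m1 (i0 - l.+1)%N) (m2 (i0 - l.+1)%N); rewrite /hinc; lra.
have G k : (k <= i0)%N -> glpp s t w k n = glpp 0 t w k n.
  by move=> ki0; rewrite glpp_max// (max_idPr _)//; exact: E.
by rewrite /hinc !G// 1?ltnW//; exact: m1.
Qed.

End nonneg.

Lemma glpp_tr s t w i j : glpp s t (fun i j => w j i) i j = glpp t s w j i.
Proof.
rewrite /glpp -lpp_tr; apply: lpp_ext => -[|i'] [|j'] //.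
Qed.

End lpp.

(** * Stationary model *)

Arguments indep {d T R} P D c s : simpl never.
Section stationary.
Context d (T : measurableType d) (R : realType) (P : probability T R).
Notation mR := (measurableTypeR R).
Notation indep := (@indep d T R P).
Notation rv := (@rv d T R).

Lemma indep_catCA s1 s2 s3 D c : indep D c (s1 ++ s2 ++ s3) -> indep D c (s2 ++ s1 ++ s3).
Proof. by rewrite !catA; apply: indep_head_sub => D' c'; exact: indep_catC. Qed.

Section burke_rows.
Variables (w : nat -> nat -> T -> R) (a b : R).
Hypotheses (a0 : 0 < a) (b0 : 0 < b) (ab : a + b = 1).

Let g (t : T) := lpp (fun i j => w i j t).
Let H i j := rv (fun t => hinc (g t) i j) a.
Let V i j := rv (fun t => vinc (g t) i j) b.
Let B i j := rv (w i.+1 j.+1) 1.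

(** A vertical increment crosses the row from left to right. In each cell it meets the horizontal
    increment below and the bulk weight, and [indep_burke] leaves behind the horizontal increment of
    the next row. [ctx] holds the variables not involved. *)
Let row_step j ctx k : forall i D c,
  indep D c (V i j :: [seq H i' j | i' <- iota i k] ++ [seq B i' j | i' <- iota i k] ++ ctx) ->
  indep D c ([seq H i' j.+1 | i' <- iota i k] ++ V (i + k) j :: ctx).
Proof.
elim: k => [|k IH] i D c /=; first by rewrite addn0.
move=> /(@indep_front _ _ _ _ (V i j :: H i j :: _)) /= /indep_swap K.
have {}K : indep D c [:: V i j, H i j, B i j & [seq H i' j | i' <- iota i.+1 k] ++
    [seq B i' j | i' <- iota i.+1 k] ++ ctx].
  by apply: (@indep_cat_sub _ _ _ _ [:: V i j] _ _ _ _ _ K) => D' c'; exact: indep_swap.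
have /(indep_burke a0 b0) {}K : indep D c [:: H i j, V i j, rv (w i.+1 j.+1) (a + b)
    & [seq H i' j | i' <- iota i.+1 k] ++ [seq B i' j | i' <- iota i.+1 k] ++ ctx].
  by rewrite ab; exact: indep_swap.
rewrite addnS -addSn; apply: (@indep_cat_sub _ _ _ _ [:: H i j.+1] _ _ (IH i.+1)).
move: K; rewrite /H /V /=.
rewrite (_ : (fun t => hinc (g t) i j.+1) = fun t => burkeI (hinc (g t) i j) (vinc (g t) i j) (w i.+1 j.+1 t)); last first.
  by apply/funext => t; rewrite /g hincS.
rewrite (_ : (fun t => vinc (g t) i.+1 j) = fun t => burkeI (vinc (g t) i j) (hinc (g t) i j) (w i.+1 j.+1 t)) //.
by apply/funext => t; rewrite /g vincS.
Qed.

(** Pushing the path of increments up by one row consumes a vertical increment on the left and a row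
    of bulk weights, and releases a vertical increment on the right; the laws never change. *)
Lemma indep_stationary m k : forall j D c ctx,
  indep D c ([seq H i j | i <- iota 0 m] ++ [seq V 0 j' | j' <- iota j k] ++
    flatten [seq [seq B i j' | i <- iota 0 m] | j' <- iota j k] ++ ctx) ->
  indep D c ([seq H i (j + k) | i <- iota 0 m] ++ [seq V m j' | j' <- iota j k] ++ ctx).
Proof.
elim: k => [|k IH] j D c ctx /=; first by rewrite addn0.
move=> /indep_front K.
have {}K : indep D c (V 0 j :: [seq H i j | i <- iota 0 m] ++ [seq B i j | i <- iota 0 m] ++
    [seq V 0 j' | j' <- iota j.+1 k] ++
    flatten [seq [seq B i j' | i <- iota 0 m] | j' <- iota j.+1 k] ++ ctx).
  apply: (@indep_cat_sub _ _ _ _ (V 0 j :: [seq H i j | i <- iota 0 m]) _ _ _ _ _ K) => D' c'.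
  by rewrite -catA; exact: indep_catCA.
have {}K := indep_front (row_step K); rewrite add0n in K.
rewrite -addSnnS; apply: indep_back.
by apply: (@indep_cat_sub _ _ _ _ [:: V m j] _ _ _ _ _ K) => D' c'; exact: IH.
Qed.

End burke_rows.

Lemma indep_scale1 D c (X : T -> mR) r k s : 0 < r -> 0 < k ->
  indep D c (rv X r :: s) -> indep D c (rv (fun t => k * X t) (r / k) :: s).
Proof.
move=> r0 k0 [mX K]; split=> [|g cg mg g0 Hg]; first exact: measurable_funM.
apply: (K (fun x => g (k * x))) => //.
  by apply: measurableT_comp mg _; exact: measurable_funM.
have mgE : measurable_fun setT (EFin \o g) by exact/measurable_EFinP.
have gE0 x : (0 <= (EFin \o g) x)%E by rewrite /= lee_fin.
by rewrite -Hg; exact: (integral_expd_scale r0 k0 mgE gE0).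
Qed.

Lemma indep_map_scale I (l : seq I) (X : I -> T -> mR) (k : R) s D c : 0 < k ->
  indep D c ([seq rv (X i) 1 | i <- l] ++ s) ->
  indep D c ([seq rv (fun t => k * X i t) k^-1 | i <- l] ++ s).
Proof.
move=> k0; apply: indep_head_all; first by rewrite !size_map.
move=> i D' c' X0; rewrite size_map => il.
have x0 : I by case: l il.
rewrite !(nth_map x0)// -(div1r k); exact: indep_scale1.
Qed.

Lemma indep_mean I (l : seq I) (X : I -> T -> mR) r : 0 < r ->
  indep (fun=> 1) 1 [seq rv (X i) r | i <- l] -> (forall i t, 0 <= X i t) ->
  (\int[P]_t (\sum_(i <- l) X i t)%:E = ((size l)%:R / r)%:E)%E.
Proof.
move=> r0 + X0; elim: l => [|i l IH] K.
  by under eq_integral do rewrite big_nil; rewrite integral0 mul0r.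
under eq_integral do rewrite big_cons EFinD.
have [mX KX] := K.
rewrite ge0_integralD//; last 4 first.
- by move=> t _; rewrite lee_fin.
- exact/measurable_EFinP.
- by move=> t _; rewrite lee_fin sumr_ge0.
- apply/measurable_EFinP; have := @indep_measurable _ _ _ P _ l X r (fun=> 1) 1 [::].
  by rewrite cats0 => /(_ (indep_behead K) _ (leqnn _)); rewrite take_size.
rewrite (IH (indep_behead K)).
have mm : measurable_fun setT (fun x : mR => Num.max x 0 : mR) by exact: measurable_maxr.
have m0 (x : mR) : 0 <= Num.max x 0 by rewrite le_max lexx orbT.
have [_ _] := indep_nil (KX _ _ mm m0 (expd_mean r0)).
rewrite (_ : integral _ _ _ = \int[P]_t (X i t)%:E)%E; last first.
  by apply: eq_integral => t _; rewrite /= (max_idPl _)// mul1r.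
by move=> ->; rewrite -EFinD /= -natr1; congr (_%:E); ring.
Qed.

(** Independence is asked for inside the rectangle only: the fields built from [om] below repeat
    some of its entries outside. *)
Definition iid_rect (m n : nat) (W : nat -> nat -> T -> R) :=
  (forall i j t, 0 <= W i j t) /\
  (forall s : seq (nat * nat), uniq s -> all (fun p => (p.1 <= m)%N && (p.2 <= n)%N) s ->
    indep (fun=> 1) 1 [seq rv (W p.1 p.2) 1 | p <- s]).

Lemma iid_rect_sub m n m' n' W : (m' <= m)%N -> (n' <= n)%N ->
  iid_rect m n W -> iid_rect m' n' W.
Proof.
move=> mm nn [W0 WI]; split=> // s us /allP ls; apply: WI => //; apply/allP => p ps.
by have /andP[h1 h2] := ls _ ps; rewrite (leq_trans h1 mm) (leq_trans h2 nn).
Qed.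

Lemma iid_rect_tr m n W : iid_rect m n W -> iid_rect n m (fun i j => W j i).
Proof.
move=> [W0 WI]; split=> // s us ls.
pose sw (p : nat * nat) := (p.2, p.1).
have := WI [seq sw p | p <- s]; rewrite -map_comp; apply.
  by rewrite map_inj_uniq// => -[x y] [x' y'] [-> ->].
by rewrite all_map; apply/allP => p ps /=; rewrite andbC; exact: (allP ls _ ps).
Qed.

Section field.
Variables (m n : nat) (W : nat -> nat -> T -> R).
Hypothesis iidW : iid_rect m n W.

Definition gfield (s t : R) (x : T) := glpp s t (fun i j => W i j x).

Let site_list : seq (nat * nat) := [seq (i.+1, 0%N) | i <- iota 0 m] ++
  [seq (0%N, j.+1) | j <- iota 0 n] ++
  flatten [seq [seq (i.+1, j.+1) | i <- iota 0 m] | j <- iota 0 n].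

Let initial (s t : R) : 0 < s -> 0 < t ->
  indep (fun=> 1) 1 ([seq rv (fun x => hinc (gfield s t x) i 0) s^-1 | i <- iota 0 m] ++
  [seq rv (fun x => vinc (gfield s t x) 0 j) t^-1 | j <- iota 0 n] ++
  flatten [seq [seq rv (W i.+1 j.+1) 1 | i <- iota 0 m] | j <- iota 0 n] ++ [::]).
Proof.
move=> s0 t0; have [_ WI] := iidW.
have us : uniq site_list.
  rewrite /site_list !cat_uniq; apply/and3P; split.
  - by rewrite map_inj_uniq ?iota_uniq// => x y [].
  - apply/hasPn => p; rewrite mem_cat => /orP[/mapP[j _ ->]|/flatten_mapP[j _ /mapP[i _ ->]]].
      by apply/mapP => -[].
    by apply/mapP => -[].
  - apply/and3P; split.
    + by rewrite map_inj_uniq ?iota_uniq// => x y [].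
    + apply/hasPn => p /flatten_mapP[j _ /mapP[i _ ->]]; by apply/mapP => -[].
    + apply: allpairs_uniq; rewrite ?iota_uniq//.
      by move=> [x y] [x' y'] _ _ /= [-> ->].
have ls : all (fun p => (p.1 <= m)%N && (p.2 <= n)%N) site_list.
  rewrite /site_list !all_cat; apply/and3P; split.
  - by rewrite all_map; apply/allP => i; rewrite mem_iota/= andbT.
  - by rewrite all_map; apply/allP => i; rewrite mem_iota.
  - by apply/allP => p /flatten_mapP[j + /mapP[i + ->]]; rewrite !mem_iota/= => -> ->.
have := WI _ us ls; rewrite /site_list !map_cat -!map_comp.
rewrite (_ : map _ (flatten _) = flatten [seq [seq rv (W i.+1 j.+1) 1 | i <- iota 0 m] | j <- iota 0 n]); last first.
  by rewrite map_flatten -map_comp; congr flatten; apply: eq_map => j /=; rewrite -map_comp.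
move=> /(@indep_map_scale _ _ (fun i => W i.+1 0%N) _ _ _ _ s0).
move=> K; rewrite cats0.
have {}K := indep_cat_sub (fun D c => @indep_map_scale _ _ (fun j => W 0%N j.+1) _ _ D c t0) K.
rewrite (_ : [seq rv (fun x => hinc (gfield s t x) i 0) s^-1 | i <- iota 0 m] =
  [seq rv (fun t => s * W i.+1 0%N t) s^-1 | i <- iota 0 m]); last first.
  by apply: eq_map => i; congr rv; apply/funext => x; rewrite /gfield hinc0.
rewrite (_ : [seq rv (fun x => vinc (gfield s t x) 0 j) t^-1 | j <- iota 0 n] =
  [seq rv (fun x => t * W 0%N j.+1 x) t^-1 | j <- iota 0 n])//.
by apply: eq_map => i; congr rv; apply/funext => x; rewrite /gfield vinc0.
Qed.

Let field0 i j t : 0 <= W i j t. Proof. by case: iidW. Qed.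

Lemma gfield_measurable s t i j : (i <= m)%N -> (j <= n)%N -> 0 <= s -> 0 <= t ->
  measurable_fun setT (fun x => gfield s t x i j : mR).
Proof.
move=> + + s0 t0.
have mW i' j' : (i' <= m)%N -> (j' <= n)%N ->
    measurable_fun setT (fun x => bdry s t (fun i j => W i j x) i' j' : mR).
  move=> im jn; have [_ /(_ [:: (i', j')] isT)] := iidW.
  rewrite /= im jn => /(_ isT)[/= mW _]; rewrite /bdry.
  by case: (j' == 0%N); [|case: (i' == 0%N)] => //; exact: measurable_funM.
rewrite /gfield /glpp; move: i j; apply: lpp_ind2.
- by move=> _ _; under eq_fun do rewrite lpp00; exact: measurable_cst.
- move=> i IH im jn; under eq_fun do rewrite lppS0.
  by apply: measurable_funD; [exact: IH (ltnW im) jn|exact: mW].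
- move=> j IH im jn; under eq_fun do rewrite lpp0S.
  by apply: measurable_funD; [exact: IH im (ltnW jn)|exact: mW].
- move=> i j H1 H2 _ im jn; under eq_fun do rewrite lppSS.
  apply: measurable_funD; first exact: mW.
  by apply: measurable_maxr; [exact: H1 (ltnW im) jn|exact: H2 im (ltnW jn)].
Qed.

Lemma stationary_rows a : 0 < a < 1 ->
  indep (fun=> 1) 1 ([seq rv (fun x => hinc (gfield a^-1 (1 - a)^-1 x) i n) a | i <- iota 0 m] ++
    [seq rv (fun x => vinc (gfield a^-1 (1 - a)^-1 x) m j) (1 - a) | j <- iota 0 n]).
Proof.
move=> /andP[a0 a1]; have a1' : 0 < 1 - a by lra.
have av : 0 < a^-1 by rewrite invr_gt0.
have av' : 0 < (1 - a)^-1 by rewrite invr_gt0.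
have := initial av av'; rewrite !invrK => K.
have := @indep_stationary (fun i j x => bdry a^-1 (1 - a)^-1 (fun i j => W i j x) i j)
  a (1 - a) a0 a1' (subrKC _ _) m n 0 (fun=> 1) 1 [::] K.
by rewrite add0n cats0.
Qed.

Definition fmean (a : R) : R := m%:R / a + n%:R / (1 - a).

Lemma stationary_mean a : 0 < a < 1 ->
  (\int[P]_x (gfield a^-1 (1 - a)^-1 x m n)%:E = (fmean a)%:E)%E.
Proof.
move=> /[dup] a01 /andP[a0 a1]; have a1' : 0 < 1 - a by lra.
have av : 0 < a^-1 by rewrite invr_gt0.
have av' : 0 < (1 - a)^-1 by rewrite invr_gt0.
have K := stationary_rows a01.
have := indep_catC K => /indep_drop KH.
have KV : indep (fun=> 1) 1 [seq rv (fun x => vinc (gfield a^-1 (1 - a)^-1 x) 0 j) (1 - a) | j <- iota 0 n].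
  have := initial av av'; rewrite invrK invrK => /indep_drop.
  by rewrite cats0 => /indep_catC /indep_drop.
have w0 x i j : 0 <= bdry a^-1 (1 - a)^-1 (fun i j => W i j x) i j by apply: bdry_ge0 => //; exact: ltW.
have h0 i x : 0 <= hinc (gfield a^-1 (1 - a)^-1 x) i n by have [] := inc_ge0 (w0 x) i n.
have v0 j x : 0 <= vinc (gfield a^-1 (1 - a)^-1 x) 0 j by have [] := inc_ge0 (w0 x) 0%N j.
under eq_integral.
  move=> x _; rewrite /gfield /glpp lpp_hsum lpp_vsum lpp00 add0r EFinD.
  over.
rewrite ge0_integralD//=; last 4 first.
- by move=> x _; rewrite lee_fin sumr_ge0// => j _; exact: v0.
- apply/measurable_EFinP.
  have := @indep_measurable _ _ _ P _ (iota 0 n) (fun j x => vinc (gfield a^-1 (1 - a)^-1 x) 0 j)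
    (1 - a) (fun=> 1) 1 [::].
  by rewrite cats0 => /(_ KV _ (leqnn _)); rewrite take_size.
- by move=> x _; rewrite lee_fin sumr_ge0// => j _; exact: h0.
- apply/measurable_EFinP.
  have := @indep_measurable _ _ _ P _ (iota 0 m) (fun j x => hinc (gfield a^-1 (1 - a)^-1 x) j n)
    a (fun=> 1) 1 [::].
  by rewrite cats0 => /(_ KH _ (leqnn _)); rewrite take_size.
have := indep_mean a0 KH h0; rewrite /gfield /glpp => ->.
have := indep_mean a1' KV v0; rewrite /gfield /glpp => ->.
by rewrite !size_iota -EFinD addrC.
Qed.

(** Tilting the horizontal axis from rate [v] to rate [z] makes the model stationary of parameter
    [z]. The tilting density is $(z/v)^m$ times the exponential of $v-z$ times the axis sum. What
    remains of the passage time is the right column, i.i.d. of rate $1-z$ under the tilted law, and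
    its exponential moment at $v-z$ is explicit. *)
Lemma boundary_mgf z v : 0 < z -> z < v -> v < 1 ->
  (\int[P]_x (expR ((v - z) * gfield v^-1 (1 - z)^-1 x m n))%:E =
   ((v / z) ^+ m * ((1 - z) / (1 - v)) ^+ n)%:E)%E.
Proof.
move=> z0 zv v1; have v0 : 0 < v by lra.
have z1' : 0 < 1 - z by lra.
have vv : 0 < v^-1 by rewrite invr_gt0.
have zz : 0 < (1 - z)^-1 by rewrite invr_gt0.
have := initial vv zz; rewrite !invrK => /(indep_tilt v0 z0) K.
set D := (fun t => _) in K.
have := @indep_stationary (fun i j x => bdry v^-1 (1 - z)^-1 (fun i j => W i j x) i j)
  z (1 - z) z0 z1' (subrKC _ _) m n 0 D 1 [::] K.
rewrite add0n cats0 => /indep_drop {}K.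
have vz : v - z < 1 - z by lra.
have := indep_mgf z1' vz K; rewrite size_iota mul1r.
rewrite (_ : 1 - z - (v - z) = 1 - v)%R; last by ring.
move=> E; rewrite EFinM -E.
rewrite -ge0_integralZl_EFin//; last 3 first.
- move=> x _; rewrite lee_fin mulr_ge0 ?expR_ge0//.
  by have [_ D0 _] := indep_nil K; exact: D0.
- have [mD D0 _] := indep_nil K; apply/measurable_EFinP; apply: measurable_funM => //.
  apply: measurableT_comp => //; apply: measurable_funM => //.
  have := @indep_measurable _ _ _ P _ (iota 0 n) (fun j x => vinc (gfield v^-1 (1 - z)^-1 x) m j)
    (1 - z) D 1 [::].
  by rewrite cats0 => /(_ K _ (leqnn _)); rewrite take_size.
- by rewrite exprn_ge0// divr_ge0// ltW.
apply: eq_integral => x _; rewrite -EFinM; congr (_%:E).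
rewrite /D mul1r big_split/= -expR_sum -mulr_sumr.
rewrite big_const_seq count_predT size_iota iter_mulr_1.
rewrite [X in _ = _ * (X * _ * _)](_ : _ = ((v / z) ^+ m)^-1); last first.
  by rewrite -exprVn invf_div.
rewrite !mulrA divff ?mul1r; last by rewrite expf_neq0// gt_eqF// divr_gt0.
rewrite -expRD -mulrDr; congr (expR (_ * _)).
rewrite /gfield /glpp lpp_vsum; congr (_ + _).
by rewrite lpp_hsum lpp00 add0r.
Qed.

End field.
End stationary.

(** * One-point and exit-point estimates *)

Section log_bound.
Context {R : realType}.

(** [fmean] is the derivative of $m\ln x-n\ln(1-x)$, whose increment from [z] to [v] is the
    logarithm of the left side; the mean value theorem concludes. *)
Lemma mgf_exponent_bound (m n : nat) (z v M : R) : 0 < z -> z < v -> v < 1 ->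
  (forall x : R, z <= x <= v -> fmean m n x <= M) ->
  (v / z) ^+ m * ((1 - z) / (1 - v)) ^+ n <= expR ((v - z) * M).
Proof.
move=> z0 zv v1 HM.
have v0 : 0 < v by lra.
have z1 : 0 < 1 - z by lra.
have v1' : 0 < 1 - v by lra.
pose Lam (x : R) : R := m%:R * ln x - n%:R * ln (1 - x).
have dLam (x : R) : 0 < x < 1 -> is_derive x 1 Lam (fmean m n x).
  move=> /andP[x0 x1]; have x1' : 0 < 1 - x by lra.
  have d1 : is_derive x 1 (@ln R) x^-1 by exact: is_derive1_ln.
  have d2 : is_derive (1 - x) 1 (@ln R) (1 - x)^-1 by exact: is_derive1_ln.
  have d3 : is_derive x 1 (fun x : R => 1 - x) (-1).
    have := is_deriveB (is_derive_cst (1 : R) x 1) (is_derive_id x (1 : R)).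
    by move=> d; apply: (is_derive_eq d); rewrite sub0r.
  have d4 : is_derive x 1 (fun x : R => ln (1 - x)) ((1 - x)^-1 * -1) by exact: is_derive1_comp.
  rewrite /Lam /fmean.
  have d5 := is_deriveB (is_deriveZ m%:R d1) (is_deriveZ n%:R d4).
  by apply: (is_derive_eq d5); rewrite -[(_ *: _)%R]/(m%:R * x^-1) -[X in _ - X]/(n%:R * ((1 - x)^-1 * -1)); ring.
have [c cI Ec] : exists2 c, c \in `]z, v[ & Lam v - Lam z = fmean m n c * (v - z).
  apply: MVT => //.
    by move=> x; rewrite in_itv/= => /andP[zx xv]; apply: dLam; apply/andP; split; lra.
  apply: derivable_within_continuous => x; rewrite in_itv/= => /andP[zx xv].
  have x01 : 0 < x < 1 by apply/andP; split; lra.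
  by case: (dLam x x01).
have -> : (v / z) ^+ m * ((1 - z) / (1 - v)) ^+ n = expR (Lam v - Lam z).
  rewrite (_ : Lam v - Lam z = m%:R * (ln v - ln z) + n%:R * (ln (1 - z) - ln (1 - v))); last first.
    by rewrite /Lam; ring.
  rewrite -!ln_div ?posrE// expRD.
  by rewrite ![_%:R * _]mulrC !expRM_natr !lnK// posrE divr_gt0.
rewrite ler_expR Ec mulrC ler_pM2l; last lra.
by apply: HM; move: cI; rewrite in_itv/= => /andP[zc cv]; apply/andP; split; lra.
Qed.
End log_bound.

Section characteristic.
Context {R : realType}.
Variables (m n : nat) (N rho : R).
Hypotheses (mE : m%:R = N * rho ^+ 2) (nE : n%:R = N * (1 - rho) ^+ 2).
Hypotheses (N0 : 0 < N) (rho0 : 0 < rho) (rho1 : rho < 1).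

Let hyps : [/\ 0 < N, 0 < rho & rho < 1]. Proof. by []. Qed.

(** Exhibits the quadratic minimum at $\rho$: moving the parameter by order $N^{-1/3}$ costs order
    $N^{1/3}$, the scale of the fluctuations. *)
Lemma fmean_char (x : R) : 0 < x -> x < 1 ->
  fmean m n x = N + N * (x - rho) ^+ 2 / (x * (1 - x)).
Proof. have [N0' r0' r1'] := hyps; by move=> x0 x1; rewrite /fmean mE nE; field; rewrite !gt_eqF//; lra. Qed.

Lemma fmean_rho : fmean m n rho = N.
Proof. have [N0' r0' r1'] := hyps; by rewrite fmean_char//; ring. Qed.

Lemma fmean_sub (x y : R) : 0 < x -> x < 1 -> 0 < y -> y < 1 ->
  fmean m n x - fmean m n y = N * (x - y) *
    ((1 - rho) ^+ 2 * x * y - rho ^+ 2 * (1 - x) * (1 - y)) / (x * y * (1 - x) * (1 - y)).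
Proof. have [N0' r0' r1'] := hyps; by move=> *; rewrite /fmean mE nE; field; rewrite !gt_eqF//; lra. Qed.

Lemma fmean_mono (x y : R) : rho <= y -> y <= x -> x < 1 -> fmean m n y <= fmean m n x.
Proof.
have [N0' r0' r1'] := hyps; move=> ry yx x1; rewrite -subr_ge0 fmean_sub; try lra.
apply: divr_ge0; last first.
  by apply: mulr_ge0; [apply: mulr_ge0; [apply: mulr_ge0|]|]; lra.
apply: mulr_ge0; first by apply: mulr_ge0; lra.
have h1 : 0 <= rho * (1 - x) by apply: mulr_ge0; lra.
have h2 : 0 <= rho * (1 - y) by apply: mulr_ge0; lra.
have h3 : rho * (1 - x) <= (1 - rho) * x by lra.
have h4 : rho * (1 - y) <= (1 - rho) * y by lra.
have := ler_pM h1 h2 h3 h4; rewrite -subr_ge0; lra.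
Qed.

Lemma fmean_near (x e eta : R) : 0 < eta -> eta <= x -> x <= 1 - eta -> - e <= x - rho <= e ->
  fmean m n x <= N + N * e ^+ 2 / eta ^+ 2.
Proof.
have [N0' r0' r1'] := hyps; move=> eta0 ex xe /andP[he1 he2]; rewrite fmean_char ?lerD2l; try lra.
have h1 : (x - rho) ^+ 2 <= e ^+ 2 by nra.
have h2 : eta ^+ 2 <= x * (1 - x) by nra.
have e20 : 0 < eta ^+ 2 by rewrite exprn_gt0.
rewrite -[leLHS]mulrA -[leRHS]mulrA ler_wpM2l ?(ltW N0)//.
apply: ler_pM; rewrite ?sqr_ge0 ?invr_ge0//; first by rewrite (le_trans _ h2)// ltW.
by rewrite lef_pV2// posrE (lt_le_trans e20).
Qed.

End characteristic.

(** * Exit points of the stationary model *)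

Section estimates.
Context d (T : measurableType d) (R : realType) (P : probability T R).
Notation mR := (measurableTypeR R).
Notation pbd := (@pbd d T R P).

(** With $G=\max(u,v)$ of mean $f$, integration bounds the expected deficit of $G$ by the expected
    excesses of the two one-sided passage times. The source is $(f-G)^+=f-G+(G-f)^+$. *)
Lemma max_shift (f u v : R) :
  Num.max (f - Num.max u v) 0 + Num.max u v <= f + (Num.max (u - f) 0 + Num.max (v - f) 0).
Proof.
case: (leP u v) => uv; [case: (leP (f - v) 0)|case: (leP (f - u) 0)] => h1;
  case: (leP (u - f) 0) => h2; case: (leP (v - f) 0) => h3; lra.
Qed.

(** Pointwise $\lambda(X-\mu)^+\le K+e^{\lambda(X-\mu)-K}$, by $1+x\le e^x$, and the exponential has
    mean at most 1. *)
Lemma pos_part_mgf (X : T -> mR) (lam mu K : R) : measurable_fun setT X ->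
  0 < lam -> 0 <= K ->
  (\int[P]_t (expR (lam * X t))%:E <= (expR (lam * mu + K))%:E)%E ->
  (\int[P]_t (Num.max (X t - mu) 0)%:E <= ((K + 1) / lam)%:E)%E.
Proof.
move=> mX l0 K0 H.
pose b := expR (- (lam * mu + K)) / lam.
have b0 : 0 <= b by rewrite divr_ge0 ?expR_ge0// ltW.
have me : measurable_fun setT (fun t => (expR (lam * X t))%:E).
  by apply/measurable_EFinP; apply: measurableT_comp => //; exact: measurable_funM.
have Kl : 0 <= K / lam by rewrite divr_ge0// ltW.
apply: (@le_trans _ _ (\int[P]_t ((K / lam)%:E + b%:E * (expR (lam * X t))%:E))%E).
  apply: ge0_le_integral => //.
  - by move=> t _; rewrite lee_fin le_max lexx orbT.
  - by apply/measurable_EFinP; apply: measurable_maxr => //; exact: measurable_funB.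
  - by apply: emeasurable_funD => //; exact: emeasurable_funM.
  move=> t _; rewrite -EFinM -EFinD lee_fin ge_max; apply/andP; split; last first.
    by rewrite addr_ge0// mulr_ge0// expR_ge0.
  rewrite /b mulrAC -expRD -mulrDl ler_pdivlMr//.
  have := expR_ge1Dx (- (lam * mu + K) + lam * X t); lra.
rewrite ge0_integralD//; last 2 first.
- by move=> t _; rewrite -EFinM lee_fin mulr_ge0// expR_ge0.
- exact: emeasurable_funM.
rewrite integral_cst// [X in (_ * X)%E]probability_setT mule1 ge0_integralZl_EFin//.
apply: (@le_trans _ _ ((K / lam)%:E + b%:E * (expR (lam * mu + K))%:E)%E).
  by rewrite leeD2l// lee_wpmul2l// lee_fin.
by rewrite -EFinM -EFinD lee_fin /b mulrAC -expRD addNr expR0 mulrDl.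
Qed.

Lemma exp_tail (X : T -> mR) (lam M y : R) : measurable_fun setT X -> 0 < lam ->
  (\int[P]_t (expR (lam * X t))%:E <= (expR (lam * M))%:E)%E ->
  pbd [set t | M + y <= X t] (expR (- (lam * y))).
Proof.
move=> mX l0 H.
have me : measurable_fun setT (fun t => expR (lam * X t) : mR).
  by apply: measurableT_comp => //; exact: measurable_funM.
have := pbd_markov (expR_gt0 (lam * (M + y))) me (fun=> expR_ge0 _) H.
rewrite -expRN -expRD (_ : lam * M - lam * (M + y) = - (lam * y)); last by ring.
by apply: pbd_sub => t /= h; rewrite ler_expR ler_pM2l.
Qed.

(** The pointwise bound is integrated and the finite mean [c] of [G] cancelled; this is how knowing
    a mean exactly becomes a bound on a deficit. *)
Lemma integral_le_shift (F G H : T -> mR) (c h : R) :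
  measurable_fun setT F -> measurable_fun setT G -> measurable_fun setT H ->
  (forall t, 0 <= F t) -> (forall t, 0 <= G t) -> (forall t, 0 <= H t) -> 0 <= c ->
  (forall t, F t + G t <= c + H t) ->
  (\int[P]_t (G t)%:E = c%:E)%E -> (\int[P]_t (H t)%:E <= h%:E)%E ->
  (\int[P]_t (F t)%:E <= h%:E)%E.
Proof.
move=> mF mG mH F0 G0 H0 c0 FGH IG IH.
have : (\int[P]_t (F t)%:E + c%:E <= c%:E + h%:E)%E.
  rewrite -IG -ge0_integralD//; last 4 first.
  - by move=> t _; rewrite lee_fin.
  - exact/measurable_EFinP.
  - by move=> t _; rewrite lee_fin.
  - exact/measurable_EFinP.
  apply: (@le_trans _ _ (\int[P]_t (c%:E + (H t)%:E))%E).
    apply: ge0_le_integral => //.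
    - by move=> t _; rewrite -EFinD lee_fin addr_ge0.
    - by apply: emeasurable_funD; exact/measurable_EFinP.
    - by apply: emeasurable_funD => //; exact/measurable_EFinP.
    - by move=> t _; rewrite -!EFinD lee_fin.
  rewrite ge0_integralD//; last 2 first.
  - by move=> t _; rewrite lee_fin.
  - exact/measurable_EFinP.
  rewrite integral_cst// [X in (_ * X)%E]probability_setT mule1 IG.
  by rewrite leeD2l.
by rewrite addeC leeD2lE.
Qed.

Lemma integralD_le (F G : T -> mR) (h k : R) :
  measurable_fun setT F -> measurable_fun setT G ->
  (forall t, 0 <= F t) -> (forall t, 0 <= G t) ->
  (\int[P]_t (F t)%:E <= h%:E)%E -> (\int[P]_t (G t)%:E <= k%:E)%E ->
  (\int[P]_t (F t + G t)%:E <= (h + k)%:E)%E.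
Proof.
move=> mF mG F0 G0 IF IG; under eq_integral do rewrite EFinD.
rewrite ge0_integralD//; last 4 first.
- by move=> t _; rewrite lee_fin.
- exact/measurable_EFinP.
- by move=> t _; rewrite lee_fin.
- exact/measurable_EFinP.
by rewrite EFinD leeD.
Qed.

Lemma integralZ_le (F : T -> mR) (h k : R) : measurable_fun setT F ->
  (forall t, 0 <= F t) -> 0 <= k -> (\int[P]_t (F t)%:E <= h%:E)%E ->
  (\int[P]_t (k * F t)%:E <= (k * h)%:E)%E.
Proof.
move=> mF F0 k0 IF; under eq_integral do rewrite EFinM.
have mFE : measurable_fun setT (EFin \o F) by exact/measurable_EFinP.
have F0E t : setT t -> (0 <= (EFin \o F) t)%E by move=> _; rewrite /= lee_fin.
rewrite (ge0_integralZl_EFin _ measurableT F0E mFE k0).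
by rewrite EFinM lee_wpmul2l ?lee_fin.
Qed.

(** Boundary weights below those of [boundary_mgf] only decrease the passage time, so its exact
    moment also serves for one-sided boundaries and for none. *)
Lemma gfield_mgf_le m n W (z v M s t : R) : iid_rect P m n W ->
  0 < z -> z < v -> v < 1 -> (forall x : R, z <= x <= v -> fmean m n x <= M) ->
  0 <= s -> s <= v^-1 -> 0 <= t -> t <= (1 - z)^-1 ->
  (\int[P]_x (expR ((v - z) * gfield W s t x m n))%:E <= (expR ((v - z) * M))%:E)%E.
Proof.
move=> iidW z0 zv v1 HM s0 sv t0 tz.
apply: (@le_trans _ _ (\int[P]_x (expR ((v - z) * gfield W v^-1 (1 - z)^-1 x m n))%:E)%E).
  have mg s' t' : 0 <= s' -> 0 <= t' ->
      measurable_fun setT (fun x => (expR ((v - z) * gfield W s' t' x m n))%:E).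
    move=> s'0 t'0; apply/measurable_EFinP; apply: measurableT_comp => //.
    by apply: measurable_funM => //; exact: (gfield_measurable iidW).
  apply: ge0_le_integral => //.
  - exact: mg.
  - by apply: mg; [exact: le_trans sv|exact: le_trans tz].
  - move=> x _; rewrite lee_fin ler_expR ler_wpM2l//; first lra.
    by apply: glpp_le => // i j; case: iidW => W0 _; exact: W0.
by rewrite (boundary_mgf iidW z0 zv v1) lee_fin; exact: mgf_exponent_bound.
Qed.

(* That is, [N = (sqrt m + sqrt n) ^+ 2], [l] is its cube root, and [rho = sqrt m / (sqrt m + sqrt n)]
   is the parameter minimizing [fmean m n]. *)
Definition charpt m n (N rho l : R) := [/\ m%:R = N * rho ^+ 2, n%:R = N * (1 - rho) ^+ 2,
  N = l ^+ 3, 0 < l & 0 < rho < 1].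

(** By [fmean_char] the excess over $N$ is $k^2l/(a(1-a))\ge4k^2l$ at [a], and at most half of that
    at the midpoint [b]. *)
Lemma exit_gap_lower m n (N rho l k : R) (a := rho + k / l) (b := rho + k / l / 2) :
  charpt m n N rho l -> 0 < k -> a < 1 -> 2 * k ^+ 2 * l <= fmean m n a - fmean m n b.
Proof.
move=> [mE nE NE l0 /andP[r0 r1]] k0 a1.
have N0 : 0 < N by rewrite NE exprn_gt0.
have lN0 : l != 0 by rewrite gt_eqF.
have kl : 0 < k / l by rewrite divr_gt0.
have [a0 b0 b1] : [/\ 0 < a, 0 < b & b < 1].
  by move: a1; rewrite /b /a; move: kl r0; clear; split; lra.
rewrite (fmean_char mE nE N0 r0 r1 a0 a1) (fmean_char mE nE N0 r0 r1 b0 b1).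
have qb : 0 < b * (1 - b) by apply: mulr_gt0; lra.
have qa : 0 < a * (1 - a) by apply: mulr_gt0; lra.
(* Concavity of $x(1-x)$, as [b] is the midpoint of [rho] and [a]. *)
have h1 : a * (1 - a) <= 2 * (b * (1 - b)).
  have : 0 < rho * (1 - rho) by apply: mulr_gt0; lra.
  by rewrite /a /b; move: kl; set q := k / l => kl; nra.
have h2 : a * (1 - a) <= 1 / 4 by have := sqr_ge0 (a - 1 / 2); lra.
have -> : N * (a - rho) ^+ 2 = k ^+ 2 * l by rewrite /a NE; field.
have -> : N * (b - rho) ^+ 2 = k ^+ 2 * l / 4 by rewrite /b NE; field.
have kl2 : 0 < k ^+ 2 * l by rewrite mulr_gt0// exprn_gt0.
have h3 : k ^+ 2 * l / 4 / (b * (1 - b)) <= k ^+ 2 * l / (a * (1 - a)) / 2.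
  rewrite ler_pdivrMr//.
  have -> : k ^+ 2 * l / (a * (1 - a)) / 2 * (b * (1 - b)) =
    k ^+ 2 * l / 4 * ((2 * (b * (1 - b))) / (a * (1 - a))).
    by field; rewrite !gt_eqF//; lra.
  rewrite -[leLHS]mulr1 ler_pM2l; last by lra.
  by rewrite ler_pdivlMr// mul1r.
have h4 : 4 * (k ^+ 2 * l) <= k ^+ 2 * l / (a * (1 - a)).
  by rewrite ler_pdivlMr//; nra.
lra.
Qed.

Lemma exit_gap_upper m n (N rho l eta k : R) (a := rho + k / l) (a' := a + 1 / l) :
  charpt m n N rho l -> 0 < eta -> 0 < k -> eta <= rho -> a' <= 1 - eta ->
  fmean m n a' - fmean m n a <= 2 * (2 * k + 1) * l / eta ^+ 4.
Proof.
move=> [mE nE NE l0 /andP[r0 r1]] eta0 k0 er rk'.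
have N0 : 0 < N by rewrite NE exprn_gt0.
have lN0 : l != 0 by rewrite gt_eqF.
have kl : 0 < k / l by rewrite divr_gt0.
have hl : 0 < 1 / l by rewrite divr_gt0.
have ra : rho < a by rewrite ltrDl.
have aa' : a < a' by rewrite ltrDl.
have a0 : 0 < a by exact: lt_trans ra.
have a'1 : a' < 1 by move: rk' eta0; clear; lra.
have a1 : a < 1 by exact: lt_trans aa' a'1.
rewrite (fmean_sub mE nE N0 r0 r1)//; [|lra].
have D0 : 0 < a' * a * (1 - a') * (1 - a).
  by apply: mulr_gt0; [apply: mulr_gt0; [apply: mulr_gt0|]|]; lra.
have D1 : eta ^+ 4 <= a' * a * (1 - a') * (1 - a).
  have e1 : eta <= a' by lra.
  have e2 : eta <= a by lra.
  have e3 : eta <= 1 - a' by lra.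
  have e4 : eta <= 1 - a by lra.
  rewrite (_ : eta ^+ 4 = eta * eta * eta * eta); last by ring.
  have e0 := ltW eta0.
  exact: (ler_pM (mulr_ge0 (mulr_ge0 e0 e0) e0) e0
    (ler_pM (mulr_ge0 e0 e0) e0 (ler_pM e0 e0 e1 e2) e3) e4).
have num : (1 - rho) ^+ 2 * a' * a - rho ^+ 2 * (1 - a') * (1 - a) <= 2 * (2 * k + 1) / l.
  have -> : 2 * (2 * k + 1) / l = 2 * (k / l + (k / l + 1 / l)) by field.
  move: kl hl rk'; rewrite /a' /a; set p := k / l; set h := 1 / l => p0 h0 ph.
  rewrite (_ : _ - _ = rho * (1 - rho) * (p + (p + h)) + p * (p + h) * (1 - 2 * rho)); last by ring.
  have c1 : rho * (1 - rho) <= 1 by nra.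
  have c2 : rho * (1 - rho) * (p + (p + h)) <= p + (p + h).
    by rewrite -[leRHS]mul1r ler_wpM2r//; lra.
  have c3 : p * (p + h) * (1 - 2 * rho) <= p.
    have c4 : p * (p + h) <= p by rewrite -[leRHS]mulr1 ler_pM2l//; lra.
    have c5 : 0 <= p * (p + h) by rewrite mulr_ge0//; lra.
    have c6 : 1 - 2 * rho <= 1 by lra.
    by apply: le_trans c4; rewrite -[leRHS]mulr1 ler_wpM2l.
  lra.
have -> : a' - a = 1 / l by rewrite /a'; ring.
apply: (@le_trans _ _ (N * (1 / l) * (2 * (2 * k + 1) / l) / (a' * a * (1 - a') * (1 - a)))).
  by rewrite ler_pM2r ?invr_gt0// ler_pM2l// mulr_gt0.
have -> : N * (1 / l) * (2 * (2 * k + 1) / l) = 2 * (2 * k + 1) * l by rewrite NE; field.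
rewrite ler_pM2l; last by rewrite mulr_gt0//; lra.
by rewrite lef_pV2// posrE exprn_gt0.
Qed.

Lemma exit_probability_bound (l k eta : R) : 0 < l -> 1 <= k -> 0 < eta ->
  (l / k + l * (2 * (2 * k + 1) / eta ^+ 4 + 1)) / (k ^+ 2 * l) <= (2 + 6 / eta ^+ 4) / k.
Proof.
move=> l0 k1 eta0; have k0 : 0 < k by exact: lt_le_trans k1.
set K := 2 * (2 * k + 1) / eta ^+ 4.
have e40 : 0 < eta ^+ 4 by rewrite exprn_gt0.
rewrite ler_pdivrMr; last by rewrite mulr_gt0// exprn_gt0.
have -> : (2 + 6 / eta ^+ 4) / k * (k ^+ 2 * l) = l * (k * (2 + 6 / eta ^+ 4)).
  by field; rewrite !gt_eqF.
have -> : l / k + l * (K + 1) = l * (k^-1 + (K + 1)) by field; rewrite gt_eqF.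
rewrite ler_pM2l//.
have kV : k^-1 <= 1 by rewrite invf_le1.
have K1 : K <= k * (6 / eta ^+ 4).
  rewrite /K mulrA ler_pM2r ?invr_gt0//; lra.
lra.
Qed.

(** If the horizontal axis wins, the stationary passage time equals the horizontal one. The latter
    is rarely above $f(b)+k^2l$, by exponential moments with parameters in $[\rho,b]$, whereas the
    former has mean $f(a)\ge f(b)+2k^2l$ and expected deficit of order $kl$. Markov's inequality at
    level $k^2l$ leaves $O(1/k)$. *)
Lemma exit_bound m n W (N rho l eta k : R) : iid_rect P m n W -> charpt m n N rho l ->
  0 < eta -> 1 <= k -> eta <= rho -> rho + (k + 1) / l <= 1 - eta ->
  let a := rho + k / l in
  pbd [set x | gfield W 0 (1 - a)^-1 x m n < gfield W a^-1 0 x m n]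
    (expR (- (k ^+ 3 / 2)) + (2 + 6 / eta ^+ 4) / k).
Proof.
move=> iidW ch eta0 k1 er rk a; have [mE nE NE l0 /andP[r0 r1]] := ch.
have k0 : 0 < k by lra.
have N0 : 0 < N by rewrite NE exprn_gt0.
have kl : 0 < k / l by rewrite divr_gt0.
have hl : 0 < 1 / l by rewrite divr_gt0.
have rk' : rho + k / l + 1 / l <= 1 - eta by move: rk; rewrite mulrDl addrA.
have a0 : 0 < a by rewrite /a; lra.
have a1 : a < 1 by rewrite /a; lra.
have ra : rho < a by rewrite /a; lra.
pose b := rho + k / l / 2.
have rb : rho < b by rewrite /b; lra.
have ba : b < a by rewrite /b /a; lra.
have b0 : 0 < b by lra.
have b1 : b < 1 by lra.
(* The vertical side needs a tilt to the right of [a]; the length $1/l$ keeps the increase of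
   [fmean] of order $kl$. *)
pose a' := a + 1 / l.
have aa' : a < a' by rewrite /a'; lra.
have a'1 : a' < 1 by rewrite /a' /a; lra.
have ai : 0 <= a^-1 by rewrite invr_ge0 ltW.
have a1i : 0 <= (1 - a)^-1 by rewrite invr_ge0; lra.
have W0 x i j : 0 <= W i j x by case: iidW.
pose f (x : R) := fmean m n x.
have lN0 : l != 0 by rewrite gt_eqF.
have gap : 2 * k ^+ 2 * l <= f a - f b := exit_gap_lower ch k0 a1.
have gap' : f a' - f a <= 2 * (2 * k + 1) * l / eta ^+ 4 := exit_gap_upper ch eta0 k0 er rk'.
have mono (x y : R) : rho <= y -> y <= x -> x < 1 -> f y <= f x.
  by move=> ry yx x1; exact: (fmean_mono mE nE N0 r0 r1).
have mS : measurable_fun setT (fun x => gfield W a^-1 0 x m n : mR) by exact: (gfield_measurable iidW).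
have mV : measurable_fun setT (fun x => gfield W 0 (1 - a)^-1 x m n : mR) by exact: (gfield_measurable iidW).
have mG : measurable_fun setT (fun x => gfield W a^-1 (1 - a)^-1 x m n : mR) by exact: (gfield_measurable iidW).
have f0 : 0 <= f a by apply: addr_ge0; apply: divr_ge0; rewrite ?subr_ge0 ?ler0n// ltW.
have IS : (\int[P]_x (Num.max (gfield W a^-1 0 x m n - f a) 0)%:E <= (l / k)%:E)%E.
  have := @pos_part_mgf (fun x => gfield W a^-1 0 x m n) (k / l) (f a) 0 mS kl (lexx _).
  rewrite addr0 add0r (_ : 1 / (k / l) = l / k); last by field; rewrite lN0 gt_eqF.
  apply; rewrite (_ : k / l = a - rho); last by rewrite /a; ring.
  apply: (gfield_mgf_le iidW r0 ra a1) => //.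
    by move=> x /andP[h1 h2]; exact: mono.
  by rewrite invr_ge0; lra.
pose K := 2 * (2 * k + 1) / eta ^+ 4.
have K0 : 0 <= K.
  by apply: divr_ge0; [apply: mulr_ge0 => //; rewrite addr_ge0 ?mulr_ge0// ltW|rewrite exprn_ge0// ltW].
have IV : (\int[P]_x (Num.max (gfield W 0 (1 - a)^-1 x m n - f a) 0)%:E <= (l * (K + 1))%:E)%E.
  have := @pos_part_mgf (fun x => gfield W 0 (1 - a)^-1 x m n) (1 / l) (f a) K mV hl K0.
  rewrite (_ : (K + 1) / (1 / l) = l * (K + 1)); last by field.
  apply; apply: (@le_trans _ _ (expR ((a' - a) * f a'))%:E).
    rewrite (_ : 1 / l = a' - a); last by rewrite /a'; ring.
    apply: (gfield_mgf_le iidW a0 aa' a'1) => //.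
      by move=> x /andP[h1 h2]; apply: mono => //; lra.
    by rewrite invr_ge0; lra.
  rewrite lee_fin ler_expR (_ : a' - a = 1 / l); last by rewrite /a'; ring.
  have -> : K = 1 / l * (2 * (2 * k + 1) * l / eta ^+ 4).
    by rewrite /K; field; rewrite lN0 gt_eqF.
  by rewrite -mulrDr ler_pM2l//; lra.
have low : pbd [set x | k ^+ 2 * l <= Num.max (f a - gfield W a^-1 (1 - a)^-1 x m n) 0]
    ((l / k + l * (K + 1)) / (k ^+ 2 * l)).
  apply: pbd_markov.
  - by rewrite mulr_gt0// exprn_gt0.
  - by apply: measurable_maxr => //; exact: measurable_funB.
  - by move=> x; rewrite le_max lexx orbT.
  apply: (@integral_le_shift _ (fun x => gfield W a^-1 (1 - a)^-1 x m n)
    (fun x => Num.max (gfield W a^-1 0 x m n - f a) 0 + Num.max (gfield W 0 (1 - a)^-1 x m n - f a) 0) (f a)) => //.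
  - by apply: measurable_maxr => //; exact: measurable_funB.
  - by apply: measurable_funD; apply: measurable_maxr => //; exact: measurable_funB.
  - by move=> x; rewrite le_max lexx orbT.
  - by move=> x; exact: glpp_ge0.
  - by move=> x; rewrite addr_ge0// le_max lexx orbT.
  - move=> x; rewrite /gfield (glpp_max (W0 x) _ _ ai a1i) -/(gfield _ _ _ _) -/(gfield _ _ _ _).
    move: (gfield _ _ _ x m n) (gfield _ _ _ x m n) => u v.
    exact: max_shift.
  - by apply: stationary_mean => //; rewrite a0 a1.
  - apply: integralD_le => //.
    + by apply: measurable_maxr => //; exact: measurable_funB.
    + by apply: measurable_maxr => //; exact: measurable_funB.
    + by move=> x; rewrite le_max lexx orbT.
    + by move=> x; rewrite le_max lexx orbT.
(* Since $a^{-1}\le b^{-1}$, the moment bound with upper parameter [b] applies, centred at $f(b)$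
   instead of $f(a)$. *)
have up : pbd [set x | f b + k ^+ 2 * l <= gfield W a^-1 0 x m n] (expR (- (k ^+ 3 / 2))).
  rewrite (_ : k ^+ 3 / 2 = (b - rho) * (k ^+ 2 * l)); last by rewrite /b; field.
  apply: exp_tail => //; first by lra.
  apply: (gfield_mgf_le iidW r0 rb b1) => //.
  - by move=> x /andP[h1 h2]; exact: mono.
  - by rewrite lef_pV2 ?posrE//; lra.
  - by rewrite invr_ge0; lra.
apply: (pbd_sub _ (pbd_le _ (pbdU up low))); last by rewrite lerD2l; exact: exit_probability_bound.
move=> x /= Hx.
have [h|h] := leP (f b + k ^+ 2 * l) (gfield W a^-1 0 x m n); first by left.
right; rewrite /= le_max; apply/orP; left.
rewrite /gfield (glpp_max (W0 x) _ _ ai a1i) -/(gfield _ _ _ _) -/(gfield _ _ _ _).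
rewrite (max_idPl _); [lra|exact: ltW].
Qed.

End estimates.

(** * Rotation of the bulk by a half turn *)

Section northeast.
Context {R : realType}.

(** A path that follows the horizontal axis of [V] up to abscissa $k+1$ enters the bulk at the site
    called $(m-k,n)$ in [U], and the rest of it, reversed, is a path of [U]. The induction bounds
    the best path through each site: passage time of [V] up to the site plus passage time of [U]
    from the opposite corner, the site being counted once. *)
Lemma glpp_northeast (U V : nat -> nat -> R) m n (s B : R) :
  (forall i j, 0 <= U i j) -> (forall i j, 0 <= V i j) -> 0 <= s ->
  (forall i j, (i < m)%N -> (j < n)%N -> V i.+1 j.+1 = U (m - i)%N (n - j)%N) ->
  (forall k, (k < m)%N ->
     \sum_(i <- iota 0 k.+1) s * V i.+1 0%N + glpp 0 0 U (m - k) n <= B) ->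
  (0 < m)%N -> (0 < n)%N -> glpp s 0 V m n <= B.
Proof.
move=> U0 V0 s0 VU HB m0 n0.
pose G := glpp s 0 V; pose L := glpp 0 0 U.
have LS i j : L i.+1 j.+1 = U i.+1 j.+1 + Num.max (L i j.+1) (L i.+1 j) by [].
have Lh i j : U i.+1 j.+1 + L i j.+1 <= L i.+1 j.+1 by rewrite LS lerD2l le_max lexx.
have Lv i j : U i.+1 j.+1 + L i.+1 j <= L i.+1 j.+1 by rewrite LS lerD2l le_max lexx orbT.
have b0 i j : 0 <= bdry 0 0 U i j by exact: bdry_ge0.
have Lmono i j : L i j <= L i j.+1.
  by have [_] := inc_ge0 b0 i j; rewrite /vinc subr_ge0.
have G0 j : G 0%N j = 0.
  elim: j => [|j IH]; first exact: lpp00.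
  have -> : G 0%N j.+1 = G 0%N j + 0 * V 0%N j.+1 by exact: lpp0S.
  by rewrite IH mul0r addr0.
have Gi i : G i 0%N = \sum_(i' <- iota 0 i) s * V i'.+1 0%N.
  elim: i => [|i IH]; first by rewrite big_nil; exact: lpp00.
  have -> : G i.+1 0%N = G i 0%N + s * V i.+1 0%N by [].
  by rewrite IH -[in RHS](addn1 i) iotaD big_cat big_seq1 add0n.
have Q i j : (i < m)%N -> (j < n)%N ->
    G i.+1 j.+1 - V i.+1 j.+1 + L (m - i)%N (n - j)%N <= B.
  move: i j; suff H : forall j i, (i < m)%N -> (j < n)%N ->
    G i.+1 j.+1 - V i.+1 j.+1 + L (m - i)%N (n - j)%N <= B by move=> i j; exact: H.
  have GS i j : G i.+1 j.+1 = V i.+1 j.+1 + Num.max (G i j.+1) (G i.+1 j) by [].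
  have hstep i j : (i < m)%N -> (j < n)%N -> G i.+1 j + L (m - i)%N (n - j)%N <= B ->
     G i j.+1 + L (m - i)%N (n - j)%N <= B ->
     G i.+1 j.+1 - V i.+1 j.+1 + L (m - i)%N (n - j)%N <= B.
    move=> im jn h1 h2; rewrite GS [V _ _ + _]addrC addrK.
    by case: (leP (G i j.+1) (G i.+1 j)) => _.
  have down i j : (i < m)%N -> (j.+1 < n)%N ->
      G i.+1 j.+1 - V i.+1 j.+1 + L (m - i)%N (n - j)%N <= B ->
      G i.+1 j.+1 + L (m - i)%N (n - j.+1)%N <= B.
    move=> im jn; rewrite (VU _ _ im (ltnW jn)).
    have -> : (n - j)%N = (n - j.+1).+1 by lia.
    have -> : (m - i)%N = (m - i.+1).+1 by lia.
    have := Lv (m - i.+1)%N (n - j.+1)%N; lra.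
  have left i j : (i.+1 < m)%N -> (j < n)%N ->
      G i.+1 j.+1 - V i.+1 j.+1 + L (m - i)%N (n - j)%N <= B ->
      G i.+1 j.+1 + L (m - i.+1)%N (n - j)%N <= B.
    move=> im jn; rewrite (VU _ _ (ltnW im) jn).
    have -> : (n - j)%N = (n - j.+1).+1 by lia.
    have -> : (m - i)%N = (m - i.+1).+1 by lia.
    have := Lh (m - i.+1)%N (n - j.+1)%N; lra.
  (* Paths up the weightless vertical axis are dominated by the case $k=0$. *)
  have base j : (j < n)%N -> G 0%N j.+1 + L (m - 0)%N (n - j)%N <= B.
    move=> jn; rewrite G0 add0r subn0; apply: (@le_trans _ _ (L m n)).
      have -> : L m n = L m ((n - j) + j)%N by rewrite subnK// ltnW.
      elim: (j) (n - j)%N => [|k IH] r; first by rewrite addn0.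
      by rewrite addnS (le_trans (IH r)).
    by have := HB 0%N m0; rewrite subn0 -/(L m n) big_seq1; have := V0 1%N 0%N; nra.
  elim=> [|j IHj].
    elim=> [|i IHi] im jn.
      apply: hstep => //; last exact: base.
      by rewrite Gi !subn0; have := HB 0%N m0; rewrite subn0.
    apply: hstep => //; first by rewrite Gi subn0; exact: HB.
    by apply: left => //; exact: IHi (ltnW im) jn.
  elim=> [|i IHi] im jn.
    apply: hstep => //; last exact: base.
    by apply: down => //; exact: IHj im (ltnW jn).
  apply: hstep => //.
    by apply: down => //; exact: IHj im (ltnW jn).
  by apply: left => //; exact: IHi (ltnW im) jn.
have := Q m.-1 n.-1; rewrite !prednK//.
move=> /(_ (leqnn _) (leqnn _)); rewrite -[X in V X _](prednK m0) -[X in V _ X](prednK n0).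
rewrite VU ?prednK//.
have -> : (m - m.-1)%N = 1%N by lia.
have -> : (n - n.-1)%N = 1%N by lia.
have L11 : L 1%N 1%N = U 1%N 1%N.
  have L10 : L 1%N 0%N = 0 by rewrite /L /glpp lppS0 lpp00 /bdry/= mul0r addr0.
  have L01 : L 0%N 1%N = 0 by rewrite /L /glpp lpp0S lpp00 /bdry/= mul0r addr0.
  by rewrite LS L10 L01 maxxx addr0.
by rewrite L11 -/G; lra.
Qed.

End northeast.

(* Turns convexity of the passage time in the boundary weights into a lower-tail estimate. *)
Lemma convex_deficit (R : realType) (u v g q N : R) :
  g <= Num.max u v -> 2 * q <= g + Num.max u v ->
  Num.max (N - g) 0 + 2 * q <= 2 * N + 2 * (Num.max (u - N) 0 + Num.max (v - N) 0).
Proof.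
case: (leP u v) => uv; case: (leP (N - g) 0) => h1;
  case: (leP (u - N) 0) => h2; case: (leP (v - N) 0) => h3; lra.
Qed.

(** * Fluctuations of the passage time at one point *)

Section one_point.
Context d (T : measurableType d) (R : realType) (P : probability T R).
Notation mR := (measurableTypeR R).
Notation pbd := (@pbd d T R P).
Notation indep := (@indep d T R P).
Notation rv := (@rv d T R).

(** Centering at $(r-\theta)^{-1}$ instead of the mean makes the exponentials a supermartingale:
    $r/(r-\theta)=1+\theta/(r-\theta)\le e^{\theta/(r-\theta)}$. Negative [th] gives lower
    deviations. *)
Lemma ville_exp I (l : seq I) (X : I -> T -> mR) (r th y : R) : 0 < r -> th < r ->
  indep (fun=> 1) 1 [seq rv (X i) r | i <- l] ->
  pbd [set t | exists k, y <= th * \sum_(i <- take k l) (X i t - (r - th)^-1)] (expR (- y)).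
Proof.
move=> r0 thr; apply: ville.
under eq_integral do rewrite mulrBr expRD EFinM.
have me : measurable_fun setT (fun x : mR => (expR (th * x))%:E).
  by apply/measurable_EFinP; exact: measurable_expRM.
have e0 (x : mR) : setT x -> (0 <= (expR (th * x))%:E)%E by move=> _; rewrite lee_fin expR_ge0.
have k0 : (0 <= (expR (- (th * (r - th)^-1)))%:E)%E by rewrite lee_fin expR_ge0.
rewrite (ge0_integralZr _ measurableT me e0 k0) expd_mgf// -EFinM lee_fin expRN ler_pdivrMr ?expR_gt0// mul1r.
apply: (le_trans _ (expR_ge1Dx _)).
by rewrite le_eqVlt; apply/orP; left; apply/eqP; field; lra.
Qed.

Lemma indep_rev I (l : seq I) (f : I -> item T R) D c :
  indep D c [seq f i | i <- l] -> indep D c [seq f i | i <- rev l].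
Proof.
elim: l D c => [|i l IH] D c //=; rewrite rev_cons -cats1 map_cat /= => H.
apply: indep_catC => /=.
by apply: (@indep_cat_sub _ _ _ _ [:: f i] _ _ _ _ _ H) => D' c'; exact: IH.
Qed.

Lemma charpt_tr m n (N rho l : R) : charpt m n N rho l -> charpt n m N (1 - rho) l.
Proof.
move=> [mE nE NE l0 /andP[r0 r1]]; split=> //.
- by rewrite mE; congr (_ * _); ring.
- by apply/andP; split; lra.
Qed.

Lemma onepoint_upper m n W (N rho l eta y : R) : iid_rect P m n W -> charpt m n N rho l ->
  0 < eta -> eta <= rho - 1 / l -> rho + 1 / l <= 1 - eta ->
  pbd [set x | N + l / eta ^+ 2 + y * l <= gfield W 0 0 x m n] (expR (- (2 * y))).
Proof.
move=> iidW [mE nE NE l0 /andP[r0 r1]] eta0 er re.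
have N0 : 0 < N by rewrite NE exprn_gt0.
have hl : 0 < 1 / l by rewrite divr_gt0.
have lN0 : l != 0 by rewrite gt_eqF.
rewrite (_ : 2 * y = (rho + 1 / l - (rho - 1 / l)) * (y * l)); last by field.
apply: exp_tail; first exact: (gfield_measurable iidW).
  by lra.
apply: (gfield_mgf_le iidW); try lra.
- move=> x /andP[h1 h2].
  have := @fmean_near _ m n N rho mE nE N0 r0 r1 x (1 / l) eta eta0.
  rewrite (_ : N * (1 / l) ^+ 2 / eta ^+ 2 = l / eta ^+ 2); last first.
    by rewrite NE; field; rewrite lN0 gt_eqF.
  by apply; try lra; apply/andP; split; lra.
- by rewrite invr_ge0; lra.
- by rewrite invr_ge0; lra.
Qed.

(** The stationary weights are the midpoint between the reduced ones and their mirror image. By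
    convexity, a deficit of the reduced model must be compensated by the stationary one, whose mean
    is exactly $N$, or by an excess of the enlarged one, which exponential moments control. *)
Lemma boundary_lower m n W (N rho l eta k A : R) : iid_rect P m n W -> charpt m n N rho l ->
  0 < eta -> 0 < k -> 0 < A -> eta <= rho - 3 * (k / l) -> rho + 3 * (k / l) <= 1 - eta ->
  pbd [set x | gfield W (rho + 2 * (k / l))^-1 (1 - rho + 2 * (k / l))^-1 x m n <= N - A * l]
    (4 * (9 * k ^+ 3 / eta ^+ 2 + 1) / k / A).
Proof.
move=> iidW [mE nE NE l0 /andP[r0 r1]] eta0 k0 A0 er re.
have N0 : 0 < N by rewrite NE exprn_gt0.
have d0 : 0 < k / l by rewrite divr_gt0.
have lN0 : l != 0 by rewrite gt_eqF.
have W0 x i j : 0 <= W i j x by case: iidW.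
set dl := k / l in d0 er re *.
pose sm := (rho + 2 * dl)^-1; pose tm := (1 - rho + 2 * dl)^-1.
pose sp := 2 * rho^-1 - sm; pose tp := 2 * (1 - rho)^-1 - tm.
have r1' : 0 < 1 - rho by lra.
have sm0 : 0 <= sm by rewrite invr_ge0; lra.
have tm0 : 0 <= tm by rewrite invr_ge0; lra.
have smr : sm <= rho^-1 by rewrite lef_pV2 ?posrE; lra.
have tmr : tm <= (1 - rho)^-1 by rewrite lef_pV2 ?posrE; lra.
have rv0 : 0 < rho^-1 by rewrite invr_gt0.
have rv1 : 0 < (1 - rho)^-1 by rewrite invr_gt0.
have sp0 : 0 <= sp by rewrite /sp; lra.
have tp0 : 0 <= tp by rewrite /tp; lra.
(* Convexity of $1/x$: the mirrored weights are at most those of rates [rho - 2 * dl] and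
   [1 - rho - 2 * dl], and the tilt takes place between distances [2 * dl] and [3 * dl] from
   [rho]. *)
have aux (q : R) : 0 < q -> 0 < q - 2 * dl -> 2 * q^-1 - (q + 2 * dl)^-1 <= (q - 2 * dl)^-1.
  move=> q0 qd; rewrite -subr_ge0.
  rewrite (_ : _ - _ = 8 * dl ^+ 2 / (q * (q + 2 * dl) * (q - 2 * dl))); last first.
    by field; rewrite !gt_eqF//; lra.
  apply: divr_ge0; first by rewrite mulr_ge0 ?sqr_ge0.
  by apply: mulr_ge0; [apply: mulr_ge0|]; lra.
have spz : sp <= (rho - 2 * dl)^-1 by apply: aux; lra.
have tpz : tp <= (1 - (rho + 2 * dl))^-1.
  by rewrite (_ : 1 - (rho + 2 * dl) = 1 - rho - 2 * dl); [apply: aux; lra|ring].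
have mg s t : 0 <= s -> 0 <= t -> measurable_fun setT (fun x => gfield W s t x m n : mR).
  by move=> s0 t0; exact: (gfield_measurable iidW).
pose K := 9 * k ^+ 3 / eta ^+ 2.
have K0 : 0 <= K by rewrite /K divr_ge0 ?mulr_ge0 ?exprn_ge0// ltW.
have near x : rho - 3 * dl <= x <= rho + 3 * dl -> fmean m n x <= N + K / dl.
  move=> /andP[h1 h2].
  have := @fmean_near _ m n N rho mE nE N0 r0 r1 x (3 * dl) eta eta0.
  rewrite (_ : N * (3 * dl) ^+ 2 / eta ^+ 2 = K / dl); last first.
    by rewrite NE /K /dl; field; rewrite !lN0 !gt_eqF.
  by apply; try lra; apply/andP; split; lra.
have pp s t lam : lam = dl -> 0 <= s -> 0 <= t ->
    (\int[P]_x (expR (lam * gfield W s t x m n))%:E <= (expR (lam * (N + K / dl)))%:E)%E ->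
    (\int[P]_x (Num.max (gfield W s t x m n - N) 0)%:E <= ((K + 1) / dl)%:E)%E.
  move=> -> s0 t0 H; apply: pos_part_mgf => //; first exact: mg.
  by move: H; rewrite mulrDr mulrCA divff ?mulr1// gt_eqF.
have IS : (\int[P]_x (Num.max (gfield W sp 0 x m n - N) 0)%:E <= ((K + 1) / dl)%:E)%E.
  apply: (pp _ _ (rho - 2 * dl - (rho - 3 * dl))) => //; first by ring.
  apply: (gfield_mgf_le iidW) => //; try by move: d0 er re eta0; clear; lra.
    by move=> x /andP[h1 h2]; apply: near; apply/andP; move: h1 h2 d0; clear; split; lra.
  by rewrite invr_ge0; lra.
have IV : (\int[P]_x (Num.max (gfield W 0 tp x m n - N) 0)%:E <= ((K + 1) / dl)%:E)%E.
  apply: (pp _ _ (rho + 3 * dl - (rho + 2 * dl))) => //; first by ring.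
  apply: (gfield_mgf_le iidW) => //; try by move: d0 er re eta0; clear; lra.
    by move=> x /andP[h1 h2]; apply: near; apply/andP; move: h1 h2 d0; clear; split; lra.
  by rewrite invr_ge0; lra.
have mm s t : 0 <= s -> 0 <= t ->
    measurable_fun setT (fun x => Num.max (gfield W s t x m n - N) 0 : mR).
  by move=> s0 t0; apply: measurable_maxr => //; apply: measurable_funB => //; exact: mg.
have m0 (u : R) : 0 <= Num.max u 0 by rewrite le_max lexx orbT.
pose H x : mR := 2 * (Num.max (gfield W sp 0 x m n - N) 0 + Num.max (gfield W 0 tp x m n - N) 0).
have mH : measurable_fun setT H by apply: measurable_funM => //; apply: measurable_funD; exact: mm.
have H0 x : 0 <= H x by rewrite mulr_ge0// addr_ge0.
have IH : (\int[P]_x (H x)%:E <= (2 * ((K + 1) / dl + (K + 1) / dl))%:E)%E.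
  apply: integralZ_le => //.
  - by apply: measurable_funD; exact: mm.
  - by move=> x; rewrite addr_ge0.
  - by apply: integralD_le => //; exact: mm.
have low : (\int[P]_x (Num.max (N - gfield W sm tm x m n) 0)%:E <= (2 * ((K + 1) / dl + (K + 1) / dl))%:E)%E.
  apply: (@integral_le_shift _ _ _ _ _ (fun x => 2 * gfield W rho^-1 (1 - rho)^-1 x m n) H (2 * N)) => //.
  - by apply: measurable_maxr => //; apply: measurable_funB => //; exact: mg.
  - by apply: measurable_funM => //; apply: mg; exact: ltW.
  - by move=> x; rewrite mulr_ge0// glpp_ge0// ltW.
  - by rewrite mulr_ge0// ltW.
  - move=> x.
    have := glpp_convex (fun i j => W i j x) sm tm sp tp m n.
    rewrite (_ : (sm + sp) / 2 = rho^-1); last by rewrite /sp; field; rewrite gt_eqF.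
    rewrite (_ : (tm + tp) / 2 = (1 - rho)^-1); last by rewrite /tp; field; rewrite gt_eqF.
    rewrite -!/(gfield W _ _ x m n).
    have : gfield W sm tm x m n <= gfield W sp tp x m n.
      by apply: glpp_le => //; rewrite ?/sp ?/tp; lra.
    rewrite {1}[gfield W sp tp x m n]glpp_max// [gfield W sp tp x m n]glpp_max//.
    rewrite -/(gfield W sp 0 x m n) -/(gfield W 0 tp x m n) /H.
    move: (gfield W sp 0 x m n) (gfield W 0 tp x m n) (gfield W sm tm x m n)
      (gfield W rho^-1 (1 - rho)^-1 x m n) => u v g q.
    exact: convex_deficit.
  - under eq_integral do rewrite EFinM.
    have r01 : 0 < rho < 1 by rewrite r0 r1.
    have E := stationary_mean iidW r01; rewrite (fmean_rho mE nE N0 r0 r1) in E.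
    rewrite ge0_integralZl_EFin//; last 2 first.
    + by move=> x _; rewrite lee_fin glpp_ge0// ltW.
    + by apply/measurable_EFinP; apply: mg; exact: ltW.
    by rewrite E.
have Al : 0 < A * l by rewrite mulr_gt0.
have mlow : measurable_fun setT (fun x => Num.max (N - gfield W sm tm x m n) 0 : mR).
  by apply: measurable_maxr => //; apply: measurable_funB => //; exact: mg.
have := pbd_markov Al mlow (fun=> m0 _) low.
rewrite (_ : 2 * ((K + 1) / dl + (K + 1) / dl) / (A * l) = 4 * (K + 1) / k / A); last first.
  by rewrite /dl; field; rewrite !lN0 !gt_eqF.
apply: pbd_sub => x /=; rewrite le_max => h; apply/orP; left; lra.
Qed.

End one_point.

Section one_point_lower.
Context d (T : measurableType d) (R : realType) (P : probability T R).
Notation mR := (measurableTypeR R).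
Notation pbd := (@pbd d T R P).
Notation indep := (@indep d T R P).
Notation rv := (@rv d T R).

Lemma sum_hinc (g : nat -> nat -> R) p k n :
  \sum_(i <- iota p k) hinc g i n = g (p + k)%N n - g p n.
Proof.
elim: k => [|k IH]; first by rewrite big_nil addn0 subrr.
by rewrite -[in LHS](addn1 k) iotaD big_cat big_seq1 /= IH /hinc addnS; ring.
Qed.

Lemma sum_shift I (l : seq I) (X : I -> R) (b : R) :
  \sum_(i <- l) (X i - b) = \sum_(i <- l) X i - (size l)%:R * b.
Proof.
elim: l => [|i l IH]; first by rewrite !big_nil mul0r subrr.
by rewrite !big_cons IH /= -natr1; ring.
Qed.

(** Walking [i] steps on the axis of [V] gains about $i/(\rho+2k/l)$ and gives up the last [i]
    increments of the top row of [U]. Unless the horizontal axis wins in the stationary model of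
    parameter $a=\rho+k/l$, these are at least the stationary increments, of mean $1/a$. Both walks
    are compared with a line of intermediate slope [b], which each of them violates by more than
    $yl$ only with small probability. *)
Lemma row_lower m n U V (N rho l eta k y : R) :
  iid_rect P m n U -> iid_rect P m n V -> charpt m n N rho l ->
  (forall i j x, (i < m)%N -> (j < n)%N -> V i.+1 j.+1 x = U (m - i)%N (n - j)%N x) ->
  (0 < m)%N -> (0 < n)%N ->
  0 < eta -> 1 <= k -> eta <= rho -> rho + (k + 1) / l <= 1 - eta ->
  pbd [set x | gfield U 0 0 x m n + 2 * y * l + eta^-1 < gfield V (rho + 2 * (k / l))^-1 0 x m n]
    (expR (- (k ^+ 3 / 2)) + (2 + 6 / eta ^+ 4) / k + 2 * expR (- (k * y / 2))).
Proof.
move=> iidU iidV chm VU m0 n0 eta0 k1 er rk.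
have E1 := exit_bound iidU chm eta0 k1 er rk.
have [mE nE NE l0 /andP[r0 r1]] := chm.
have k0 : 0 < k by lra.
have lN0 : l != 0 by rewrite gt_eqF.
set a := rho + k / l in E1; simpl in E1.
have d0 : 0 < k / l by rewrite divr_gt0.
have hl : 0 < 1 / l by rewrite divr_gt0.
have rk' : rho + k / l + 1 / l <= 1 - eta by move: rk; rewrite mulrDl addrA.
have a0 : 0 < a by rewrite /a; lra.
have a1 : a < 1 by rewrite /a; lra.
pose s := (rho + 2 * (k / l))^-1.
have w0 : 0 < rho + 2 * (k / l) by lra.
have s0 : 0 < s by rewrite invr_gt0.
(* The rate $\rho+\frac32k/l$ is half-way between those of the two walks, so the two tilts are $\pm
   k/(2l)$. *)
pose b := (rho + k / l + k / l / 2)^-1.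
have b0 : 0 < b by rewrite invr_gt0; lra.
have beta : b <= eta^-1 by rewrite lef_pV2 ?posrE; lra.
have yE : k / l / 2 * (y * l) = k * y / 2 by field.
have E2 : pbd [set x | exists i, k * y / 2 <= k / l / 2 *
    \sum_(j <- take i (iota 0 m)) (s * V j.+1 0%N x - b)] (expR (- (k * y / 2))).
  rewrite /b (_ : rho + k / l + k / l / 2 = s^-1 - k / l / 2); last by rewrite /s invrK; lra.
  apply: ville_exp; first by rewrite invr_gt0.
    by rewrite /s invrK; lra.
  have [_ VI] := iidV.
  have := VI [seq (i.+1, 0%N) | i <- iota 0 m]; rewrite -map_comp.
  have u : uniq [seq (i.+1, 0%N) | i <- iota 0 m].
    by rewrite map_inj_uniq ?iota_uniq// => x x' [].
  have al : all (fun p => (p.1 <= m)%N && (p.2 <= n)%N) [seq (i.+1, 0%N) | i <- iota 0 m].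
    by rewrite all_map; apply/allP => i; rewrite mem_iota/= andbT.
  move=> /(_ u al); rewrite -[X in indep _ _ X -> _]cats0.
  move=> /(@indep_map_scale _ _ _ P _ _ (fun i => V i.+1 0%N) s _ _ _ s0).
  by rewrite cats0.
(* The list is reversed because the increments given up are counted from the right end of the
   row. *)
have E3 : pbd [set x | exists i, k * y / 2 <= - (k / l / 2) *
    \sum_(j <- take i (rev (iota 0 m))) (hinc (gfield U a^-1 (1 - a)^-1 x) j n - b)] (expR (- (k * y / 2))).
  rewrite /b (_ : rho + k / l + k / l / 2 = a - - (k / l / 2)); last by rewrite /a; ring.
  apply: ville_exp => //; first by lra.
  apply: indep_rev.
  have a01 : 0 < a < 1 by rewrite a0 a1.
  by have /indep_catC /indep_drop := stationary_rows iidU a01.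
apply: (pbd_sub _ (pbd_le _ (pbdU E1 (pbdU E2 E3)))); last by lra.
move=> x /= Hx.
have [h1|h1] := ltP (gfield U 0 (1 - a)^-1 x m n) (gfield U a^-1 0 x m n); first by left.
right; apply: contrapT => /not_orP[h2 h3].
have U0 i j : 0 <= U i j x by case: iidU.
have V0 i j : 0 <= V i j x by case: iidV.
(* The extra [b] pays for $i+1$ axis steps against only [i] increments. *)
suff : gfield V s 0 x m n <= gfield U 0 0 x m n + 2 * y * l + b by move: Hx; rewrite -/s; lra.
apply: (glpp_northeast U0 V0 (ltW s0)) => //; first by move=> i j im jn; exact: VU.
move=> i im.
have {h2} : k / l / 2 * \sum_(j <- take i.+1 (iota 0 m)) (s * V j.+1 0%N x - b) < k * y / 2.
  by rewrite ltNge; apply/negP => h; apply: h2; exists i.+1.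
have {h3} : - (k / l / 2) * \sum_(j <- take i (rev (iota 0 m)))
    (hinc (gfield U a^-1 (1 - a)^-1 x) j n - b) < k * y / 2.
  by rewrite ltNge; apply/negP => h; apply: h3; exists i.
rewrite take_rev size_iota drop_iota add0n subKn; last exact: ltnW.
rewrite take_iota (minn_idPl _)//.
rewrite -yE mulNr -mulrN !ltr_pM2l; [|lra|lra].
rewrite !sum_shift size_rev !size_iota (perm_big (iota (m - i) i)) /=; last by rewrite perm_rev.
have cmp : \sum_(j <- iota (m - i) i) hinc (gfield U a^-1 (1 - a)^-1 x) j n <=
    gfield U 0 0 x m n - gfield U 0 0 x (m - i) n.
  rewrite -[X in gfield U 0 0 x X n](subnK (ltnW im)) -sum_hinc.
  rewrite big_seq [leRHS]big_seq; apply: ler_sum => j; rewrite mem_iota subnK ?(ltnW im)// => /andP[_ jm].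
  apply: (row_comparison U0 _ _ h1) => //; by rewrite invr_ge0; lra.
rewrite -/(gfield U _ _ x) -(natr1 i).
by move: cmp; set S := \sum_(j <- iota (m - i) i) _; set S' := \sum_(j <- _) _; lra.
Qed.

(** The model with reduced boundary is rarely low, by [boundary_lower], and it is the larger of its
    two one-sided versions, neither of which is much above the bulk; the vertical one is handled by
    transposition. *)
Lemma onepoint_lower m n U V (N rho l eta k y A : R) :
  iid_rect P m n U -> iid_rect P m n V -> charpt m n N rho l ->
  (forall i j x, (i < m)%N -> (j < n)%N -> V i.+1 j.+1 x = U (m - i)%N (n - j)%N x) ->
  (0 < m)%N -> (0 < n)%N -> 0 < eta -> 1 <= k -> 0 < A ->
  eta <= rho - 3 * (k / l) -> rho + 3 * (k / l) <= 1 - eta ->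
  pbd [set x | gfield U 0 0 x m n < N - A * l - 2 * y * l - eta^-1]
    (2 * (expR (- (k ^+ 3 / 2)) + (2 + 6 / eta ^+ 4) / k + 2 * expR (- (k * y / 2))) +
     4 * (9 * k ^+ 3 / eta ^+ 2 + 1) / k / A).
Proof.
move=> iidU iidV chm VU m0 n0 eta0 k1 A0 er re.
have [mE nE NE l0 /andP[r0 r1]] := chm.
have k0 : 0 < k by lra.
have d0 : 0 < k / l by rewrite divr_gt0.
have kl : (k + 1) / l <= 3 * (k / l) by rewrite mulrA ler_pM2r ?invr_gt0//; lra.
have B1 := @row_lower m n U V N rho l eta k y iidU iidV chm VU m0 n0 eta0 k1.
have {}B1 := B1 ltac:(lra) ltac:(lra).
have VUt i j x : (i < n)%N -> (j < m)%N -> V j.+1 i.+1 x = U (m - j)%N (n - i)%N x.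
  by move=> hi hj; exact: VU.
have B2 := @row_lower n m (fun i j => U j i) (fun i j => V j i) N (1 - rho) l eta k y
  (iid_rect_tr iidU) (iid_rect_tr iidV) (charpt_tr chm) VUt n0 m0 eta0 k1.
have {}B2 := B2 ltac:(lra) ltac:(lra).
have B3 := boundary_lower iidV chm eta0 k0 A0 er re.
apply: (pbd_sub _ (pbd_le _ (pbdU (pbdU B1 B2) B3))); last by lra.
move=> x /= Hx; apply: contrapT => /not_orP[/not_orP[h1 h2] h3].
have {}h1 : gfield V (rho + 2 * (k / l))^-1 0 x m n <= gfield U 0 0 x m n + 2 * y * l + eta^-1.
  by rewrite leNgt; apply/negP.
have {}h2 : gfield V 0 (1 - rho + 2 * (k / l))^-1 x m n <= gfield U 0 0 x m n + 2 * y * l + eta^-1.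
  rewrite /gfield leNgt; apply/negP => h; apply: h2.
  rewrite -(glpp_tr _ 0 (fun i j => V i j x)) -(glpp_tr 0 0 (fun i j => U i j x)) in h.
  exact: h.
have {}h3 : N - A * l < gfield V (rho + 2 * (k / l))^-1 (1 - rho + 2 * (k / l))^-1 x m n.
  by rewrite ltNge; apply/negP.
have V0 i j : 0 <= V i j x by case: iidV.
move: h3; rewrite /gfield (glpp_max V0); last 2 first.
- by rewrite invr_ge0; lra.
- by rewrite invr_ge0; lra.
rewrite lt_max => /orP[]; move: h1 h2 Hx; rewrite /gfield; lra.
Qed.

End one_point_lower.

(** * Maximal paths and the recursion *)

Section lpp_paths.
Context {R : realType}.
Variable om : nat -> nat -> R.
Let sw := site_weight om.

(** A bare list of steps, without its length in the type, can be extended by one step at the end,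
    which matches the recursion of [lpp]. *)
Definition seq_weight (s : seq bool) : R :=
  \sum_(1 <= k < (size s).+1) sw (count id (take k s)) (k - count id (take k s)).

Lemma seq_weight_rcons s b : seq_weight (rcons s b) =
  seq_weight s + sw (count id s + b) ((size s).+1 - (count id s + b)).
Proof.
rewrite /seq_weight size_rcons big_nat_recr//=; congr (_ + _).
  rewrite !big_nat; apply: eq_bigr => k /andP[k1 ks].
  by rewrite -cats1 takel_cat.
by rewrite -(size_rcons s b) take_size -cats1 count_cat /= addn0.
Qed.

Lemma seq_weight_le s m n : size s = (m + n)%N -> count id s = m -> seq_weight s <= lpp sw m n.
Proof.
elim/last_ind: s m n => [|s b IH] m n.
  move=> /= sz cnt; move: sz; rewrite -cnt => /esym /eqP; rewrite addn_eq0 => /andP[_ /eqP ->].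
  by rewrite lpp00 /seq_weight big_geq.
rewrite size_rcons -cats1 count_cat /= addn0 cats1 seq_weight_rcons => sz cnt.
rewrite cnt sz (_ : (m + n - m)%N = n); last lia.
case: b cnt => /= cnt.
  case: m cnt sz => [|m] cnt sz; first lia.
  have H : seq_weight s <= lpp sw m n by apply: IH; lia.
  case: n sz H => [|n] sz H; first by rewrite lppS0 lerD2r.
  by rewrite lppSS addrC lerD2l le_max H.
case: n sz => [|n] sz.
  by have := count_size id s; lia.
have H : seq_weight s <= lpp sw m n by apply: IH; lia.
case: m cnt sz H => [|m] cnt sz H; first by rewrite lpp0S lerD2r.
by rewrite lppSS addrC lerD2l le_max H orbT.
Qed.

Lemma seq_weight_max m n : exists s, [/\ size s = (m + n)%N, count id s = m &
  seq_weight s = lpp sw m n].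
Proof.
have stepT i j s : size s = (i + j)%N -> count id s = i -> seq_weight s = lpp sw i j ->
  [/\ size (rcons s true) = (i.+1 + j)%N, count id (rcons s true) = i.+1 &
    seq_weight (rcons s true) = lpp sw i j + sw i.+1 j].
  move=> sz cnt E; rewrite size_rcons -cats1 count_cat cats1 seq_weight_rcons E cnt sz.
  by split; [lia|rewrite /=; lia|rewrite addn1 (_ : ((i + j).+1 - i.+1)%N = j)//; lia].
have stepF i j s : size s = (i + j)%N -> count id s = i -> seq_weight s = lpp sw i j ->
  [/\ size (rcons s false) = (i + j.+1)%N, count id (rcons s false) = i &
    seq_weight (rcons s false) = lpp sw i j + sw i j.+1].
  move=> sz cnt E; rewrite size_rcons -cats1 count_cat cats1 seq_weight_rcons E cnt sz.
  by split; [lia|rewrite /=; lia|rewrite addn0 (_ : ((i + j).+1 - i)%N = j.+1)//; lia].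
move: m n; apply: lpp_ind2.
- by exists [::]; split=> //; rewrite lpp00 /seq_weight big_geq.
- move=> i [s [sz cnt E]]; exists (rcons s true).
  by have [h1 h2 h3] := stepT _ _ _ sz cnt E; split=> //; rewrite h3 lppS0.
- move=> j [s [sz cnt E]]; exists (rcons s false).
  by have [h1 h2 h3] := stepF _ _ _ sz cnt E; split=> //; rewrite h3 lpp0S.
- move=> i j [s [sz cnt E]] [s' [sz' cnt' E']] _.
  rewrite lppSS; case: (leP (lpp sw i j.+1) (lpp sw i.+1 j)) => h.
    exists (rcons s' false).
    by have [h1 h2 h3] := stepF _ _ _ sz' cnt' E'; split=> //; rewrite h3 addrC.
  exists (rcons s true).
  by have [h1 h2 h3] := stepT _ _ _ sz cnt E; split=> //; rewrite h3 addrC.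
Qed.

Lemma path_weightE m n (t : (m + n).-tuple bool) : path_weight om t = seq_weight t.
Proof. by rewrite /path_weight /seq_weight size_tuple. Qed.

Lemma LPP_lpp m n : LPP om m n = lpp sw m n.
Proof.
apply/eqP; rewrite eq_le; apply/andP; split.
  rewrite /LPP; apply/bigmax_leP; split.
    rewrite path_weightE; apply: seq_weight_le; first by rewrite size_tuple.
    by rewrite /= count_cat !count_nseq /= mul1n mul0n addn0.
  by move=> t /eqP ct; rewrite path_weightE; apply: seq_weight_le => //; rewrite size_tuple.
have [s [sz cnt <-]] := seq_weight_max m n.
have sz' : size s == (m + n)%N by apply/eqP.
rewrite -[s]/(tval (Tuple sz')) -path_weightE /LPP.
by apply: le_bigmax_cond; apply/eqP.
Qed.

Lemma LPP_glpp (W : nat -> nat -> R) m n :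
  (forall i j, (i < m)%N -> (j < n)%N -> W i.+1 j.+1 = om i j) ->
  LPP om m n = glpp 0 0 W m n.
Proof.
move=> H; rewrite LPP_lpp; apply: lpp_ext => -[|i] [|j] //= _ im jn.
- by rewrite /sw /site_weight /bdry/= mul0r.
- by rewrite /sw /site_weight /bdry/= mul0r.
- by rewrite /sw /site_weight /bdry/= H.
Qed.

End lpp_paths.

Section iid_init.
Context d (T : measurableType d) (R : realType) (P : probability T R).
Notation mR := (measurableTypeR R).
Notation indep := (@indep d T R P).
Notation rv := (@rv d T R).

(** The product formula for sets becomes one for functions, one variable at a time: [law_ext] is
    used with a density made of the functions already treated and the indicators of the remaining
    variables. *)
Let setindep (I : eqType) (X : I -> T -> mR) (l : seq I) : uniq l ->
  (forall i, measurable_fun setT (X i)) ->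
  forall D c, measurable_fun setT (D : T -> mR) -> (forall t, 0 <= D t) -> 0 <= c ->
  (forall B : I -> set mR, (forall i, measurable (B i)) ->
    (\int[P]_t (D t * \prod_(i <- l) \1_(B i) (X i t))%:E =
      (c * \prod_(i <- l) fine (expd 1 (B i)))%:E)%E) ->
  indep D c [seq rv (X i) 1 | i <- l].
Proof.
move=> + mX; elim: l => [|i l IH] /=.
  move=> _ D c mD D0 c0 /(_ (fun=> setT) (fun=> measurableT)).
  rewrite big_nil mulr1 => E; split=> //; rewrite -E.
  by apply: eq_integral => t _; rewrite big_nil mulr1.
move=> /andP[il ul] D c mD D0 c0 H; split=> [|g cg mg g0 Hg]; first exact: mX.
have cg0 : 0 <= cg by rewrite -lee_fin -Hg; apply: integral_ge0 => x _; rewrite lee_fin.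
apply: IH => //.
- by apply: measurable_funM => //; exact: measurableT_comp mg (mX i).
- by move=> t; rewrite mulr_ge0.
- by rewrite mulr_ge0.
move=> B mB.
pose D' t := D t * \prod_(j <- l) \1_(B j) (X j t).
have mD' : measurable_fun setT (D' : T -> mR).
  apply: measurable_funM => //; apply: measurable_prod => j _.
  by apply: measurableT_comp (mX j); exact: measurable_indic.
have i01 (S : set mR) x : 0 <= \1_S x :> R by rewrite indicE.
have D'0 t : 0 <= D' t by rewrite mulr_ge0// prodr_ge0.
pose c' := c * \prod_(j <- l) fine (expd 1 (B j)).
have c'0 : 0 <= c' by rewrite mulr_ge0// prodr_ge0// => j _; rewrite fine_ge0.
have := law_ext (mu := expd 1) (mX i) mD' D'0 c'0.
move=> /(_ P) K; have {}K : forall g : mR -> R, measurable_fun setT g -> (forall x, 0 <= g x) ->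
  (\int[P]_t (D' t * g (X i t))%:E = c'%:E * \int[expd 1]_x (g x)%:E)%E.
  apply: K => A mA.
  have := H (fun j => if j == i then A else B j).
  have mAB j : measurable (if j == i then A else B j) by case: ifP.
  move=> /(_ mAB); rewrite big_cons eqxx => E.
  have eqf (f h : I -> R) : (forall j, j \in l -> f j = h j) ->
      \prod_(j <- l) f j = \prod_(j <- l) h j.
    by move=> fh; rewrite big_seq [RHS]big_seq; apply: eq_bigr => j /fh.
  have ji j : j \in l -> (j == i) = false.
    by move=> jl; apply/negbTE; apply: contra il => /eqP <-.
  transitivity ((c * (fine (expd 1 A) * \prod_(j <- l) fine (expd 1 (B j))))%:E)%E.
    rewrite -(eqf (fun j => fine (expd 1 (if j == i then A else B j)))); last first.
      by move=> j jl; rewrite ji.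
    rewrite -E; apply: eq_integral => t _; congr (_%:E).
    rewrite big_cons eqxx /D' -(eqf (fun j => \1_(if j == i then A else B j) (X j t))); last first.
      by move=> j jl; rewrite ji.
    by ring.
  rewrite (_ : _ * _ = c' * fine (expd 1 A)); last by rewrite /c'; ring.
  by rewrite EFinM fineK// fin_num_measure.
have := K g mg g0; rewrite [(\int[expd 1]_x (g x)%:E)%E]Hg -EFinM => K'.
rewrite (_ : c * cg * _ = c' * cg); last by rewrite /c'; ring.
rewrite -K'; apply: eq_integral => t _; congr (_%:E); rewrite /D' /=; ring.
Qed.

Variable om : nat -> nat -> {RV P >-> R}.
Hypothesis iid : iid_exp1 P om.

(** Exponential variables are nonnegative only almost surely. Truncation makes the deterministic
    comparisons valid at every point; the null set is discarded at the end. *)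
Definition wt (p : nat * nat) (t : T) : R := Num.max (om p.1 p.2 t) 0.

Let mom (p : nat * nat) : measurable_fun setT (om p.1 p.2 : T -> mR).
Proof. exact (measurable_funP (om p.1 p.2)). Qed.

Lemma iid_wt (l : seq (nat * nat)) : uniq l -> indep (fun=> 1) 1 [seq rv (wt p) 1 | p <- l].
Proof.
move=> ul; have [ind law] := iid.
have H : indep (fun=> 1) 1 [seq rv (om p.1 p.2 : T -> mR) 1 | p <- l].
  apply: (@setindep _ (fun p : nat * nat => om p.1 p.2 : T -> mR)) => //.
  move=> B mB.
  have := ind [fset p in l]%fset B mB.
  have pl : perm_eq [fset p in l]%fset l.
    apply: uniq_perm; [exact: fset_uniq|by []|].
    by move=> p; rewrite inE.
  rewrite (perm_big _ pl) => E.
  rewrite mul1r (_ : (\prod_(i <- l) fine (expd 1 (B i)))%:E =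
      \prod_(i <- l) P (om i.1 i.2 @^-1` B i))%E; last first.
    rewrite -prodEFin; apply: eq_bigr => p _.
    rewrite fineK; last by rewrite fin_num_measure.
    by rewrite expdE// (law p.1 p.2 _ (mB p)).
  rewrite -E.
  have mI : measurable (\bigcap_(p in [set` [fset p in l]%fset]) (om p.1 p.2 @^-1` B p)).
    apply: fin_bigcap_measurable => // p _.
    by rewrite -[X in measurable X]setTI; exact: (mom p).
  set I := (\bigcap_(i in _) _) in mI *.
  have <- : (\int[P]_t (\1_I t)%:E = P I)%E by rewrite integral_indic// setIT.
  apply: eq_integral => t _; congr (_%:E); rewrite /I.
  rewrite mul1r indicE; case: (boolP (t \in _)); rewrite ?inE.
    move=> h; rewrite big_seq big1// => p pl'.
    by rewrite indicE mem_set//; apply: (h p); rewrite /= inE.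
  move=> h; have [p pl' hp] : exists2 p, p \in l & ~ B p (om p.1 p.2 t).
    apply: contrapT => hn; move/negP: h; apply; rewrite inE => p /=; rewrite inE => pl'.
    by apply: contrapT => hB; apply: hn; exists p.
  rewrite (bigD1_seq p)//= indicE memNset// mul0r//.
move: H; rewrite -[X in indep _ _ X -> _]cats0 -[X in _ -> indep _ _ X]cats0.
apply: indep_head_all; first by rewrite !size_map.
move=> i D c X0; rewrite size_map => il; rewrite !(nth_map (0%N, 0%N))//.
set p := nth _ _ _.
have mm : measurable_fun setT (fun x : mR => Num.max x 0 : mR) by exact: measurable_maxr.
move=> [mX K]; split=> [|g cg mg g0 Hg]; first exact: measurableT_comp mm (mom p).
apply: (K (fun x => g (Num.max x 0))) => //; first exact: measurableT_comp mg mm.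
have mgE : measurable_fun setT (EFin \o g) by exact/measurable_EFinP.
have mgm : measurable_fun setT (fun x : mR => (g (Num.max x 0))%:E).
  exact: measurableT_comp mgE mm.
have gE0 x : (0 <= (g x)%:E)%E by rewrite lee_fin.
rewrite -Hg; apply: (eq_integral_expd ltr01 mgm (fun=> gE0 _) mgE gE0) => x x0.
by rewrite /= (max_idPl x0).
Qed.

Lemma iid_rect_reindex m n (sigma : nat -> nat -> nat * nat) :
  (forall i j i' j', (i <= m)%N -> (j <= n)%N -> (i' <= m)%N -> (j' <= n)%N ->
    sigma i j = sigma i' j' -> (i, j) = (i', j')) ->
  iid_rect P m n (fun i j => wt (sigma i j)).
Proof.
move=> inj; split=> [i j t|s us /allP sr]; first by rewrite le_max lexx orbT.
have := iid_wt (l := [seq sigma p.1 p.2 | p <- s]); rewrite -map_comp; apply.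
rewrite map_inj_in_uniq// => -[i j] [i' j'] /sr/andP[/= h1 h2] /sr/andP[/= h3 h4].
exact: inj.
Qed.

(* Passage times to height [n] only use the rows [j < n] of [om], so row [n] can provide independent
   boundary weights, its even and odd entries serving the two axes. *)
Definition sw_index (n i j : nat) : nat * nat :=
  if j == 0%N then (i.*2, n) else if i == 0%N then (j.*2.+1, n) else (i.-1, j.-1).

(** The bulk of [sw_index] after a half turn, with the same boundary entries: the two fields are
    related as [V] and [U] in [glpp_northeast]. *)
Definition ne_index (m n i j : nat) : nat * nat :=
  if j == 0%N then (i.*2, n) else if i == 0%N then (j.*2.+1, n) else (m - i, n - j)%N.

Lemma iid_sw m n : iid_rect P m n (fun i j => wt (sw_index n i j)).
Proof.
apply: iid_rect_reindex => -[|i] [|j] [|i'] [|j'] im jn im' jn'; rewrite /sw_index/=;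
  move=> e; have := congr1 fst e; have := congr1 snd e => /= e2 e1; congr pair; lia.
Qed.

Lemma iid_ne m n : iid_rect P m n (fun i j => wt (ne_index m n i j)).
Proof.
apply: iid_rect_reindex => -[|i] [|j] [|i'] [|j'] im jn im' jn'; rewrite /ne_index/=;
  move=> e; have := congr1 fst e; have := congr1 snd e => /= e2 e1; congr pair; lia.
Qed.

End iid_init.

(** * Scaling regime *)

Section regime.
Context {R : realType}.

Lemma expRN_le (x : R) : 0 < x -> expR (- x) <= x^-1.
Proof.
move=> x0; rewrite expRN lef_pV2 ?posrE ?expR_gt0//.
by have := expR_ge1Dx x; lra.
Qed.

(** With $r=\sqrt{m/n}$ one has $N=n(1+r)^2$ and $\rho=r/(1+r)$, and the estimates follow from
    $|r-g|(r+g)=|m/n-g^2|$. Here [q] stands for $n^{1/3}$. *)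
Lemma char_regime (g C q : R) (m n : nat) : 0 < g -> 0 < C -> 0 < q -> q ^+ 3 = n%:R ->
  C / g ^+ 2 < q -> C / g <= q -> `|m%:R - g ^+ 2 * n%:R| <= C * q ^+ 2 ->
  exists N rho l, [/\ charpt m n N rho l, (0 < m)%N, `|rho - g / (1 + g)| <= C / g / q,
    q <= l <= (2 + g) * q &
    `|N - n%:R * (1 + g) ^+ 2| <= `|m%:R - g ^+ 2 * n%:R| * ((3 + 2 * g) / g)].
Proof.
move=> g0 C0 q0 qn Cq1 Cq2 Hm.
have n0 : 0 < n%:R :> R by rewrite -qn exprn_gt0.
have g2 : 0 < g ^+ 2 by rewrite exprn_gt0.
have q2 : 0 < q ^+ 2 by rewrite exprn_gt0.
have m0 : 0 < m%:R :> R.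
  move: Hm; rewrite ler_norml => /andP[h _].
  have : C * q ^+ 2 < g ^+ 2 * n%:R.
    rewrite -qn (_ : g ^+ 2 * q ^+ 3 = g ^+ 2 * q * q ^+ 2); last by ring.
    by rewrite ltr_pM2r// mulrC -ltr_pdivrMr.
  lra.
pose r := Num.sqrt (m%:R / n%:R : R).
have mn0 : 0 < m%:R / n%:R :> R by rewrite divr_gt0.
have r0 : 0 < r by rewrite sqrtr_gt0.
have rE : r ^+ 2 = m%:R / n%:R by rewrite sqr_sqrtr// ltW.
have mE : m%:R = n%:R * r ^+ 2 by rewrite rE; field; rewrite gt_eqF.
pose N := n%:R * (1 + r) ^+ 2.
have N0 : 0 < N by rewrite mulr_gt0// exprn_gt0//; lra.
pose l := powR N (1 / 3).
have lE : l ^+ 3 = N.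
  rewrite /l -powR_mulrn ?powR_ge0// -powRrM.
  by rewrite (_ : 1 / 3 * 3 = 1 :> R) ?powRr1 ?ltW//; field.
have l0 : 0 < l by rewrite powR_gt0.
have r1 : 0 < 1 + r by lra.
have dr : `|r - g| * (r + g) = `|m%:R - g ^+ 2 * n%:R| / n%:R.
  rewrite -[X in _ * X]gtr0_norm; last lra.
  rewrite -normrM -[X in _ = _ / X](gtr0_norm n0) -normf_div; congr (`|_|).
  by rewrite mE; field; rewrite gt_eqF.
have drg : `|r - g| <= `|m%:R - g ^+ 2 * n%:R| / n%:R / g.
  by rewrite ler_pdivlMr// -dr ler_wpM2l//; lra.
have drq : `|r - g| <= C / g / q.
  apply: (le_trans drg); rewrite mulrAC ler_pdivrMr//.
  have -> : C / g / q * n%:R = C * q ^+ 2 / g by rewrite -qn; field; rewrite !gt_eqF.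
  by rewrite ler_pM2r ?invr_gt0.
have r_up : r <= g + 1.
  have : C / g / q <= 1 by rewrite ler_pdivrMr// mul1r.
  by move: drq; rewrite ler_norml => /andP[_]; lra.
exists N, (r / (1 + r)), l; split.
- split=> //.
  + by rewrite mE /N; field; rewrite gt_eqF.
  + by rewrite /N; field; rewrite gt_eqF.
  + by rewrite divr_gt0//= ltr_pdivrMr//; lra.
- by rewrite -(ltr_nat R).
- apply: le_trans drq.
  have g1 : 0 < 1 + g by lra.
  rewrite (_ : r / (1 + r) - g / (1 + g) = (r - g) / ((1 + r) * (1 + g))); last first.
    by field; rewrite !gt_eqF.
  have gg : 1 <= (1 + r) * (1 + g) by nra.
  rewrite normf_div (gtr0_norm (lt_le_trans ltr01 gg)) ler_pdivrMr; last by lra.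
  by rewrite ler_peMr.
- have l3 : q ^+ 3 <= l ^+ 3.
    by rewrite lE /N qn ler_peMr ?ltW//; nra.
  have l3' : l ^+ 3 <= ((2 + g) * q) ^+ 3.
    rewrite lE /N -qn exprMn mulrC ler_pM2r ?exprn_gt0//; nra.
  apply/andP; split; last by rewrite -(@ler_pXn2r _ 3%N)// nnegrE; nra.
  by rewrite -(@ler_pXn2r _ 3%N)// nnegrE ltW.
- rewrite (_ : N - n%:R * (1 + g) ^+ 2 = n%:R * (r - g) * (2 + r + g)); last by rewrite /N; ring.
  rewrite !normrM (gtr0_norm n0) (gtr0_norm (_ : 0 < 2 + r + g)); last lra.
  apply: (@le_trans _ _ (`|m%:R - g ^+ 2 * n%:R| / g * (2 + r + g))).
    rewrite ler_pM2r; last lra.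
    have -> : `|m%:R - g ^+ 2 * n%:R| / g = n%:R * (`|m%:R - g ^+ 2 * n%:R| / n%:R / g).
      by field; rewrite !gt_eqF.
    by rewrite ler_pM2l.
  by rewrite -mulrA ler_wpM2l// mulrC ler_pM2r ?invr_gt0//; lra.
Qed.

End regime.

Definition swfield d (T : measurableType d) (R : realType) (P : probability T R)
    (om : nat -> nat -> {RV P >-> R}) (n i j : nat) : T -> R :=
  wt om (sw_index n i j).

(** The order of the constants matters: [k] makes the exit probabilities small, [y] the crossing
    probabilities, and [A0], chosen last, beats the factor [B], which grows with [k]. *)
Lemma onepoint_tight d (T : measurableType d) (R : realType) (P : probability T R)
    (om : nat -> nat -> {RV P >-> R}) (g eps : R) : iid_exp1 P om -> 0 < g -> 0 < eps ->
  exists A Q : R, [/\ 0 < A, 0 < Q & forall (m n : nat) (q : R), q ^+ 3 = n%:R -> Q <= q ->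
    `|m%:R - g ^+ 2 * n%:R| <= 2 ->
    pbd P [set x | A * q < `|gfield (swfield om n) 0 0 x m n - n%:R * (1 + g) ^+ 2|] eps].
Proof.
move=> iid g0 eps0.
pose rho := g / (1 + g).
have g1 : 0 < 1 + g by lra.
have g20 : 0 <= 2 + g by lra.
have rho0 : 0 < rho by rewrite divr_gt0.
have rho1 : rho < 1 by rewrite ltr_pdivrMr//; lra.
(* At most half the distance from [rho] to 0 and to 1, so that perturbed parameters stay in
   $[\eta,1-\eta]$. *)
pose eta := rho * (1 - rho) / 2.
have eta0 : 0 < eta by rewrite /eta divr_gt0// mulr_gt0//; lra.
have eta1 : 2 * eta <= rho by rewrite /eta; nra.
have eta2 : 2 * eta <= 1 - rho by rewrite /eta; nra.
have e4 : 0 < 6 / eta ^+ 4 by rewrite divr_gt0 ?exprn_gt0.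
pose k := 1 + 8 * (4 + 6 / eta ^+ 4) / eps.
have k1 : 1 <= k by rewrite /k lerDl divr_ge0 ?ltW//; lra.
have k0 : 0 < k by lra.
have Hk : 2 * (expR (- (k ^+ 3 / 2)) + (2 + 6 / eta ^+ 4) / k) <= eps / 4.
  have k3 : 0 < k ^+ 3 / 2 by rewrite divr_gt0 ?exprn_gt0.
  have h1 : expR (- (k ^+ 3 / 2)) <= 2 / k.
    apply: (le_trans (expRN_le k3)); rewrite invf_div ler_pM2l// lef_pV2 ?posrE ?exprn_gt0//.
    by rewrite exprS ler_peMr ?(ltW k0)// expr2; nra.
  apply: (@le_trans _ _ (2 * (4 + 6 / eta ^+ 4) / k)).
    rewrite -mulrA ler_pM2l//.
    have -> : (4 + 6 / eta ^+ 4) / k = 2 / k + (2 + 6 / eta ^+ 4) / k by rewrite -mulrDl; congr (_ / _); lra.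
    by rewrite lerD2r.
  rewrite ler_pdivrMr// /k [eps / 4 * _]mulrDr mulr1.
  have -> : eps / 4 * (8 * (4 + 6 / eta ^+ 4) / eps) = 2 * (4 + 6 / eta ^+ 4).
    by field; rewrite !gt_eqF.
  by lra.
pose y := 64 / eps.
have y0 : 0 < y by rewrite divr_gt0.
have Hy : 4 * expR (- (k * y / 2)) <= eps / 8.
  have y2 : 0 < y / 2 by lra.
  have h1 : expR (- (k * y / 2)) <= expR (- (y / 2)) by rewrite ler_expR lerN2; nra.
  have h2 := expRN_le y2.
  have ye : (y / 2)^-1 = eps / 32 by rewrite /y; field; rewrite gt_eqF.
  rewrite ye in h2; lra.
have Hy2 : expR (- (2 * y)) <= eps / 4.
  apply: (le_trans (expRN_le (_ : 0 < 2 * y))); first lra.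
  have -> : (2 * y)^-1 = eps / 128 by rewrite /y; field; rewrite gt_eqF.
  lra.
pose B := 4 * (9 * k ^+ 3 / eta ^+ 2 + 1) / k.
have B0 : 0 < B.
  have h : 0 < 9 * k ^+ 3 / eta ^+ 2.
    apply: divr_gt0; last exact: exprn_gt0.
    by apply: mulr_gt0 => //; exact: exprn_gt0.
  by rewrite /B divr_gt0//; lra.
pose A0 := 4 * B / eps.
have A00 : 0 < A0 by rewrite /A0 divr_gt0//; lra.
have HA0 : B / A0 = eps / 4 by rewrite /A0; field; rewrite !gt_eqF.
pose C3 := (3 + 2 * g) / g.
have C30 : 0 < C3 by rewrite divr_gt0//; lra.
(* The factor $2+g$ bounds $l/q$; the last two terms absorb [eta^-1] and the distance between $N$
   and $n(1+g)^2$. *)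
pose A := (2 + g) * (A0 + 2 * y + 1 / eta ^+ 2) + eta^-1 + 2 * C3.
have e20 : 0 < 1 / eta ^+ 2 by rewrite divr_gt0 ?exprn_gt0.
have ev0 : 0 < eta^-1 by rewrite invr_gt0.
have A_0 : 0 < A.
  have h : 0 < (2 + g) * (A0 + 2 * y + 1 / eta ^+ 2) by apply: mulr_gt0; lra.
  by rewrite /A; lra.
pose Q := 1 + 2 / g ^+ 2 + 2 / g + (2 / g + 3 * k) / eta.
have g2 : 0 < 2 / g ^+ 2 by rewrite divr_gt0 ?exprn_gt0.
have g3 : 0 < 2 / g by rewrite divr_gt0.
have g4 : 0 < (2 / g + 3 * k) / eta by rewrite divr_gt0//; lra.
exists A, Q; split=> //; first by rewrite /Q; lra.
move=> m n q qn Qq Hm.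
have q1 : 1 <= q by move: Qq g2 g3 g4; rewrite /Q; clear; lra.
have q0 : 0 < q by exact: lt_le_trans q1.
have q21 : 1 <= q ^+ 2 by exact: exprn_ege1.
have [N [rh [l [chm m0 Hrh /andP[ql lq] HN]]]] :
    exists N rho l, [/\ charpt m n N rho l, (0 < m)%N, `|rho - g / (1 + g)| <= 2 / g / q,
    q <= l <= (2 + g) * q &
    `|N - n%:R * (1 + g) ^+ 2| <= `|m%:R - g ^+ 2 * n%:R| * ((3 + 2 * g) / g)].
  apply: char_regime => //.
  - by move: Qq g2 g3 g4; rewrite /Q; clear; lra.
  - by move: Qq g2 g3 g4; rewrite /Q; clear; lra.
  - by apply: (le_trans Hm); move: q21; clear; lra.
have n0 : (0 < n)%N by rewrite -(ltr_nat R) -qn exprn_gt0.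
have l0 : 0 < l by exact: lt_le_trans ql.
have kl : k / l <= k / q by rewrite ler_pM2l// lef_pV2 ?posrE.
have small : (2 / g + 3 * k) / q <= eta.
  by rewrite ler_pdivrMr// -ler_pdivrMl// mulrC; move: Qq g2 g3; rewrite /Q; clear; lra.
have sp : 2 / g / q + 3 * (k / q) <= eta by move: small; rewrite mulrDl !mulrA.
have kq0 : 0 < k / q by rewrite divr_gt0.
have gq0 : 0 < 2 / g / q by rewrite divr_gt0.
move: Hrh; rewrite ler_norml -/rho => /andP[Hr1 Hr2].
have kl1 : 1 / l <= k / l by rewrite ler_pM2r ?invr_gt0.
have [c1 c2 c3 c4] : [/\ eta <= rh - 3 * (k / l), rh + 3 * (k / l) <= 1 - eta,
    eta <= rh - 1 / l & rh + 1 / l <= 1 - eta].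
  by move: Hr1 Hr2 sp kl kl1 eta1 eta2 kq0 gq0 eta0; clear; split; lra.
have iidU := iid_sw iid m n.
have iidV := iid_ne iid m n.
have VU i j x : (i < m)%N -> (j < n)%N ->
    wt om (ne_index m n i.+1 j.+1) x = wt om (sw_index n (m - i)%N (n - j)%N) x.
  move=> im jn; rewrite /ne_index /sw_index /= !subn_eq0 (leqNgt m i) (leqNgt n j) im jn /=.
  by rewrite -!subnS.
have B1 := @onepoint_lower _ _ _ P m n _ _ N rh l eta k y A0 iidU iidV chm VU m0 n0 eta0 k1 A00.
have {}B1 := B1 c1 c2.
have B2 := @onepoint_upper _ _ _ P m n _ N rh l eta y iidU chm eta0.
have {}B2 := B2 c3 c4.
apply: (pbd_sub _ (pbd_le _ (pbdU B1 B2))); last first.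
  by rewrite -/B HA0; move: Hk Hy Hy2 eps0; clear; lra.
move=> x /=; rewrite -/(swfield om n) ltr_normr => Hx.
have HN' : `|N - n%:R * (1 + g) ^+ 2| <= 2 * C3.
  by apply: (le_trans HN); rewrite ler_pM2r.
move: HN'; rewrite ler_norml => /andP[HN1 HN2].
have ev : eta^-1 <= eta^-1 * q by rewrite ler_peMr// ltW.
have c3' : 2 * C3 <= 2 * C3 * q by apply: ler_peMr => //; apply: mulr_ge0 => //; exact: ltW.
have hA : (A0 + 2 * y) * l <= (2 + g) * (A0 + 2 * y) * q.
  rewrite (_ : (2 + g) * (A0 + 2 * y) * q = (A0 + 2 * y) * ((2 + g) * q)); last by ring.
  by rewrite ler_pM2l//; clear -A00 y0; lra.
have hE : l / eta ^+ 2 <= (2 + g) * (1 / eta ^+ 2) * q.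
  rewrite (_ : l / eta ^+ 2 = 1 / eta ^+ 2 * l); last by rewrite mul1r mulrC.
  rewrite (_ : (2 + g) * (1 / eta ^+ 2) * q = 1 / eta ^+ 2 * ((2 + g) * q)); last by ring.
  by rewrite ler_pM2l.
have hy : y * l <= (2 + g) * y * q.
  by rewrite (_ : (2 + g) * y * q = y * ((2 + g) * q)); [rewrite ler_pM2l|ring].
have hA0 : 0 <= (2 + g) * A0 * q by exact: mulr_ge0 (mulr_ge0 g20 (ltW A00)) (ltW q0).
have hyy : 0 <= (2 + g) * y * q by exact: mulr_ge0 (mulr_ge0 g20 (ltW y0)) (ltW q0).
have hee : 0 <= (2 + g) * (1 / eta ^+ 2) * q by exact: mulr_ge0 (mulr_ge0 g20 (ltW e20)) (ltW q0).
have AE : A * q = (2 + g) * (A0 + 2 * y) * q + (2 + g) * (1 / eta ^+ 2) * q + eta^-1 * q + 2 * C3 * q.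
  by rewrite /A; ring.
have evq : 0 <= eta^-1 * q by rewrite mulr_ge0// ltW.
move: Hx; rewrite AE; set L := gfield _ _ _ _ _ _.
clear -HN1 HN2 ev c3' hA hE hy hA0 hyy hee evq.
by move=> /orP[] Hx; [right|left] => /=; lra.
Qed.

(** Mirror image of [row_comparison]: domination by the horizontal axis persists to the right of
    [i0], and gives the upper half of the sandwich. *)
Lemma row_comparison_ge {R : realType} (w : nat -> nat -> R) s t i0 n :
  (forall i j, 0 <= w i j) -> 0 <= s -> 0 <= t ->
  glpp 0 t w i0 n <= glpp s 0 w i0 n ->
  forall i, (i0 <= i)%N -> hinc (glpp 0 0 w) i n <= hinc (glpp s t w) i n.
Proof.
move=> w0 s0 t0 H i ii0.
have m1 k : hinc (glpp 0 t w) k n <= hinc (glpp 0 0 w) k n.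
  by apply: (inc_mono _ _ _ k n).1 => // j; rewrite /bdry/= ler_wpM2r.
have m2 k : hinc (glpp 0 0 w) k n <= hinc (glpp s 0 w) k n.
  by apply: (inc_mono _ _ _ k n).1 => // j; rewrite /bdry/= ler_wpM2r.
have E k : glpp 0 t w (i0 + k) n <= glpp s 0 w (i0 + k) n.
  elim: k => [|k IH]; first by rewrite addn0.
  have := le_trans (m1 (i0 + k)%N) (m2 (i0 + k)%N); rewrite /hinc -addnS; lra.
have G k : (i0 <= k)%N -> glpp s t w k n = glpp s 0 w k n.
  by move=> ki0; rewrite glpp_max// (max_idPl _)// -(subnKC ki0); exact: E.
by rewrite {2}/hinc !G ?(leqW ii0)//; exact: m2.
Qed.

(** The cube of $e^{y/3}\ge1+y/3$. It will be used with $y$ of order $\tau^{-1}$, where the third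
    power beats a number of blocks of order $\tau^{-2}$. *)
Lemma expRN_le3 {R : realType} (y : R) : 0 < y -> expR (- y) <= 27 / y ^+ 3.
Proof.
move=> y0; have h := expR_ge1Dx (y / 3).
have y3 : 0 < y / 3 by lra.
rewrite expRN -[27 / _]invf_div lef_pV2 ?posrE ?expR_gt0//; last by rewrite divr_gt0// exprn_gt0.
rewrite (_ : y ^+ 3 / 27 = (y / 3) ^+ 3); last by field.
rewrite (_ : expR y = expR (y / 3) ^+ 3); last by rewrite -expRM_natr; congr expR; field.
by apply: lerXn2r; rewrite ?nnegrE ?expR_ge0//; lra.
Qed.

(** * Increments along the top row *)

Section modulus.
Context d (T : measurableType d) (R : realType) (P : probability T R).
Notation pbd := (@pbd d T R P).
Notation indep := (@indep d T R P).
Notation rv := (@rv d T R).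

Lemma indep_iota_sub (f : nat -> item T R) m p b D c : (p + b <= m)%N ->
  indep D c [seq f i | i <- iota 0 m] -> indep D c [seq f i | i <- iota p b].
Proof.
move=> pb; rewrite -(subnKC pb) iotaD map_cat => /indep_catC /indep_drop.
by rewrite iotaD map_cat => /indep_drop.
Qed.

Lemma block_upper m n (U : nat -> nat -> T -> R) (a th y : R) p b :
  iid_rect P m n U -> 0 < a < 1 -> 0 < th < a -> (p + b <= m)%N ->
  pbd [set x | exists2 k, (k <= b)%N & y + th * (k%:R / (a - th)) <=
    th * (gfield U a^-1 (1 - a)^-1 x (p + k)%N n - gfield U a^-1 (1 - a)^-1 x p n)] (expR (- y)).
Proof.
move=> iidU a01 /andP[th0 tha] pb; have /andP[a0 a1] := a01.
have /indep_catC /indep_drop K := stationary_rows iidU a01.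
apply: (pbd_sub _ (ville_exp y a0 tha (indep_iota_sub pb K))).
move=> x [k kb] /= Hk; exists k.
by rewrite take_iota (minn_idPl kb) sum_shift size_iota sum_hinc mulrBr; lra.
Qed.

Lemma block_lower m n (U : nat -> nat -> T -> R) (a th y : R) p b :
  iid_rect P m n U -> 0 < a < 1 -> 0 < th -> (p + b <= m)%N ->
  pbd [set x | exists2 k, (k <= b)%N & y +
    th * (gfield U a^-1 (1 - a)^-1 x (p + k)%N n - gfield U a^-1 (1 - a)^-1 x p n) <=
    th * (k%:R / (a + th))] (expR (- y)).
Proof.
move=> iidU a01 th0 pb; have /andP[a0 a1] := a01.
have tha : - th < a by lra.
have /indep_catC /indep_drop K := stationary_rows iidU a01.
apply: (pbd_sub _ (ville_exp y a0 tha (indep_iota_sub pb K))).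
move=> x [k kb] /= Hk; exists k; rewrite opprK.
by rewrite take_iota (minn_idPl kb) sum_shift size_iota sum_hinc mulrBr; lra.
Qed.

(** Here [a] itself is prescribed, rather than its distance to [rh] in units of $1/l$, so that one
    value can serve several endpoints. *)
Lemma exit_bound_simple m n (U : nat -> nat -> T -> R) (N rh l eta k0 a : R) :
  iid_rect P m n U -> charpt m n N rh l -> 0 < eta -> 1 <= k0 -> eta <= rh ->
  k0 / l <= a - rh -> a + 1 / l <= 1 - eta ->
  pbd [set x | gfield U 0 (1 - a)^-1 x m n < gfield U a^-1 0 x m n] ((4 + 6 / eta ^+ 4) / k0).
Proof.
move=> iidU chm eta0 k1 er ka ae; have [_ _ _ l0 _] := chm.
have lN0 : l != 0 by rewrite gt_eqF.
pose k := (a - rh) * l.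
have Hk : rh + k / l = a by rewrite /k; field.
have kk0 : k0 <= k by rewrite /k -ler_pdivrMr.
have k1' : 1 <= k by lra.
have kp : 0 < k by lra.
have Hk' : rh + (k + 1) / l <= 1 - eta by rewrite mulrDl addrA Hk.
have := exit_bound iidU chm eta0 k1' er Hk'; rewrite /= Hk; apply: pbd_le.
have k3 : 0 < k ^+ 3 / 2 by rewrite divr_gt0 ?exprn_gt0.
have e4 : 0 < 6 / eta ^+ 4 by rewrite divr_gt0 ?exprn_gt0.
have h1 : expR (- (k ^+ 3 / 2)) <= 2 / k.
  apply: (le_trans (expRN_le k3)); rewrite invf_div ler_pM2l// lef_pV2 ?posrE ?exprn_gt0//.
  by rewrite exprS ler_peMr ?(ltW kp)// expr2; nra.
apply: (@le_trans _ _ ((4 + 6 / eta ^+ 4) / k)).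
  have -> : (4 + 6 / eta ^+ 4) / k = 2 / k + (2 + 6 / eta ^+ 4) / k.
    by rewrite -mulrDl; congr (_ / _); lra.
  by rewrite lerD2r.
by rewrite ler_pM2l ?lef_pV2 ?posrE//; lra.
Qed.

(** The characteristic parameter of $(m,n)$ is within $(C/g)/q$ of $g/(1+g)$. Adding this to the
    margin $k_0/q$ gives two parameters that do not depend on [m] and lie at distance at least
    $k_0/l$ on either side of it. The lower one is handled by transposition. *)
Lemma exit_regime m n (U : nat -> nat -> T -> R) (g C q eta k0 : R) (rho := g / (1 + g)) :
  iid_rect P m n U -> 0 < g -> 0 < C -> 0 < q -> q ^+ 3 = n%:R ->
  C / g ^+ 2 < q -> C / g <= q -> `|m%:R - g ^+ 2 * n%:R| <= C * q ^+ 2 ->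
  0 < eta -> 1 <= k0 -> eta + (k0 + C / g) / q + 1 / q <= rho ->
  rho + (k0 + C / g) / q + 1 / q <= 1 - eta ->
  let a := rho + (k0 + C / g) / q in let z := rho - (k0 + C / g) / q in
  pbd [set x | gfield U 0 (1 - a)^-1 x m n < gfield U a^-1 0 x m n] ((4 + 6 / eta ^+ 4) / k0) /\
  pbd [set x | gfield U z^-1 0 x m n < gfield U 0 (1 - z)^-1 x m n] ((4 + 6 / eta ^+ 4) / k0).
Proof.
move=> iidU g0 C0 q0 qn h1 h2 h3 eta0 k1 h4 h5 a z.
have [N [rh [l [chm m0 Hrh /andP[ql _] _]]]] := char_regime g0 C0 q0 qn h1 h2 h3.
have l0 : 0 < l by lra.
move: Hrh; rewrite -/rho ler_norml => /andP[r1 r2].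
have E : (k0 + C / g) / q = k0 / q + C / g / q by rewrite mulrDl.
have k0l : k0 / l <= k0 / q by rewrite ler_pM2l ?lef_pV2 ?posrE//; lra.
have ll : 1 / l <= 1 / q by rewrite ler_pM2l ?lef_pV2 ?posrE//; lra.
have q1 : 0 < 1 / q by rewrite divr_gt0.
have kq : 0 < k0 / q by rewrite divr_gt0//; lra.
have cq : 0 < C / g / q by rewrite !divr_gt0.
clear h1 h2 h3 qn.
split.
  apply: (exit_bound_simple iidU chm eta0 k1); rewrite ?/a ?E; move: h4 h5; rewrite E; lra.
have := @exit_bound_simple n m (fun i j => U j i) N (1 - rh) l eta k0 (1 - z)
  (iid_rect_tr iidU) (charpt_tr chm) eta0 k1.
rewrite (_ : 1 - (1 - z) = z); last by ring.
have c1 : eta <= 1 - rh by move: h4 h5; rewrite E; lra.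
have c2 : k0 / l <= 1 - z - (1 - rh) by rewrite /z E; lra.
have c3 : 1 - z + 1 / l <= 1 - eta by rewrite /z; move: h4 h5; rewrite E; lra.
move=> /(_ c1 c2 c3); apply: pbd_sub => x /=; rewrite /gfield => H.
rewrite (glpp_tr 0 z^-1 (fun i j => U i j x)) (glpp_tr (1 - z)^-1 0 (fun i j => U i j x)).
exact: H.
Qed.

End modulus.

Lemma block_arith {R : realType} (rho e th y K DL DU Dl : R) :
  0 < rho -> 0 < e -> e <= rho / 2 -> 0 < th -> 0 <= K ->
  th * DU < y + th * (K / (rho - e)) -> DL <= DU ->
  th * (K / (rho + e)) < y + th * Dl -> Dl <= DL ->
  `|DL - K / rho| <= y / th + 2 * K * e / rho ^+ 2.
Proof.
move=> rho0 e0 er th0 K0 hU LU hl lL.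
have thN0 : th != 0 by rewrite gt_eqF.
have hU' : DU < y / th + K / (rho - e).
  by rewrite -(ltr_pM2l th0) mulrDr mulrCA divff// mulr1.
have hl' : K / (rho + e) < y / th + Dl.
  by rewrite -(ltr_pM2l th0) [ltRHS]mulrDr [th * (y / th)]mulrCA divff// mulr1.
have re : 0 < rho - e by lra.
have re' : 0 < rho + e by lra.
have pA : 0 < rho * (rho / 2) by apply: mulr_gt0; lra.
have pB : 0 < rho * (rho - e) by exact: mulr_gt0.
have pC : 0 < rho * (rho + e) by exact: mulr_gt0.
have u1 : K / (rho - e) - K / rho <= 2 * K * e / rho ^+ 2.
  rewrite (_ : _ - _ = K * e / (rho * (rho - e))); last by field; rewrite !gt_eqF.
  rewrite (_ : 2 * K * e / rho ^+ 2 = K * e / (rho * (rho / 2))); last by field; rewrite gt_eqF.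
  apply: ler_wpM2l; first by rewrite mulr_ge0// ltW.
  rewrite lef_pV2 ?posrE//.
  by rewrite ler_pM2l//; lra.
have u2 : K / rho - K / (rho + e) <= 2 * K * e / rho ^+ 2.
  rewrite (_ : _ - _ = K * e / (rho * (rho + e))); last by field; rewrite !gt_eqF.
  rewrite (_ : 2 * K * e / rho ^+ 2 = K * e / (rho * (rho / 2))); last by field; rewrite gt_eqF.
  apply: ler_wpM2l; first by rewrite mulr_ge0// ltW.
  rewrite lef_pV2 ?posrE//.
  by rewrite ler_pM2l//; lra.
by rewrite ler_norml; apply/andP; split; lra.
Qed.

Section modulus_int.
Context d (T : measurableType d) (R : realType) (P : probability T R).
Notation pbd := (@pbd d T R P).
Variable om : nat -> nat -> {RV P >-> R}.
Hypothesis iid : iid_exp1 P om.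

Let L n x i := gfield (swfield om n) 0 0 x i n.

(** Two exit events suffice for all blocks. At the right end [m] the maximal path for [w] leaves
    vertically, which bounds all row increments before [m] from below; at the left end [p0] the one
    for [z] leaves horizontally, which bounds all increments after [p0] from above. Ville's
    inequality then controls the two stationary rows in each block. *)
Lemma blocks_bound (g q eta k0 kap th y C : R) (rho := g / (1 + g)) (n p0 b J : nat) :
  0 < g -> 0 < C -> 0 < q -> q ^+ 3 = n%:R -> C / g ^+ 2 < q -> C / g <= q ->
  `|p0%:R - g ^+ 2 * n%:R| <= C * q ^+ 2 ->
  `|(p0 + J * b)%:R - g ^+ 2 * n%:R| <= C * q ^+ 2 ->
  0 < eta -> 1 <= k0 -> kap = k0 + C / g ->
  eta + kap / q + 1 / q <= rho -> rho + kap / q + 1 / q <= 1 - eta ->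
  0 < th -> kap / q + th <= rho / 2 ->
  pbd [set x | exists2 j, (j < J)%N & exists2 k, (k <= b)%N &
      y / th + 2 * k%:R * (kap / q + th) / rho ^+ 2 <
      `|L n x (p0 + j * b + k)%N - L n x (p0 + j * b)%N - k%:R / rho|]
    (2 * ((4 + 6 / eta ^+ 4) / k0) + 2 * expR (- y) *+ J).
Proof.
move=> g0 C0 q0 qn h1 h2 hmin hmax eta0 k1 kE h4 h5 th0 the.
set m := (p0 + J * b)%N in hmax.
have iidU := iid_sw iid m n.
have iidU0 : iid_rect P p0 n (swfield om n) by apply: iid_rect_sub iidU; rewrite /m ?leq_addr.
rewrite kE in h4 h5.
have [_ E0] := exit_regime iidU0 g0 C0 q0 qn h1 h2 hmin eta0 k1 h4 h5.
have [E1 _] := exit_regime iidU g0 C0 q0 qn h1 h2 hmax eta0 k1 h4 h5.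
rewrite -/rho -kE in E0 E1 h4 h5.
have kap0 : 0 < kap by have : 0 < C / g by [rewrite divr_gt0]; lra.
have kq : 0 < kap / q by rewrite divr_gt0.
have q1 : 0 < 1 / q by rewrite divr_gt0.
pose w := rho + kap / q; pose z := rho - kap / q.
have w01 : 0 < w < 1 by rewrite /w; apply/andP; split; lra.
have z01 : 0 < z < 1 by rewrite /z; apply/andP; split; lra.
have thz : 0 < th < z by rewrite /z; apply/andP; split; lra.
clear h1 h2 hmin hmax qn.
have BU : pbd [set x | exists2 j, j \in iota 0 J & (exists2 k, (k <= b)%N &
      y + th * (k%:R / (z - th)) <= th * (gfield (swfield om n) z^-1 (1 - z)^-1 x (p0 + j * b + k)%N n -
        gfield (swfield om n) z^-1 (1 - z)^-1 x (p0 + j * b)%N n)) \/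
    (exists2 k, (k <= b)%N & y + th * (gfield (swfield om n) w^-1 (1 - w)^-1 x (p0 + j * b + k)%N n -
        gfield (swfield om n) w^-1 (1 - w)^-1 x (p0 + j * b)%N n) <= th * (k%:R / (w + th)))]
    ((expR (- y) + expR (- y)) *+ size (iota 0 J)).
  apply: pbd_bigU => j; rewrite mem_iota add0n => /= jJ.
  have pb : (p0 + j * b + b <= m)%N by rewrite /m -addnA leq_add2l -mulSnr leq_mul2r jJ orbT.
  exact: pbdU (block_upper y iidU z01 thz pb) (block_lower y iidU w01 th0 pb).
rewrite size_iota in BU.
apply: (pbd_sub _ (pbd_le _ (pbdU (pbdU E0 E1) BU))); last first.
  by rewrite (_ : expR (- y) + expR (- y) = 2 * expR (- y)); lra.
move=> x [j jJ [k kb Hk]]; apply: contrapT => /not_orP[/not_orP[n0 n1] n2].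
have U0 i l : 0 <= swfield om n i l x by case: iidU => + _; exact.
have c0 : glpp 0 (1 - z)^-1 (fun i l => swfield om n i l x) p0 n <=
    glpp z^-1 0 (fun i l => swfield om n i l x) p0 n.
  by rewrite leNgt; apply/negP.
have c1 : glpp w^-1 0 (fun i l => swfield om n i l x) m n <=
    glpp 0 (1 - w)^-1 (fun i l => swfield om n i l x) m n.
  by rewrite leNgt; apply/negP.
have /andP[w0 w1] := w01; have /andP[z0 z1] := z01.
have iv (u : R) : 0 < u -> 0 <= u^-1 by move=> u0; rewrite invr_ge0 ltW.
have z1' : 0 < 1 - z by lra.
have w1' : 0 < 1 - w by lra.
have cz := row_comparison_ge U0 (iv _ z0) (iv _ z1') c0.
have cw := row_comparison U0 (iv _ w0) (iv _ w1') c1.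
have n2z : th * (gfield (swfield om n) z^-1 (1 - z)^-1 x (p0 + j * b + k)%N n -
        gfield (swfield om n) z^-1 (1 - z)^-1 x (p0 + j * b)%N n) < y + th * (k%:R / (z - th)).
  rewrite ltNge; apply/negP => h; apply: n2; exists j; first by rewrite mem_iota.
  by left; exists k.
have n2w : th * (k%:R / (w + th)) < y + th * (gfield (swfield om n) w^-1 (1 - w)^-1 x (p0 + j * b + k)%N n -
        gfield (swfield om n) w^-1 (1 - w)^-1 x (p0 + j * b)%N n).
  rewrite ltNge; apply/negP => h; apply: n2; exists j; first by rewrite mem_iota.
  by right; exists k.
have pkm : (p0 + j * b + k <= m)%N.
  by rewrite /m -addnA leq_add2l (leq_trans (leq_add (leqnn _) kb))// -mulSnr leq_mul2r jJ orbT.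
have dz : L n x (p0 + j * b + k)%N - L n x (p0 + j * b)%N <=
   gfield (swfield om n) z^-1 (1 - z)^-1 x (p0 + j * b + k)%N n -
   gfield (swfield om n) z^-1 (1 - z)^-1 x (p0 + j * b)%N n.
  rewrite /L -!sum_hinc big_seq [leRHS]big_seq; apply: ler_sum => i; rewrite mem_iota => /andP[pi _].
  by apply: cz; exact: leq_trans (leq_addr _ _) pi.
have dw : gfield (swfield om n) w^-1 (1 - w)^-1 x (p0 + j * b + k)%N n -
   gfield (swfield om n) w^-1 (1 - w)^-1 x (p0 + j * b)%N n <=
   L n x (p0 + j * b + k)%N - L n x (p0 + j * b)%N.
  rewrite /L -!sum_hinc big_seq [leRHS]big_seq; apply: ler_sum => i; rewrite mem_iota => /andP[_ ik].
  by apply: cw; exact: leq_trans ik pkm.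
move: Hk; rewrite ltNge => /negP; apply.
have ez : z - th = rho - (kap / q + th) by rewrite /z; ring.
have ew : w + th = rho + (kap / q + th) by rewrite /w; ring.
rewrite ez in n2z; rewrite ew in n2w.
have rho0 : 0 < rho by lra.
have e0 : 0 < kap / q + th by lra.
exact: (block_arith rho0 e0 the th0 (ler0n _ _) n2z dz n2w dw).
Qed.

End modulus_int.

(** Blocks have length about $\tau^2q^2$ and the tilt is $1/(\tau q)$. With $y=e_1/(2\tau)$ the
    error $y/\theta$ is $e_1q/2$, the error in the slope contributes $O(\tau q)$, and about
    $\tau^{-2}$ blocks, each failing with probability $O(\tau^3)$, leave $O(\tau)$. *)
Lemma modulus_int d (T : measurableType d) (R : realType) (P : probability T R)
    (om : nat -> nat -> {RV P >-> R}) (g B eps e1 : R) (rho := g / (1 + g)) :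
  iid_exp1 P om -> 0 < g -> 0 < B -> 0 < eps -> 0 < e1 ->
  exists dl Q : R, [/\ 0 < dl, 0 < Q & forall (n : nat) (q : R), q ^+ 3 = n%:R -> Q <= q ->
    exists p0 b J : nat, [/\ p0%:R <= g ^+ 2 * n%:R - B * q ^+ 2,
      g ^+ 2 * n%:R + B * q ^+ 2 + 1 <= (p0 + J * b)%:R, dl * q ^+ 2 <= b%:R &
      pbd P [set x | exists2 j, (j < J)%N & exists2 k, (k <= b)%N &
        e1 * q < `|gfield (swfield om n) 0 0 x (p0 + j * b + k)%N n -
                   gfield (swfield om n) 0 0 x (p0 + j * b)%N n - k%:R / rho|] eps]].
Proof.
move=> iid g0 B0 eps0 e10.
have g1 : 0 < 1 + g by lra.
have rho0 : 0 < rho by rewrite divr_gt0.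
have rho1 : rho < 1 by rewrite ltr_pdivrMr//; lra.
pose eta := rho * (1 - rho) / 2.
have eta0 : 0 < eta by rewrite /eta divr_gt0// mulr_gt0//; lra.
have eta1 : 2 * eta <= rho by rewrite /eta; nra.
have eta2 : 2 * eta <= 1 - rho by rewrite /eta; nra.
pose c4 := 4 + 6 / eta ^+ 4.
have c40 : 0 < c4.
  by have : 0 < 6 / eta ^+ 4 by [rewrite divr_gt0 ?exprn_gt0]; rewrite /c4; lra.
pose k0 := 1 + 4 * c4 / eps.
have k01 : 1 <= k0.
  by have : 0 < 4 * c4 / eps by [rewrite divr_gt0// mulr_gt0]; rewrite /k0; lra.
have P1 : 2 * (c4 / k0) <= eps / 2.
  rewrite mulrA ler_pdivrMr; last by lra.
  rewrite /k0 [eps / 2 * _]mulrDr mulr1 (_ : eps / 2 * (4 * c4 / eps) = 2 * c4); last first.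
    by field; rewrite gt_eqF.
  by lra.
(* Despite the rounding of [b] and [J], the last block ends no later than $g^2n+(B+4)q^2$. *)
pose C := B + 5.
have C0 : 0 < C by rewrite /C; lra.
pose kap := k0 + C / g.
have kap0 : 0 < kap by have : 0 < C / g by [rewrite divr_gt0]; rewrite /kap; lra.
have rho20 : 0 < rho ^+ 2 by rewrite exprn_gt0.
(* [t1] takes care of the error in the slope, [t2] of the total failure probability. *)
pose t1 := rho ^+ 2 * e1 / (8 * (kap + 1)).
(* The constant is $27\cdot2^3$, from [expRN_le3] at $e_1/(2\tau)$; it is kept abstract so that the
   algebra treats it as a variable. *)
have [c c0 cE] : exists2 c : R, 0 < c & 216 = c by exists 216.
pose t2 := eps * e1 ^+ 3 / (4 * c * (2 * B + 3)).
have t10 : 0 < t1 by apply: divr_gt0; [exact: mulr_gt0|lra].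
have t20 : 0 < t2.
  apply: divr_gt0; last by apply: mulr_gt0; [exact: mulr_gt0|lra].
  by apply: mulr_gt0 => //; exact: exprn_gt0.
pose tau := Num.min 1 (Num.min t1 t2).
have tau0 : 0 < tau by rewrite !lt_min ltr01 t10 t20.
have tau1 : tau <= 1 by rewrite ge_min lexx.
have taut1 : tau <= t1 by rewrite !ge_min lexx !orbT.
have taut2 : tau <= t2 by rewrite !ge_min lexx !orbT.
have tauN0 : tau != 0 by rewrite gt_eqF.
have tau20 : 0 < tau ^+ 2 by rewrite exprn_gt0.
have dev : 4 * (tau ^+ 2 * kap + tau) / rho ^+ 2 <= e1 / 2.
  rewrite ler_pdivrMr//.
  have h1 : tau * (8 * (kap + 1)) <= rho ^+ 2 * e1.
    by rewrite -ler_pdivlMr//; lra.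
  have h2 : tau ^+ 2 * kap <= tau * kap.
    by rewrite ler_pM2r// expr2 ler_piMl// ltW.
  lra.
pose J := (Num.truncn ((2 * B + 2) / tau ^+ 2)).+1.
have x0 : 0 <= (2 * B + 2) / tau ^+ 2 by rewrite divr_ge0 ?ltW//; lra.
have /andP[J1 J2] := truncn_itv x0; rewrite -/J in J2.
have J3 : J%:R <= (2 * B + 2) / tau ^+ 2 + 1 by rewrite /J -natr1 lerD2r.
have J4 : 2 * B + 2 <= J%:R * tau ^+ 2 by rewrite -ler_pdivrMr// ltW.
have J5 : J%:R * tau ^+ 2 <= 2 * B + 3.
  apply: (@le_trans _ _ (((2 * B + 2) / tau ^+ 2 + 1) * tau ^+ 2)); first by rewrite ler_pM2r.
  have t21 : tau ^+ 2 <= 1 by rewrite expr2; nra.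
  rewrite mulrDl divfK ?gt_eqF// mul1r; lra.
pose y := e1 / (2 * tau).
have y0 : 0 < y by rewrite /y divr_gt0// mulr_gt0.
have P2 : 2 * expR (- y) *+ J <= eps / 2.
  rewrite -mulr_natr.
  have h1 : expR (- y) <= c * tau ^+ 3 / e1 ^+ 3.
    apply: (le_trans (expRN_le3 y0)); rewrite le_eqVlt; apply/orP; left; apply/eqP.
    by rewrite /y -cE; field; rewrite tauN0 gt_eqF.
  apply: (@le_trans _ _ (2 * (c * tau ^+ 3 / e1 ^+ 3) * J%:R)).
    by rewrite ler_wpM2r// ler_pM2l.
  have ce0 : 0 <= 2 * c / e1 ^+ 3 by rewrite divr_ge0 ?exprn_ge0 ?mulr_ge0 ?ltW.
  rewrite (_ : 2 * _ * _ = 2 * c / e1 ^+ 3 * tau * (J%:R * tau ^+ 2)); last first.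
    by field; rewrite gt_eqF.
  apply: (le_trans (ler_wpM2l (mulr_ge0 ce0 (ltW tau0)) J5)).
  have B30 : 0 <= 2 * B + 3 by clear - B0; lra.
  apply: (le_trans (ler_wpM2r B30 (ler_wpM2l ce0 taut2))).
  rewrite le_eqVlt; apply/orP; left; apply/eqP; rewrite /t2; field.
  by rewrite !gt_eqF//; clear - B0; lra.
pose Q := 1 + C / g ^+ 2 + C / g + (kap + 1) / eta + (kap + 1 / tau) / (rho / 2) + 1 / tau + J%:R.
have Q1 : 0 < C / g ^+ 2 by rewrite divr_gt0 ?exprn_gt0.
have Q2 : 0 < C / g by rewrite divr_gt0.
have Q3 : 0 < (kap + 1) / eta by apply: divr_gt0 => //; exact: addr_gt0.
have Q5 : 0 < 1 / tau by rewrite divr_gt0.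
have Q4 : 0 < (kap + 1 / tau) / (rho / 2) by apply: divr_gt0; [exact: addr_gt0|exact: divr_gt0].
have Q6 : 0 <= J%:R :> R by [].
exists (tau ^+ 2), Q; split=> //; first by rewrite /Q; lra.
move=> n q qn Qq.
have [q1 qC1 qC2] : [/\ 1 <= q, C / g ^+ 2 < q & C / g <= q].
  by move: Qq Q1 Q2 Q3 Q4 Q5 Q6; rewrite /Q; clear; split; lra.
have [qk qt qtau qJ] : [/\ (kap + 1) / eta <= q, (kap + 1 / tau) / (rho / 2) <= q, 1 / tau <= q & J%:R <= q].
  by move: Qq Q1 Q2 Q3 Q4 Q5 Q6; rewrite /Q; clear; split; lra.
clear Qq Q1 Q2 Q3 Q4 Q5 Q6 x0 J1 J2 J3.
have q0 : 0 < q by exact: lt_le_trans q1.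
have qN0 : q != 0 by rewrite gt_eqF.
have q20 : 0 < q ^+ 2 by rewrite exprn_gt0.
have q2q : q <= q ^+ 2 by rewrite expr2 ler_peMr// ltW.
have q21 : 1 <= q ^+ 2 by exact: le_trans q2q.
have qJ2 : J%:R <= q ^+ 2 by exact: le_trans q2q.
have g20 : 0 < g ^+ 2 by rewrite exprn_gt0.
have pos : 0 <= g ^+ 2 * n%:R - B * q ^+ 2.
  rewrite -qn (_ : _ - _ = (g ^+ 2 * q - B) * q ^+ 2); last by ring.
  apply: mulr_ge0; last exact: ltW.
  have h : C < q * g ^+ 2 by rewrite -ltr_pdivrMr.
  by rewrite subr_ge0 mulrC; apply/ltW; apply: le_lt_trans h; rewrite lerDl.
pose p0 := Num.truncn (g ^+ 2 * n%:R - B * q ^+ 2).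
have /andP[p1 p2] := truncn_itv pos; rewrite -/p0 in p1 p2; rewrite -natr1 in p2.
pose b := (Num.truncn (tau ^+ 2 * q ^+ 2)).+1.
have tq0 : 0 <= tau ^+ 2 * q ^+ 2 by rewrite mulr_ge0// ltW.
have /andP[b1 b2] := truncn_itv tq0; rewrite -/b in b2.
have b3 : b%:R <= tau ^+ 2 * q ^+ 2 + 1 by rewrite /b -natr1 lerD2r.
have tq1 : 1 <= tau ^+ 2 * q ^+ 2.
  have : 1 <= q * tau by rewrite -ler_pdivrMr.
  by clear; rewrite -exprMn [tau * q]mulrC => h; rewrite expr2; nra.
have Jb1 : (2 * B + 2) * q ^+ 2 <= J%:R * b%:R.
  apply: (@le_trans _ _ (J%:R * (tau ^+ 2 * q ^+ 2))); last by rewrite ler_wpM2l// ltW.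
  by rewrite mulrA ler_pM2r.
have Jb2 : J%:R * b%:R <= (2 * B + 4) * q ^+ 2.
  apply: (@le_trans _ _ (J%:R * (tau ^+ 2 * q ^+ 2 + 1))); first by rewrite ler_wpM2l.
  rewrite mulrDr mulr1 mulrA.
  have : J%:R * tau ^+ 2 * q ^+ 2 <= (2 * B + 3) * q ^+ 2 by rewrite ler_pM2r.
  by move: qJ2; clear; lra.
have mE : (p0 + J * b)%:R = p0%:R + J%:R * b%:R :> R by rewrite natrD natrM.
have Bq : 0 < B * q ^+ 2 by rewrite mulr_gt0.
exists p0, b, J; split=> //.
- by rewrite mE; move: p2 Jb1 q21; clear; lra.
- exact: ltW.
have hmin : `|p0%:R - g ^+ 2 * n%:R| <= C * q ^+ 2.
  by rewrite ler_norml /C; apply/andP; split; move: p1 p2 q21 Bq; clear; lra.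
have hmax : `|(p0 + J * b)%:R - g ^+ 2 * n%:R| <= C * q ^+ 2.
  by rewrite mE ler_norml /C; apply/andP; split; move: p1 p2 q21 Bq Jb1 Jb2; clear; lra.
pose th := 1 / (tau * q).
have th0 : 0 < th by rewrite divr_gt0// mulr_gt0.
have small : kap / q + 1 / q <= eta.
  by rewrite -mulrDl ler_pdivrMr// [X in _ <= X]mulrC -ler_pdivrMr.
have the : kap / q + th <= rho / 2.
  rewrite (_ : kap / q + th = (kap + 1 / tau) / q); last by rewrite /th; field; rewrite qN0.
  by rewrite ler_pdivrMr// [X in _ <= X]mulrC -ler_pdivrMr//; exact: divr_gt0.
have h4 : eta + kap / q + 1 / q <= rho by move: small eta1; clear; lra.
have h5 : rho + kap / q + 1 / q <= 1 - eta by move: small eta2; clear; lra.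
have K := blocks_bound iid y g0 C0 q0 qn qC1 qC2 hmin hmax eta0 k01 (erefl : kap = k0 + C / g)
  h4 h5 th0 the.
apply: (pbd_sub _ (pbd_le _ K)); last by move: P1 P2; rewrite /c4; clear; lra.
move=> x [j jJ [k kb Hk]]; exists j => //; exists k => //; apply: le_lt_trans Hk.
have -> : y / th = e1 / 2 * q by rewrite /y /th; field; rewrite ?qN0 ?tauN0.
have kb' : k%:R <= 2 * (tau ^+ 2 * q ^+ 2).
  apply: (@le_trans _ _ b%:R); first by rewrite ler_nat.
  by move: b3 tq1; clear; lra.
have kth0 : 0 < kap / q + th by rewrite addr_gt0// divr_gt0.
rewrite (_ : e1 * q = e1 / 2 * q + e1 / 2 * q); last by field.
apply: lerD; first exact: lexx.
apply: (@le_trans _ _ (2 * (2 * (tau ^+ 2 * q ^+ 2)) * (kap / q + th) / rho ^+ 2)).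
  by rewrite ler_pM2r ?invr_gt0// ler_pM2r// ler_pM2l.
rewrite (_ : _ / rho ^+ 2 = 4 * (tau ^+ 2 * kap + tau) / rho ^+ 2 * q).
  by rewrite ler_pM2r.
by rewrite /th; field; rewrite qN0 tauN0 gt_eqF.
Qed.

(** * Compactness and tightness in the space of continuous functions *)

Section function_space.
Context (R : realType).
Implicit Types (f g : R -> R) (M A del eta : R) (dk : nat -> R).

Lemma uniform_continuity_segment f M eta : continuous f -> 0 < eta ->
  exists2 del, 0 < del & forall u v, - M <= u <= M -> - M <= v <= M -> `|u - v| < del ->
    `|f u - f v| <= eta.
Proof.
move=> cf eta0.
have /compact_near_coveringP := @segment_compact R (- M) M.
move=> /(_ R (0 : R)^'+ (fun dl u => forall v, `|u - v| < dl -> `|f u - f v| <= eta)).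
case=> [x _|e /= e0 He].
  have /cvgrPdist_lt/(_ _ (divr_gt0 eta0 (ltr0Sn R 1))) := cf x.
  move=> /nbhs_ballP[r /= r0 rP].
  exists (ball x (r / 2), [set dl | dl < r / 2]).
    split; first by apply: nbhsx_ballx; exact: divr_gt0.
    by apply: nbhs_right_lt; exact: divr_gt0.
  move=> [u dl] [/= xu dlr] v uv.
  have ru : ball x r u.
    by apply: (@le_ball _ _ x (r / 2)) => //; rewrite ler_pdivrMr// ler_pMr// ler1n.
  have rv : ball x r v.
    rewrite [r]splitr; apply: ball_triangle xu _.
    by rewrite -ball_normE /= (lt_trans uv).
  move: (rP _ ru) (rP _ rv) => /= h1 h2.
  rewrite (_ : f u - f v = (f x - f v) - (f x - f u)); last by ring.
  by apply: (le_trans (ler_normB _ _)); rewrite [leRHS]splitr; apply: lerD; exact: ltW.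
exists (e / 2); first exact: divr_gt0.
move=> u v uM _ uv; apply: (He (e / 2)) => //=.
- by rewrite sub0r normrN gtr0_norm ?divr_gt0// ltr_pdivrMr// ltr_pMr// ltr1n.
- exact: divr_gt0.
Qed.

(** An Arzela-Ascoli set with a countable family of moduli. Functions live on the whole line but are
    constrained on the segment only, which is all that the topology of uniform convergence there
    sees. *)
Definition equi_bounded M A dk : set {uniform` `[- M, M]%classic -> R} :=
  [set f | `|f 0| <= A /\ forall k u v, - M <= u <= M -> - M <= v <= M -> `|u - v| < dk k ->
    `|f u - f v| <= k.+1%:R^-1].

Arguments equi_bounded : clear implicits.

Lemma equi_bounded_continuous M A dk f : (forall k, 0 < dk k) -> equi_bounded M A dk f ->
  {within `[- M, M]%classic, continuous f}.
Proof.
move=> dk0 [_ H]; apply/subspace_continuousP => x; rewrite /= in_itv/= => xM.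
apply/cvgrPdist_le => e e0.
have [k ke] : exists k : nat, k.+1%:R^-1 <= e.
  exists (Num.truncn e^-1); rewrite invf_ple ?posrE//; apply/ltW.
  by have /andP[] := truncn_itv (ltW (etrans (invr_gt0 e) e0)).
have : nbhs x [set y | `|x - y| < dk k].
  by apply/nbhs_ballP; exists (dk k) => //= y; rewrite -ball_normE.
apply: filterS => y xy; rewrite /= in_itv/= => yM.
by apply: le_trans ke; exact: H.
Qed.

(** The segment from 0 to [u] is cut into pieces shorter than [dk 0], on each of which [f] varies by
    at most 1. *)
Lemma equi_bounded_le M A dk f u : 0 < dk 0%N -> 0 < M -> equi_bounded M A dk f ->
  - M <= u <= M -> `|f u| <= A + (Num.truncn (M / dk 0%N)).+1%:R.
Proof.
move=> d0 M0 [fA H]; rewrite -ler_norml => uM.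
have x0 : 0 <= M / dk 0%N by apply: divr_ge0; exact: ltW.
have /andP[_] := truncn_itv x0; set N := (Num.truncn _).+1 => MN.
have N0 : (0 : R) < N%:R by rewrite ltr0n.
have uN0 : 0 <= `|u| / N%:R by rewrite divr_ge0// ltW.
have rng j : (j <= N)%N -> - M <= j%:R * (u / N%:R) <= M.
  move=> jN; rewrite -ler_norml !normrM normfV normr_nat (ger0_norm (ltW N0)).
  apply: le_trans uM; rewrite -[leRHS](divfK (lt0r_neq0 N0)) mulrC.
  by apply: ler_wpM2l => //; rewrite ler_nat.
have step i : (i <= N)%N -> `|f (i%:R * (u / N%:R)) - f 0| <= i%:R.
  elim: i => [_|i IH iN]; first by rewrite mul0r subrr normr0.
  rewrite (_ : f _ - f 0 = (f (i.+1%:R * (u / N%:R)) - f (i%:R * (u / N%:R))) +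
    (f (i%:R * (u / N%:R)) - f 0)); last by ring.
  apply: (le_trans (ler_normD _ _)); rewrite -[leRHS]natr1 addrC; apply: lerD; first exact: IH (ltnW iN).
  have := H 0%N _ _ (rng _ iN) (rng _ (ltnW iN)); rewrite invr1; apply.
  rewrite -mulrBl -natr1 [_ + 1]addrC addrK mul1r normrM normfV (ger0_norm (ltW N0)).
  by rewrite ltr_pdivrMr// (le_lt_trans uM)// mulrC -ltr_pdivrMr.
have := step _ (leqnn N); rewrite mulrCA divff ?mulr1 ?gt_eqF// => h.
rewrite -[f u](subrK (f 0)) addrC; apply: (le_trans (ler_normD _ _)); exact: lerD.
Qed.

(** Along an ultrafilter the values at each point converge, being bounded. The pointwise limit
    inherits the moduli, and these upgrade convergence on a finite net to uniform convergence. *)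
Lemma compact_equi_bounded M A dk : 0 < M -> (forall k, 0 < dk k) ->
  compact (equi_bounded M A dk).
Proof.
move=> M0 dk0; rewrite compact_ultra => F FU FK.
pose B := A + (Num.truncn (M / dk 0%N)).+1%:R.
(* Outside the segment nothing is required of the limit. *)
have lim u : exists l, - M <= u <= M -> forall e, 0 < e -> F [set f | `|l - f u| < e].
  have [uM|] := boolP (- M <= u <= M); last by exists 0.
  pose pF : set_system R := [set (fun f : R -> R => f u) @` D | D in F].
  have pFU : UltraFilter pF.
    apply: ultra_image; apply/seteqP; split=> // y _; by exists (fun=> y).
  have pFB : pF `[- B, B]%classic.
    apply: (@filterS _ pF _ ((fun f : R -> R => f u) @` equi_bounded M A dk)); last by exists (equi_bounded M A dk).
    by move=> _ [f Kf <-]; rewrite /= in_itv/= -ler_norml; exact: equi_bounded_le Kf uM.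
  have := @segment_compact R (- B) B; rewrite compact_ultra => /(_ pF pFU pFB)[l [_ /= pFl]].
  exists l => _ e e0.
  have [D FD DE] := pFl _ (nbhsx_ballx l e e0).
  apply: (@filterS _ F _ D) FD => f Df.
  have : ball l e (f u) by rewrite -DE; exists f.
  by rewrite -ball_normE.
have [g gP] := choice lim.
have M00 : - M <= 0 <= M by rewrite oppr_le0 ltW//=.
have gK : equi_bounded M A dk g.
  split.
    apply/ler_addgt0Pr => e e0.
    have [f [[fA _]/= ge]] := filter_ex (filterI FK (gP 0 M00 _ e0)).
    have := ler_normD (g 0 - f 0) (f 0); rewrite subrK => h.
    by apply: (le_trans h); rewrite addrC; apply: lerD => //; exact: ltW.
  move=> k u v uM vM uv; apply/ler_addgt0Pr => e e0.
  have e20 : 0 < e / 2 by exact: divr_gt0.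
  have [f [[[_ fH]/= gu] gv]] := filter_ex (filterI (filterI FK (gP u uM _ e20)) (gP v vM _ e20)).
  have h := fH _ _ _ uM vM uv.
  rewrite (_ : g u - g v = (f u - f v) + ((g u - f u) - (g v - f v))); last by ring.
  apply: (le_trans (ler_normD _ _)); apply: lerD => //.
  by apply: (le_trans (ler_normB _ _)); rewrite [leRHS]splitr; apply: lerD; exact: ltW.
exists g; split => //= W /uniform_nbhs[E [+ EW]]; rewrite -entourage_ballE => -[e /= e0 eE].
have e40 : 0 < e / 4 by exact: divr_gt0.
have [k ke] : exists k : nat, k.+1%:R^-1 < e / 4.
  exists (Num.truncn (e / 4)^-1); rewrite invf_plt ?posrE//.
  by have /andP[] := truncn_itv (ltW (etrans (invr_gt0 (e / 4)) e40)).
have x0 : 0 <= 2 * M / dk k by apply: divr_ge0; [apply: mulr_ge0 => //|]; exact: ltW.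
have /andP[_] := truncn_itv x0; set N := (Num.truncn _).+1 => MN.
have N0 : (0 : R) < N%:R by rewrite ltr0n.
pose h := 2 * M / N%:R.
have h0 : 0 < h by apply: divr_gt0 => //; exact: mulr_gt0.
have hN : h * N%:R = 2 * M by rewrite /h divfK// gt_eqF.
have hd : h < dk k by rewrite ltr_pdivrMr// [dk k * _]mulrC -ltr_pdivrMr.
pose p (i : nat) := - M + i%:R * h.
have pM i : (i <= N)%N -> - M <= p i <= M.
  move=> iN; rewrite /p lerDl mulr_ge0//=; last exact: ltW.
  have : i%:R * h <= N%:R * h by rewrite ler_pM2r// ler_nat.
  by rewrite [_ * h in X in _ <= X -> _]mulrC hN; lra.
have net : F [set f | forall i : 'I_N.+1, `|g (p i) - f (p i)| < e / 4].
  apply: filter_forall => i; apply: gP; last exact: e40.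
  by apply: pM; rewrite -ltnS.
apply: (@filterS _ F _ (equi_bounded M A dk `&` [set f | forall i : 'I_N.+1, `|g (p i) - f (p i)| < e / 4])); last exact: filterI.
move=> f [[_ fH] /= fn]; apply: EW => u; rewrite /= in_itv/= => uM.
apply: eE; rewrite /= -ball_normE /=.
have y0 : 0 <= (u + M) / h by apply: divr_ge0; [rewrite -lerBlDr sub0r; case/andP: uM|exact: ltW].
have /andP[i1 i2] := truncn_itv y0; set i := Num.truncn _ in i1 i2.
have iN : (i <= N)%N.
  rewrite -(ler_nat R); apply: (le_trans i1); rewrite ler_pdivrMr// mulrC hN mulr_natl mulr2n.
  by rewrite lerD2r; case/andP: uM.
have up : `|u - p i| < dk k.
  apply: le_lt_trans hd.
  rewrite ler_pdivlMr// in i1; rewrite ltr_pdivrMr// -natr1 mulrDl mul1r in i2.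
  rewrite /p ger0_norm; move: i1 i2; clear; lra.
have h1 := fH k _ _ uM (pM _ iN) up.
have h2 := gK.2 k _ _ uM (pM _ iN) up.
have h3 := fn (Ordinal (iN : (i < N.+1)%N)).
rewrite (_ : g u - f u = (g u - g (p i)) + (g (p i) - f (p i)) - (f u - f (p i))); last by ring.
apply: (le_lt_trans (ler_normB _ _)).
apply: (@lt_trans _ _ (e / 4 + e / 4 + e / 4)); last by move: e0; clear; lra.
apply: ltrD; last exact: le_lt_trans ke.
apply: (le_lt_trans (ler_normD _ _)); apply: ltrD; last exact: h3.
exact: le_lt_trans ke.
Qed.

End function_space.
Arguments equi_bounded {R} M A dk.

Lemma rat_near (R : realType) (M u r : R) : 0 < M -> - M <= u <= M -> 0 < r ->
  exists2 p : rat, - M <= ratr p <= M & `|u - ratr p| < r.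
Proof.
move=> M0 /andP[u1 u2] r0.
have lt : Num.max (- M) (u - r) < Num.min M (u + r).
  by rewrite gt_max !lt_min; move: M0 u1 u2 r0; clear; lra.
have [p] := rat_in_itvoo lt.
rewrite in_itv/= gt_max lt_min => /andP[/andP[p1 p2] /andP[p3 p4]].
by exists p; [rewrite !ltW|rewrite ltr_norml; move: p2 p4; clear; lra].
Qed.

(** * Tightness from one-point bounds and moduli of continuity *)

Section tightness_criterion.
Context d (T : measurableType d) (R : realType) (P : probability T R) (M : R).
Hypothesis M0 : 0 < M.
Local Notation mR := (measurableTypeR R).

Definition modev (f : T -> R -> R) (del eta : R) : set T :=
  [set x | exists u v, [/\ - M <= u <= M, - M <= v <= M, `|u - v| < del &
    eta < `|f x u - f x v|]].

Lemma modev_mono f del del' eta : del <= del' -> modev f del eta `<=` modev f del' eta.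
Proof.
by move=> dd x [u [v [uM vM uv H]]]; exists u, v; split=> //; exact: lt_le_trans dd.
Qed.

Section fixed_process.
Variable f : T -> R -> R.
Hypothesis cf : forall x, continuous (f x).
Hypothesis mf : forall u, measurable_fun setT (fun x => f x u : mR).

(** By continuity the strict inequalities survive a small move of [u] and [v] to rational points, so
    the event is a countable union. *)
Lemma modev_measurable del eta : measurable (modev f del eta).
Proof.
pose G (p q : rat) : set T := if [&& - M <= ratr p <= M, - M <= ratr q <= M &
  `|ratr p - ratr q| < del] then [set x | eta < `|f x (ratr p) - f x (ratr q)|] else set0.
have -> : modev f del eta = \bigcup_p \bigcup_q G p q.
  apply/seteqP; split=> x.
    move=> [u [v [uM vM uv H]]].
    pose r0 := (del - `|u - v|) / 2.
    have r00 : 0 < r0 by rewrite divr_gt0// subr_gt0.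
    pose s0 := (`|f x u - f x v| - eta) / 2.
    have s00 : 0 < s0 by rewrite divr_gt0// subr_gt0.
    have /cvgrPdist_lt/(_ _ s00)/nbhs_ballP[r1 /= r10 H1] := @cf x u.
    have /cvgrPdist_lt/(_ _ s00)/nbhs_ballP[r2 /= r20 H2] := @cf x v.
    pose r := Num.min r0 (Num.min r1 r2).
    have r_0 : 0 < r by rewrite !lt_min r00 r10 r20.
    have [rr0 rr1 rr2] : [/\ r <= r0, r <= r1 & r <= r2].
      by rewrite /r !ge_min !lexx !orbT.
    have [p pM up] := rat_near M0 uM r_0; have [q qM vq] := rat_near M0 vM r_0.
    exists p => //; exists q => //; rewrite /G pM qM /=.
    have -> : `|ratr p - ratr q| < del.
      rewrite (_ : ratr p - ratr q = (u - v) - (u - ratr p) + (v - ratr q)); last by ring.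
      apply: (le_lt_trans (ler_normD _ _)).
      apply: (le_lt_trans (lerD (ler_normB _ _) (lexx _))).
      by move: rr0 up vq; rewrite /r0; clear; lra.
    have b1 : ball u r1 (ratr p) by rewrite -ball_normE /= (lt_le_trans up).
    have b2 : ball v r2 (ratr q) by rewrite -ball_normE /= (lt_le_trans vq).
    have := H1 _ b1; have := H2 _ b2 => /= h2 h1.
    have := ler_normD (f x (ratr p) - f x (ratr q)) ((f x u - f x (ratr p)) - (f x v - f x (ratr q))).
    rewrite (_ : _ + (_ - _) = f x u - f x v); last by ring.
    have := ler_normB (f x u - f x (ratr p)) (f x v - f x (ratr q)).
    by move: h1 h2; rewrite /s0; clear; rewrite /=; lra.
  move=> [p _ [q _]]; rewrite /G; case: ifP => // /and3P[pM qM pq] H.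
  by exists (ratr p), (ratr q).
apply: bigcupT_measurable_rat => p; apply: bigcupT_measurable_rat => q.
rewrite /G; case: ifP => // _.
have mn : measurable_fun setT (fun x => `|f x (ratr p) - f x (ratr q)| : mR).
  by apply: measurableT_comp; [exact: normr_measurable|apply: measurable_funB; exact: mf].
rewrite -[X in measurable X]setTI.
have -> : [set x | eta < `|f x (ratr p) - f x (ratr q)|] =
    (fun x => `|f x (ratr p) - f x (ratr q)| : mR) @^-1` `]eta, +oo[%classic.
  by apply/seteqP; split=> x /=; rewrite in_itv/= andbT.
by apply: mn => //; exact: measurable_itv.
Qed.

(** The events decrease to the empty set as [del] tends to 0, each path being uniformly continuous
    on the segment. *)
Lemma modev_small eps eta : 0 < eps -> 0 < eta ->
  exists2 del, 0 < del & (P (modev f del eta) <= eps%:E)%E.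
Proof.
move=> eps0 eta0.
pose F (j : nat) := modev f j.+1%:R^-1 eta.
have F0 : \bigcap_j F j = set0.
  apply/seteqP; split=> // x H.
  have [del del0 Hd] := uniform_continuity_segment M (@cf x) eta0.
  have /andP[_ h] := truncn_itv (ltW (etrans (invr_gt0 del) del0)).
  have [u [v [uM vM uv]]] := H (Num.truncn del^-1) I.
  rewrite ltNge => /negP; apply; apply: Hd => //; apply: (lt_le_trans uv).
  by rewrite invf_ple ?posrE// ltW.
have : (P \o F) j @[j --> \oo] --> P (\bigcap_j F j).
  apply: nonincreasing_cvg_mu.
  - by rewrite (le_lt_trans (probability_le1 _ _)) ?ltry//; exact: modev_measurable.
  - by move=> j; exact: modev_measurable.
  - by rewrite F0.
  - move=> i j ij; apply/subsetPset; apply: modev_mono.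
    by rewrite lef_pV2 ?posrE// ler_nat ltnS.
rewrite F0 measure0 => /fine_cvgP[_ /cvgrPdist_lt/(_ _ eps0)[N _ /(_ N (leqnn N))]] /=.
rewrite sub0r normrN => H; exists N.+1%:R^-1; first by rewrite invr_gt0.
have Pf : P (F N) \is a fin_num by apply: fin_num_measure; exact: modev_measurable.
by rewrite -[P _]fineK// lee_fin; apply/ltW; exact: le_lt_trans (ler_norm _) H.
Qed.

End fixed_process.

Variable X : nat -> T -> R -> R.
Hypothesis cX : forall n x, continuous (X n x).
Hypothesis mX : forall n u, measurable_fun setT (fun x => X n x u : mR).

Lemma pbdE A e : measurable A -> pbd P A e -> (P A <= e%:E)%E.
Proof. by move=> mA [B [mB AB PB]]; apply: le_trans PB; apply: le_measure; rewrite ?inE. Qed.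

(** The threshold [N] of the hypothesis varies with [eps] and [eta], but countably many moduli must
    hold for the same [n]. The finitely many earlier processes are therefore included by shrinking
    [del]. *)
Lemma modev_small_all eps eta : 0 < eps -> 0 < eta ->
  (exists del N, 0 < del /\ forall n, (N <= n)%N -> pbd P (modev (X n) del eta) eps) ->
  exists2 del, 0 < del & forall n, (P (modev (X n) del eta) <= eps%:E)%E.
Proof.
move=> eps0 eta0 [del [N [del0 H]]].
have mm n d' := modev_measurable (@cX n) (@mX n) d' eta.
have [del' del'0 H'] : exists2 del', 0 < del' & forall n, (n < N)%N -> (P (modev (X n) del' eta) <= eps%:E)%E.
  elim: (N) => [|k [d1 d10 H1]]; first by exists 1.
  have [d2 d20 H2] := modev_small (@cX k) (@mX k) eps0 eta0.
  exists (Num.min d1 d2); first by rewrite lt_min d10.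
  move=> n; rewrite ltnS leq_eqVlt => /orP[/eqP->|nk].
    apply: le_trans H2; apply: le_measure; rewrite ?inE//; apply: modev_mono.
    by rewrite ge_min lexx orbT.
  apply: le_trans (H1 _ nk); apply: le_measure; rewrite ?inE//; apply: modev_mono.
  by rewrite ge_min lexx.
exists (Num.min del del'); first by rewrite lt_min del0.
move=> n; have [nN|Nn] := ltnP n N.
  apply: le_trans (H' _ nN); apply: le_measure; rewrite ?inE//; apply: modev_mono.
  by rewrite ge_min lexx orbT.
apply: le_trans (pbdE (mm _ _) (H _ Nn)); apply: le_measure; rewrite ?inE//; apply: modev_mono.
by rewrite ge_min lexx.
Qed.

Lemma tightness_criterion :
  (forall eps, 0 < eps -> exists A N, forall n, (N <= n)%N -> pbd P [set x | A < `|X n x 0|] eps) ->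
  (forall eps eta, 0 < eps -> 0 < eta -> exists del N, 0 < del /\
    forall n, (N <= n)%N -> pbd P (modev (X n) del eta) eps) ->
  forall eps, 0 < eps -> exists A dk N, (forall k, 0 < dk k) /\ forall n, (N <= n)%N ->
    measurable [set x | equi_bounded M A dk (X n x)] /\
    ((1 - eps)%:E <= P [set x | equi_bounded M A dk (X n x)])%E.
Proof.
move=> H0 Hm eps eps0; have e20 : 0 < eps / 2 by exact: divr_gt0.
have [A [N HA]] := H0 _ e20.
(* Half of [eps] goes to the value at 0; the other half is shared among the moduli as a geometric
   series. *)
have ek0 k : 0 < eps / 2 / (2 ^ k.+1)%:R by rewrite divr_gt0// ltr0n expn_gt0.
have /choice[dk dkP] : forall k, exists dl, 0 < dl /\
    forall n, (P (modev (X n) dl k.+1%:R^-1) <= (eps / 2 / (2 ^ k.+1)%:R)%:E)%E.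
  move=> k; have k0 : (0 : R) < k.+1%:R^-1 by rewrite invr_gt0.
  by have [dl dl0 Hd] := modev_small_all (ek0 k) k0 (Hm _ _ (ek0 k) k0); exists dl.
exists A, dk, N; split=> [k|n Nn]; first by case: (dkP k).
set E := [set x | _].
have mE0 : measurable [set x | A < `|X n x 0|].
  rewrite -[X in measurable X]setTI.
  have -> : [set x | A < `|X n x 0|] = (fun x => `|X n x 0| : mR) @^-1` `]A, +oo[%classic.
    by apply/seteqP; split=> x /=; rewrite in_itv/= andbT.
  have mn : measurable_fun setT (fun x => `|X n x 0| : mR).
    by apply: measurableT_comp; [exact: normr_measurable|exact: mX].
  by apply: mn => //; exact: measurable_itv.
have mm k := modev_measurable (@cX n) (@mX n) (dk k) k.+1%:R^-1.
have EC : ~` E = [set x | A < `|X n x 0|] `|` \bigcup_k modev (X n) (dk k) k.+1%:R^-1.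
  apply/seteqP; split=> x.
    move=> nE; have [xA|] := leP (`|X n x 0|) A; last by left.
    right; apply: contrapT => nU; apply: nE; split=> // k u v uM vM uv.
    by rewrite leNgt; apply/negP => h; apply: nU; exists k => //; exists u, v.
  move=> H [xA Hk]; case: H => [|[k _ [u [v [uM vM uv]]]]]; rewrite /= ltNge.
    by rewrite xA.
  by rewrite Hk.
have mU : measurable (\bigcup_k modev (X n) (dk k) k.+1%:R^-1) by exact: bigcupT_measurable.
have mE : measurable E by rewrite -[E]setCK EC; apply: measurableC; exact: measurableU.
split=> //; rewrite -[E]setCK EC probability_setC; last exact: measurableU.
rewrite EFinB; apply: leeB => //.
apply: (le_trans (measureU2 _ mE0 mU)).
rewrite [eps]splitr EFinD; apply: leeD; first exact: pbdE mE0 (HA _ Nn).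
apply: (le_trans (measure_sigma_subadditive _ mm mU (@subset_refl _ _))).
apply: (le_trans _ (epsilon_trick0 xpredT (ltW e20))).
apply: lee_nneseries => [k _ _|k _]; first exact: measure_ge0.
by have [_] := dkP k; apply.
Qed.

End tightness_criterion.

(** * Interpolation and centering *)

Section interpolation.
Context (R : realType).
Implicit Types (F : int -> R) (t s c r : R).

Definition interp F t : R :=
  (1 - (t - (Num.floor t)%:~R)) * F (Num.floor t) + (t - (Num.floor t)%:~R) * F (Num.floor t + 1).

Lemma interp_continuous F : continuous (interp F).
Proof.
move=> t; set k := Num.floor t.
(* Near [t] the interpolation is linear on each side of $k=\lfloor t\rfloor$; this formula also
   covers the corner when [t] is an integer. *)
pose G (z : R) : R := F k + (F (k + 1) - F k) * Num.max (z - k%:~R) 0 +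
  (F k - F (k - 1)) * Num.min (z - k%:~R) 0.
have /andP[k1 k2] := floor_itv t; rewrite -/k in k1 k2.
have eqG : \forall z \near t, G z = interp F z.
  have : nbhs t [set z | k%:~R - 1 < z < k%:~R + 1].
    have h : k%:~R - 1 < t < k%:~R + 1.
      by move: k1 k2; rewrite intrD => k1 k2; apply/andP; split; lra.
    have := @near_in_itvoo R (k%:~R - 1) (k%:~R + 1) t.
    by rewrite in_itv/= => /(_ h); apply: filterS => z; rewrite in_itv.
  apply: filterS => z /andP[z1 z2]; rewrite /G /interp.
  have [kz|zk] := leP (k%:~R) z.
    have -> : Num.floor z = k by apply: floor_def; rewrite kz intrD.
    rewrite max_l ?subr_ge0// min_r ?subr_ge0//; ring.
  have -> : Num.floor z = k - 1.
    by apply: floor_def; rewrite subrK zk andbT intrB ltW.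
  rewrite max_r ?subr_le0 ?ltW// min_l ?subr_le0 ?ltW// subrK intrB; ring.
rewrite /continuous_at; have -> : interp F t = G t by apply/esym; exact: nbhs_singleton eqG.
apply: (cvg_trans (near_eq_cvg eqG)).
have ck : {for t, continuous (fun z : R => z - k%:~R)} by apply: cvgB; [exact: cvg_id|exact: cvg_cst].
have c0 : {for t, continuous (fun _ : R => 0 : R)} by exact: cvg_cst.
apply: cvgD; [apply: cvgD; [exact: cvg_cst|]|]; (apply: cvgM; first exact: cvg_cst).
- exact: (continuous_max ck c0).
- exact: (continuous_min ck c0).
Qed.

Lemma interp_affine F c t :
  interp (fun i => F i - c * i%:~R) t = interp F t - c * t.
Proof. by rewrite /interp intrD; ring. Qed.

Lemma interp_dist F t c r :
  `|F (Num.floor t) - c| <= r -> `|F (Num.floor t + 1) - c| <= r -> `|interp F t - c| <= r.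
Proof.
rewrite /interp; have /andP[k1 k2] := floor_itv t; rewrite intrD in k2.
set k := Num.floor t in k1 k2 *; move: (F k) (F (k + 1)) => a b h1 h2.
set th := t - k%:~R.
have th0 : 0 <= th by rewrite subr_ge0.
have th1 : 0 <= 1 - th by rewrite subr_ge0 /th lerBlDr addrC ltW.
rewrite (_ : _ - c = (1 - th) * (a - c) + th * (b - c)); last by ring.
apply: (le_trans (ler_normD _ _)); rewrite !normrM (ger0_norm th0) (ger0_norm th1).
have -> : r = (1 - th) * r + th * r by ring.
by apply: lerD; apply: ler_wpM2l.
Qed.

Lemma interp_dist2 F t s r :
  (forall a b : int, (0 <= a - Num.floor t <= 1)%R -> (0 <= b - Num.floor s <= 1)%R ->
    `|F a - F b| <= r) ->
  `|interp F t - interp F s| <= r.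
Proof.
move=> H; apply: interp_dist; rewrite distrC; apply: interp_dist; rewrite distrC; apply: H;
  by rewrite ?subrr ?[_ + 1]addrC ?addrK.
Qed.

(** Indices at distance at most [b] lie in the same block or in adjacent ones; in the second case
    the passage through the common end costs three oscillations. *)
Lemma blocks_close (f : nat -> R) (p0 b J : nat) (E : R) : 0 <= E ->
  (forall j k, (j < J)%N -> (k <= b)%N -> `|f (p0 + j * b + k)%N - f (p0 + j * b)%N| <= E) ->
  forall i i', (p0 <= i)%N -> (i <= i')%N -> (i' <= p0 + J * b)%N -> (i' <= i + b)%N ->
  `|f i' - f i| <= 3 * E.
Proof.
move=> E0 H i i' pi ii' iJ ib.
have [->|ne] := eqVneq i i'; first by rewrite subrr normr0 mulr_ge0.
have b0 : (0 < b)%N by lia.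
pose j := ((i - p0) %/ b)%N; pose k := ((i - p0) %% b)%N.
have iE : i = (p0 + j * b + k)%N by rewrite -addnA -divn_eq; lia.
have kb : (k < b)%N by rewrite ltn_pmod.
have jJ : (j < J)%N by rewrite -(ltn_pmul2r b0); lia.
have h1 := H j k jJ (ltnW kb); rewrite -iE in h1.
have [kb'|kb'] := leqP (k + (i' - i))%N b.
  have h2 := H j _ jJ kb'; rewrite (_ : (p0 + j * b + (k + (i' - i)))%N = i') in h2; last by lia.
  rewrite (_ : f i' - f i = (f i' - f (p0 + j * b)%N) - (f i - f (p0 + j * b)%N)); last by ring.
  by apply: (le_trans (ler_normB _ _)); lra.
have jJ' : (j.+1 < J)%N by rewrite -(ltn_pmul2r b0) mulSn; lia.
have h3 := H j b jJ (leqnn b).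
have kb2 : (k + (i' - i) - b <= b)%N by lia.
have h2 := H j.+1 _ jJ' kb2.
rewrite (_ : (p0 + j.+1 * b + (k + (i' - i) - b))%N = i') in h2; last by rewrite mulSn; lia.
rewrite (_ : (p0 + j.+1 * b)%N = (p0 + j * b + b)%N) in h2; last by rewrite mulSn; lia.
rewrite (_ : f i' - f i = (f i' - f (p0 + j * b + b)%N) + (f (p0 + j * b + b)%N - f (p0 + j * b)%N)
  - (f i - f (p0 + j * b)%N)); last by ring.
apply: (le_trans (ler_normB _ _)); apply: (le_trans (lerD (ler_normD _ _) (lexx _))); lra.
Qed.

Lemma sqrt_near (g y : R) (s := Num.sqrt y) : 0 < g -> g ^+ 2 / 4 <= y ->
  [/\ s ^+ 2 = y, g / 2 <= s & `|s - g| <= `|y - g ^+ 2| / g].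
Proof.
move=> g0 gy; have g20 : 0 < g ^+ 2 by rewrite exprn_gt0.
have y0 : 0 <= y by lra.
have s0 : 0 <= s by rewrite sqrtr_ge0.
have sE : s ^+ 2 = y by rewrite sqr_sqrtr.
split=> //; first by nra.
rewrite ler_pdivlMr// -sE subr_sqr normrM ler_wpM2l//.
by rewrite ger0_norm ?lerDr// addr_ge0// ltW.
Qed.

(* With [x = n y], the centering [n (1 + sqrt y)^2] equals [n + x + 2 n sqrt y],
   and its slope in [x] at [y = g^2] is [1 + 1 / g]. *)
Lemma centering_increment (g n q be M u v : R) (y := fun u => g ^+ 2 + be * u * q^-1) :
  0 < g -> 0 < q -> q ^+ 3 = n -> 0 < be -> 0 < M -> be * M / q <= 3 / 4 * g ^+ 2 ->
  `|u| <= M -> `|v| <= M ->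
  `|(n * (1 + Num.sqrt (y u)) ^+ 2 - n * (1 + Num.sqrt (y v)) ^+ 2) -
    (1 + g^-1) * (n * y u - n * y v)| <= 2 * be ^+ 2 * M / g ^+ 3 * `|u - v| * q.
Proof.
move=> g0 q0 qn be0 M0 small uM vM.
have n0 : 0 < n by rewrite -qn exprn_gt0.
have yg w : `|w| <= M -> `|y w - g ^+ 2| <= be * M / q.
  move=> wM; rewrite /y addrC addKr !normrM normfV (gtr0_norm be0) (gtr0_norm q0).
  by rewrite ler_pM2r ?invr_gt0// ler_pM2l.
have yl w : `|w| <= M -> g ^+ 2 / 4 <= y w.
  by move=> /yg; rewrite ler_norml => /andP[+ _]; move: small; clear; lra.
have [suE su sug] := sqrt_near g0 (yl _ uM).
have [svE sv svg] := sqrt_near g0 (yl _ vM).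
set a := Num.sqrt (y u) in suE su sug *; set b := Num.sqrt (y v) in svE sv svg *.
have g_0 : g != 0 by rewrite gt_eqF.
(* The remainder is exactly a product containing $a-b$ and $a+b-2g$, both of order $1/q$. *)
have -> : n * (1 + a) ^+ 2 - n * (1 + b) ^+ 2 - (1 + g^-1) * (n * y u - n * y v) =
    - (n * (a - b) * ((a - g) + (b - g)) / g).
  by rewrite -suE -svE; field.
have ab : `|a - b| <= be * `|u - v| / q / g.
  rewrite ler_pdivlMr//.
  have -> : be * `|u - v| / q = `|y u - y v|.
    rewrite (_ : y u - y v = be * (u - v) * q^-1); last by rewrite /y; ring.
    by rewrite !normrM normfV (gtr0_norm be0) (gtr0_norm q0).
  rewrite -suE -svE subr_sqr normrM ler_wpM2l// ger0_norm; move: su sv g0; clear; lra.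
have agb : `|(a - g) + (b - g)| <= 2 * (be * M / q / g).
  apply: (le_trans (ler_normD _ _)).
  have h1 : `|a - g| <= be * M / q / g.
    by apply: (le_trans sug); rewrite ler_pM2r ?invr_gt0//; exact: yg.
  have h2 : `|b - g| <= be * M / q / g.
    by apply: (le_trans svg); rewrite ler_pM2r ?invr_gt0//; exact: yg.
  by move: h1 h2; clear; lra.
rewrite normrN !normrM normfV (gtr0_norm g0) (gtr0_norm n0).
apply: (@le_trans _ _ (n * (be * `|u - v| / q / g) * (2 * (be * M / q / g)) / g)).
  rewrite ler_pM2r ?invr_gt0//; apply: ler_pM => //; first by rewrite mulr_ge0// ltW.
  by rewrite ler_pM2l.
rewrite -qn le_eqVlt; apply/orP; left; apply/eqP.
by field; rewrite g_0 gt_eqF.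
Qed.

End interpolation.

Section rescaled_process.
Context (R : realType).

Lemma cube_root (n : nat) (q := powR (n%:R : R) (1 / 3)) :
  [/\ q ^+ 3 = n%:R, powR (n%:R : R) (2 / 3) = q ^+ 2 & powR (n%:R : R) (- (1 / 3)) = q^-1].
Proof.
have n0 : (0 : R) <= n%:R by [].
split; last by rewrite powRN.
- by rewrite -powR_mulrn ?powR_ge0// -powRrM div1r mulVf ?pnatr_eq0// powRr1.
- by rewrite -powR_mulrn ?powR_ge0// -powRrM; congr (_ `^ _); field.
Qed.

Lemma cube_root_large (Q : R) : exists N : nat, forall n, (N <= n)%N -> Q <= powR n%:R (1 / 3).
Proof.
have [Q0|Q0] := leP Q 0; first by exists 0%N => n _; rewrite (le_trans Q0)// powR_ge0.
exists (Num.truncn (Q ^+ 3)).+1 => n Nn.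
have Q30 : 0 <= Q ^+ 3 by rewrite exprn_ge0// ltW.
have /andP[_ h] := truncn_itv Q30.
have [q3 _ _] := cube_root n.
rewrite -(@ler_pXn2r _ 3)// ?nnegrE ?powR_ge0 ?(ltW Q0)//.
by rewrite q3; apply: (le_trans (ltW h)); rewrite ler_nat.
Qed.

Variables (om : nat -> nat -> R) (g : R).
Hypothesis g0 : 0 < g.

Lemma LrescE n u (q := powR (n%:R : R) (1 / 3)) : 0 < q -> Lresc om g n u =
  (interp (fun a => LPPz om a n) (n%:R * (g ^+ 2 + beta1 g * u * q^-1)) -
   n%:R * (1 + Num.sqrt (g ^+ 2 + beta1 g * u * q^-1)) ^+ 2) / (beta2 g * q).
Proof.
move=> q0; have [q3 q2 qV] := cube_root n.
have xE : g ^+ 2 * n%:R + beta1 g * u * q ^+ 2 = n%:R * (g ^+ 2 + beta1 g * u * q^-1).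
  by rewrite -q3 -/q; field; rewrite gt_eqF.
by rewrite /Lresc q2 qV -/q xE.
Qed.

Lemma Lresc_continuous n : continuous (Lresc om g n).
Proof.
have -> : Lresc om g n = fun u =>
  (interp (fun a => LPPz om a n) (g ^+ 2 * n%:R + beta1 g * u * powR n%:R (2/3)) -
   n%:R * (1 + Num.sqrt (g ^+ 2 + beta1 g * u * powR n%:R (- (1/3)))) ^+ 2) / (beta2 g * powR n%:R (1/3)).
  by [].
have lin (a b c : R) : continuous (fun u : R => a + b * u * c).
  move=> u; apply: cvgD; first exact: cvg_cst.
  by apply: cvgM; [apply: cvgM; [exact: cvg_cst|exact: cvg_id]|exact: cvg_cst].
move=> u; apply: cvgM; last exact: cvg_cst; apply: cvgB.
  exact: (continuous_comp (lin _ _ _ u) (@interp_continuous _ _ _)).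
apply: cvgM; first exact: cvg_cst.
have h : {for u, continuous (fun u => 1 + Num.sqrt (g ^+ 2 + beta1 g * u * powR n%:R (- (1/3))))}.
  apply: cvgD; first exact: cvg_cst.
  exact: (continuous_comp (lin _ _ _ u) (@sqrt_continuous _ _)).
exact: (cvgM h h).
Qed.

Lemma beta1_gt0 : 0 < beta1 g.
Proof. by rewrite /beta1 !mulr_gt0// powR_gt0// addr_gt0. Qed.

Lemma beta2_gt0 : 0 < beta2 g.
Proof. by rewrite /beta2 mulr_gt0// powR_gt0// addr_gt0. Qed.

(** The slope $1+1/g=(g/(1+g))^{-1}$ is both the mean increment along the row and the derivative of
    the centering, so it cancels. What remains is three block oscillations and the second-order
    error of the centering. *)
Lemma Lresc_modulus (n p0 b J : nat) (M dl e1 del : R) (q := powR (n%:R : R) (1 / 3)) :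
  0 < q -> 0 < M -> 0 <= e1 ->
  p0%:R <= g ^+ 2 * n%:R - beta1 g * M * q ^+ 2 ->
  g ^+ 2 * n%:R + beta1 g * M * q ^+ 2 + 1 <= (p0 + J * b)%:R ->
  dl * q ^+ 2 <= b%:R -> 4 <= dl * q ^+ 2 -> beta1 g * del <= dl / 2 ->
  beta1 g * M / q <= 3 / 4 * g ^+ 2 ->
  (forall j k, (j < J)%N -> (k <= b)%N ->
     `|LPP om (p0 + j * b + k)%N n - LPP om (p0 + j * b)%N n - k%:R / (g / (1 + g))| <= e1 * q) ->
  forall u v, - M <= u <= M -> - M <= v <= M -> `|u - v| < del ->
  `|Lresc om g n u - Lresc om g n v| <= (3 * e1 + 2 * beta1 g ^+ 2 * M / g ^+ 3 * del) / beta2 g.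
Proof.
move=> q0 M0 e10 hp hJ hb hb4 hdel small H u v uM vM uv.
have [qn _ _] := cube_root n; rewrite -/q in qn.
have b10 := beta1_gt0; have b20 := beta2_gt0.
rewrite !LrescE//; set be := beta1 g in b10 hp hJ hdel small *.
have q_0 : q != 0 by rewrite gt_eqF.
have g_0 : g != 0 by rewrite gt_eqF.
have q20 : 0 < q ^+ 2 by rewrite exprn_gt0.
pose y w := g ^+ 2 + be * w * q^-1.
pose x w := n%:R * y w.
have xE w : x w = g ^+ 2 * n%:R + be * w * q ^+ 2 by rewrite /x /y -qn; field.
have xlow w : - M <= w <= M -> p0%:R <= x w /\ x w + 1 <= (p0 + J * b)%:R.
  move=> /andP[w1 w2]; rewrite xE; split.
    apply: (le_trans hp); rewrite lerD2l -mulNr ler_pM2r//.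
    by rewrite -mulrN ler_pM2l.
  apply: le_trans hJ; rewrite lerD2r lerD2l ler_pM2r// ler_pM2l//.
pose c := 1 + g^-1.
have cE : c = (g / (1 + g))^-1.
  by rewrite /c; field; rewrite g_0 gt_eqF// addr_gt0.
pose f (i : nat) := LPP om i n - c * i%:R.
have fH := @blocks_close R f p0 b J (e1 * q) (mulr_ge0 e10 (ltW q0)).
have Fb : forall j k, (j < J)%N -> (k <= b)%N -> `|f (p0 + j * b + k)%N - f (p0 + j * b)%N| <= e1 * q.
  move=> j k jJ kb; have := H j k jJ kb; rewrite -cE /f.
  rewrite (_ : LPP om (p0 + j * b + k) n - c * _ - _ = LPP om (p0 + j * b + k) n - LPP om (p0 + j * b) n - k%:R * c)//.
  by rewrite [in c * (p0 + j * b + k)%:R]natrD; ring.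
have {}fH := fH Fb.
(* [a] and [a'] are interpolation nodes of two nearby abscissae. They are at most $dl\,q^2/2+2\le
   dl\,q^2\le b$ apart, the 2 being the cost of rounding. *)
have close w z : - M <= w <= M -> - M <= z <= M -> `|w - z| < del ->
    forall a a' : int, (0 <= a - Num.floor (x w) <= 1)%R -> (0 <= a' - Num.floor (x z) <= 1)%R -> (a <= a')%R ->
    `|(LPPz om a' n - c * a'%:~R) - (LPPz om a n - c * a%:~R)| <= 3 * (e1 * q).
  move=> wM zM wz a a' /andP[a1 _] /andP[_ a'1] aa.
  have [pw _] := xlow _ wM; have [_ zJ] := xlow _ zM.
  have /andP[f1 f2] := floor_itv (x w); have /andP[f3 _] := floor_itv (x z).
  have pf : (p0%:Z <= Num.floor (x w))%R by rewrite floor_ge_int -pmulrn.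
  have a0 : (0 <= a)%R.
    by rewrite -(subrK (Num.floor (x w)) a); apply: addr_ge0 => //; apply: le_trans pf.
  have [i aE] : exists i : nat, a = i by exists `|a|%N; rewrite gez0_abs.
  have [i' a'E] : exists i' : nat, a' = i' by exists `|a'|%N; rewrite gez0_abs// (le_trans a0).
  subst a a'.
  have fa : (Num.floor (x w))%:~R <= i%:R :> R.
    by rewrite [i%:R]pmulrn ler_int; move: a1; clear; lia.
  have fa' : i'%:R <= (Num.floor (x z))%:~R + 1 :> R.
    by rewrite [i'%:R]pmulrn -[1]/(1%:~R) -intrD ler_int; move: a'1; clear; lia.
  rewrite -!pmulrn /LPPz !ltNge !lez_nat /= -!/(f _); apply: fH.
  - by move: pf a1; clear; lia.
  - by move: aa; clear; lia.
  - by rewrite -(ler_nat R); apply: le_trans zJ; apply: (le_trans fa'); rewrite lerD2r.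
  rewrite -(ler_nat R) natrD.
  have xx : x z - x w <= dl * q ^+ 2 / 2.
    rewrite !xE (_ : _ - _ = be * (z - w) * q ^+ 2); last by ring.
    apply: (@le_trans _ _ (dl / 2 * q ^+ 2)); last by clear; lra.
    rewrite ler_pM2r//; apply: le_trans hdel; rewrite ler_pM2l//.
    by apply: (le_trans (ler_norm _)); rewrite distrC ltW.
  by rewrite intrD in f2; move: fa fa' f2 f3 xx hb hb4; clear; lra.
set Phi := interp (fun a => LPPz om a n - c * a%:~R).
have PhiE w : interp (fun a => LPPz om a n) (x w) = Phi (x w) + c * x w.
  by rewrite /Phi interp_affine subrK.
have dPhi : `|Phi (x u) - Phi (x v)| <= 3 * (e1 * q).
  apply: interp_dist2 => a a' au a'v; case/orP: (le_total a a') => aa.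
    rewrite distrC; exact: (close u v).
  by apply: (close v u) => //; rewrite distrC.
rewrite -!/(x _) -!/(y _) !PhiE.
have uM' : `|u| <= M by rewrite ler_norml.
have vM' : `|v| <= M by rewrite ler_norml.
have dm := @centering_increment R g n%:R q be M u v g0 q0 qn b10 M0 small uM' vM'.
rewrite -!/(y _) -!/(x _) -/c in dm.
set mu := n%:R * _ in dm *; set mv := n%:R * (1 + Num.sqrt (y v)) ^+ 2 in dm *.
rewrite (_ : _ - _ = ((Phi (x u) - Phi (x v)) - (mu - mv - c * (x u - x v))) / (beta2 g * q)); last first.
  by ring.
rewrite normrM normfV (gtr0_norm (mulr_gt0 b20 q0)) ler_pdivrMr; last exact: mulr_gt0.
rewrite mulrA divfK ?gt_eqF//.
apply: (le_trans (ler_normB _ _)); rewrite [leRHS]mulrDl; apply: lerD; first by rewrite -mulrA.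
apply: (le_trans dm); rewrite ler_pM2r//; apply: ler_wpM2l; last exact: ltW.
apply: divr_ge0; last by rewrite exprn_ge0// ltW.
by apply: mulr_ge0; [rewrite mulr_ge0// exprn_ge0// ltW|exact: ltW].
Qed.

End rescaled_process.

(** * Tightness of the rescaled process *)

Section assembly.
Context d (T : measurableType d) (R : realType) (P : probability T R).
Variable om : nat -> nat -> {RV P >-> R}.
Hypothesis iid : iid_exp1 P om.
Local Notation mR := (measurableTypeR R).
Local Notation omx x := (fun i j => om i j x).

Lemma LPP_measurable m n : measurable_fun setT (fun x => LPP (omx x) m n : mR).
Proof.
have mw (t : (m + n).-tuple bool) : measurable_fun setT (fun x => path_weight (omx x) t : mR).
  rewrite /path_weight; apply: measurable_sum => k; rewrite /site_weight.
  case: (boolP (_ && _)) => _; last exact: measurable_cst.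
  exact (measurable_funP (om _ _)).
rewrite /LPP; elim: (index_enum _) => [|t l IH].
  by apply: (eq_measurable_fun _ _ (mw (first_path m n))) => x _; rewrite big_nil.
case: (boolP (count id t == m)) => tm.
  apply: (eq_measurable_fun _ _ (measurable_maxr (mw t) IH)) => x _; by rewrite big_cons tm.
by apply: (eq_measurable_fun _ _ IH) => x _; rewrite big_cons (negbTE tm).
Qed.

Lemma Lresc_measurable g n u : measurable_fun setT (fun x => Lresc (omx x) g n u : mR).
Proof.
have mz a : measurable_fun setT (fun x => LPPz (omx x) a n : mR).
  rewrite /LPPz; case: (boolP (a < 0)) => _; [exact: measurable_cst|exact: LPP_measurable].
rewrite /Lresc; apply: measurable_funM; last exact: measurable_cst.
apply: measurable_funB; last exact: measurable_cst.
by apply: measurable_funD; apply: measurable_funM; (exact: measurable_cst || exact: mz).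
Qed.

Lemma negative_weight : pbd P [set x | exists i j, om i j x < 0] 0.
Proof.
have H i j : P [set x | om i j x < 0] = 0.
  have [_ /(_ i j `]-oo, 0[%classic (measurable_itv _))] := iid.
  rewrite (_ : _ @^-1` _ = [set x | om i j x < 0]); last first.
    by apply/seteqP; split=> x /=; rewrite in_itv.
  move=> ->; apply: integral0_eq => x; rewrite /= in_itv/= => x0.
  by rewrite lt0_exponential_pdf.
have mN i j : measurable [set x | om i j x < 0].
  rewrite (_ : [set x | om i j x < 0] = om i j @^-1` `]-oo, 0[%classic).
    by rewrite -[X in measurable X]setTI; apply: (measurable_funP (om i j)) => //; exact: measurable_itv.
  by apply/seteqP; split=> x /=; rewrite in_itv.
have [B [mB PB0 NB]] : P.-negligible (\bigcup_i \bigcup_j [set x | om i j x < 0]).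
  by apply: negligible_bigcup => i; apply: negligible_bigcup => j; apply/(negligibleP P (mN i j)); exact: H.
exists B; split=> //; last by rewrite PB0.
by move=> x [i [j h]]; apply: NB; exists i => //; exists j.
Qed.

Lemma LPP_gfield m n x : ~ (exists i j, om i j x < 0) ->
  LPP (omx x) m n = gfield (swfield om n) 0 0 x m n.
Proof.
move=> H; apply: LPP_glpp => i j _ _; rewrite /swfield /wt /sw_index /= max_l//.
by rewrite leNgt; apply/negP => h; apply: H; exists i, j.
Qed.

(** At $u=0$ the abscissa is $g^2n$ and the centering $n(1+g)^2$; both neighbouring integers are
    within the distance 2 allowed by [onepoint_tight]. *)
Lemma Lresc_onepoint g eps : 0 < g -> 0 < eps ->
  exists A N, forall n, (N <= n)%N -> pbd P [set x | A < `|Lresc (omx x) g n 0|] eps.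
Proof.
move=> g0 eps0; have e20 : 0 < eps / 2 by exact: divr_gt0.
have [A [Q [A0 Q0 H]]] := onepoint_tight iid g0 e20.
have [N HN] := cube_root_large Q.
exists (A / beta2 g), N => n Nn.
have b20 := beta2_gt0 g0.
have [q3 _ _] := cube_root R n; set q := powR _ _ in q3.
have Qq : Q <= q by exact: HN.
have q0 : 0 < q by exact: lt_le_trans Qq.
set y := g ^+ 2 * n%:R.
have y0 : 0 <= y by rewrite mulr_ge0// exprn_ge0// ltW.
have /andP[f1 f2] := floor_itv y; rewrite intrD in f2.
have [m mE] : exists m : nat, Num.floor y = m by exists `|Num.floor y|%N; rewrite gez0_abs// floor_ge_int.
rewrite mE -pmulrn in f1 f2.
have h1 : `|m%:R - y| <= 2 by rewrite ler_norml; move: f1 f2; clear; lra.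
have h2 : `|m.+1%:R - y| <= 2 by rewrite -natr1 ler_norml; move: f1 f2; clear; lra.
have := pbdU negative_weight (pbdU (H _ _ _ q3 Qq h1) (H _ _ _ q3 Qq h2)).
rewrite add0r -splitr; apply: pbd_sub => x /= Hx.
apply: contrapT => /not_orP[nn /not_orP[/negP n1 /negP n2]].
rewrite -!leNgt -!LPP_gfield// in n1 n2.
move: Hx; apply/negP; rewrite -leNgt LrescE//.
rewrite mulr0 mul0r addr0 sqrtr_sqr (gtr0_norm g0) [n%:R * g ^+ 2]mulrC -/y.
rewrite normrM normfV (gtr0_norm (mulr_gt0 b20 q0)) ler_pdivrMr; last exact: mulr_gt0.
rewrite [leRHS]mulrA divfK ?gt_eqF//; apply: interp_dist.
  by rewrite mE.
by rewrite mE -PoszD addn1.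
Qed.

Lemma Lresc_modev g M eps eta : 0 < g -> 0 < M -> 0 < eps -> 0 < eta ->
  exists del N, 0 < del /\ forall n, (N <= n)%N ->
    pbd P (modev M (fun x => Lresc (omx x) g n) del eta) eps.
Proof.
move=> g0 M0 eps0 eta0.
have b10 := beta1_gt0 g0; have b20 := beta2_gt0 g0.
(* The block oscillations contribute $3e_1/\beta_2=\eta/2$; the second bound in [del] leaves the
   other half for the centering. *)
pose e1 := eta * beta2 g / 6.
have e10 : 0 < e1 by rewrite divr_gt0// mulr_gt0.
have B0 : 0 < beta1 g * M by rewrite mulr_gt0.
have [dl [Q [dl0 Q0 H]]] := modulus_int iid g0 B0 eps0 e10.
pose C := 2 * beta1 g ^+ 2 * M / g ^+ 3.
have C0 : 0 < C by rewrite /C divr_gt0 ?exprn_gt0// mulr_gt0// mulr_gt0// exprn_gt0.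
pose del := Num.min (dl / 2 / beta1 g) (eta * beta2 g / 2 / C).
have del0 : 0 < del.
  rewrite lt_min; apply/andP; split; apply: divr_gt0 => //; apply: divr_gt0 => //.
  exact: mulr_gt0.
pose Q1 := Q + (1 + 4 / dl) + beta1 g * M / (3 / 4 * g ^+ 2).
have [N HN] := cube_root_large Q1.
exists del, N; split=> // n Nn.
have [q3 _ _] := cube_root R n; set q := powR _ _ in q3.
have d40 : 0 < 4 / dl by exact: divr_gt0.
have g340 : 0 < 3 / 4 * g ^+ 2 by rewrite mulr_gt0// exprn_gt0.
have B30 : 0 < beta1 g * M / (3 / 4 * g ^+ 2) by exact: divr_gt0.
have Qq : Q1 <= q by exact: HN.
have [qQ q1 q4 qB] : [/\ Q <= q, 1 <= q, 4 / dl <= q & beta1 g * M / (3 / 4 * g ^+ 2) <= q].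
  by move: Qq Q0 d40 B30; rewrite /Q1; clear; split; lra.
have q0 : 0 < q by exact: lt_le_trans qQ.
have [p0 [b [J [h1 h2 h3 h4]]]] := H n q q3 qQ.
have := pbdU negative_weight h4; rewrite add0r; apply: pbd_sub => x /= [u [v [uM vM uv Hx]]].
apply: contrapT => /not_orP[nn n1].
move: Hx; apply/negP; rewrite -leNgt.
have db : beta1 g * del <= dl / 2 by rewrite mulrC -ler_pdivlMr// ge_min lexx.
have q22 : 4 <= dl * q ^+ 2.
  rewrite mulrC -ler_pdivrMr//; apply: (le_trans q4); rewrite expr2 ler_peMr//; exact: ltW.
have qb : beta1 g * M / q <= 3 / 4 * g ^+ 2 by rewrite ler_pdivrMr// [leRHS]mulrC -ler_pdivrMr.
have blk j k : (j < J)%N -> (k <= b)%N ->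
    `|LPP (omx x) (p0 + j * b + k)%N n - LPP (omx x) (p0 + j * b)%N n - k%:R / (g / (1 + g))| <= e1 * q.
  move=> jJ kb; rewrite leNgt !LPP_gfield//; apply/negP => h; apply: n1.
  by exists j => //; exists k.
apply: (le_trans (Lresc_modulus g0 q0 M0 (ltW e10) h1 h2 h3 q22 db qb blk uM vM uv)).
rewrite ler_pdivrMr// -/C.
have : C * del <= eta * beta2 g / 2 by rewrite mulrC -ler_pdivlMr// ge_min lexx orbT.
by rewrite /e1; clear; lra.
Qed.

End assembly.

Theorem theorem2p2 (R : realType) (d : measure_display) (T : measurableType d)
  (P : probability T R) (om : nat -> nat -> {RV P >-> R}) (gamma M : R) :
  iid_exp1 P om -> 0 < gamma -> 0 < M ->
  forall eps : R, 0 < eps ->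
  exists K : set {uniform` (`[- M, M]%classic : set R) -> R},
    compact K /\
    (forall f, K f -> {within `[- M, M]%classic, continuous (f : R -> R)}) /\
    \forall n \near \oo,
      measurable [set x | K (Lresc (fun i j => om i j x) gamma n)] /\
      ((1 - eps)%:E <= P [set x | K (Lresc (fun i j => om i j x) gamma n)])%E.
Proof.
move=> iid g0 M0 eps eps0.
have [A [dk [N [dk0 H]]]] := tightness_criterion M0
  (fun n x => @Lresc_continuous R (fun i j => om i j x) gamma n)
  (fun n u => Lresc_measurable om gamma n u)
  (fun e e0 => Lresc_onepoint iid g0 e0)
  (fun e eta e0 eta0 => Lresc_modev iid g0 M0 e0 eta0) eps0.
exists (equi_bounded M A dk); split; first exact: compact_equi_bounded.
split; first by move=> f; exact: equi_bounded_continuous.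
by exists N => // n /= Nn; exact: H.
Qed.
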